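(* Let $M$ be a hypercomplex manifold with hypercomplex structure $H=(I_1,I_2,I_3)$, a closed two-form $\Theta$ and a rotating vector field $Z$ such that $L_Z\Theta=0$. Let $f$ be a smooth function on $M$ such that $df=-\iota_Z\Theta$ and assume that $f_1:=f-\tfrac12\Theta(Z,I_1Z)$ vanishes nowhere. Let $\pi:P\to M$ be a principal $\mathrm{U}(1)$-bundle with a connection form $\eta$ whose curvature form is $d\eta=\pi^*\big(\Theta-\tfrac12 d((\iota_Z\Theta)\circ I_1)\big)$. Assume that the quotient maps $\tilde\pi:\tilde M=\mathbb H^*\times P\to\hat M$ and $\hat\pi:\hat M\to\bar M$ are submersions, and let $(\bar M,\bar Q)$ be the resulting quaternionic manifold, $\bar\nabla$ the quaternionic connection on $\bar M$ and $X$ the vector field on $\bar M$ defined in the context. Then $X$ is an affine quaternionic vector field of $(\bar M,\bar Q,\bar\nabla)$, that is, $$L_X\Gamma(\bar Q)\subset\Gamma(\bar Q)\quad\text{and}\quad L_X\bar\nabla=0.$$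
   Context: All manifolds and maps are smooth. A quaternionic structure on a manifold $N$ is a rank-three subbundle $Q\subset\mathrm{End}(TN)$ locally spanned by $J_1,J_2,J_3$ with $J_\alpha^2=-\mathrm{id}$, $J_1J_2=-J_2J_1=J_3$, preserved by some torsion-free connection (a quaternionic connection). A hypercomplex structure on $M$ is a triple $(I_1,I_2,I_3)$ of integrable almost complex structures with $I_1I_2=-I_2I_1=I_3$; its Obata connection is the unique torsion-free connection for which all $I_\alpha$ are parallel. A vector field $Z$ is rotating if $L_ZI_1=0$ and $L_ZI_2=-2I_3$. For a one-form $\lambda$, $\lambda\circ I$ is the one-form $X\mapsto\lambda(IX)$. For a connection $\nabla$, $(L_X\nabla)_YW:=L_X(\nabla_YW)-\nabla_{L_XY}W-\nabla_Y(L_XW)$. Construction of $\hat M$. $\eta$ is a real-valued connection form, $X_P$ is the fundamental vector field on $P$ with $\eta(X_P)=1$, and $Y^{h_\eta}$ denotes the $\eta$-horizontal lift. Put $Z_1=Z^{h_\eta}+(\pi^*f_1)X_P$ on $P$. On the group $\mathbb H^*$ of non-zero quaternions let $(e_0^R,\dots,e_3^R)$ (resp. $(e_0^L,\dots,e_3^L)$) be the right-invariant (resp. left-invariant) frame equal to $(1,i,j,k)$ at $1$. Vector fields on the factors of $\tilde M=\mathbb H^*\times P$ are lifted canonically to $\tilde M$. Put $V_1=e_1^L-Z_1$. $\hat M$ is the space of integral curves of $V_1$ and $\tilde\pi:\tilde M\to\hat M$ the quotient map. Since $f_1$ has no zeros, $T\tilde M=\langle V_1\rangle\oplus T\mathbb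 H^*\oplus\mathrm{Ker}\,\eta$. Define $\tilde I_\alpha$ on $\tilde M$ by $\tilde I_\alpha V_1=0$, $\tilde I_\alpha e_0^R=e_\alpha^R$, $\tilde I_\alpha e_\alpha^R=-e_0^R$, $\tilde I_\alpha e_\beta^R=e_\gamma^R$, $\tilde I_\alpha e_\gamma^R=-e_\beta^R$ for $(\alpha,\beta,\gamma)$ a cyclic permutation of $(1,2,3)$, and $\tilde I_\alpha(Y^{h_\eta})_{(z,p)}=(I'_\alpha Y)^{h_\eta}_{(z,p)}$ for $Y\in T_{\pi(p)}M$, where $I'_\alpha=\sum_\beta A_{\alpha\beta}I_\beta$ and $A\in\mathrm{SO}(3)$ is the matrix of $\mathrm{Ad}_z:q\mapsto zqz^{-1}$ on $\mathrm{Im}\,\mathbb H$ with respect to $(i_1,i_2,i_3)=(i,j,k)$, i.e. $\mathrm{Ad}_z(i_\beta)=\sum_\alpha A_{\alpha\beta}i_\alpha$. The $\tilde I_\alpha$ and $e_0^R$ are $V_1$-invariant; $\hat I_\alpha$ on $\hat M$ is determined by $\tilde\pi_*\circ\tilde I_\alpha=\hat I_\alpha\circ\tilde\pi_*$, and $V=\tilde\pi_*e_0^R$. $(\hat I_1,\hat I_2,\hat I_3)$ is a hypercomplex structure on $\hat M$, with Obata connection $\hat\nabla^0$. Construction of $\bar M$. $\mathcal D=\langle V,\hat I_1V,\hat I_2V,\hat I_3V\rangle$ is an integrable distribution on $\hat M$; $\bar M$ is its space of leaves and $\hat\pi:\hat M\to\bar M$ the quotient map. ''Submersion'' for a quotient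 map includes that the quotient space is a smooth manifold. Let $\varphi_0$ be the real part of the right-invariant Maurer-Cartan form of $\mathbb H^*$ ($\varphi_0(e_0^R)=1$, $\varphi_0(e_\alpha^R)=0$), extended by $0$ on $TP$; it descends to a one-form $\hat\theta_0$ on $\hat M$. Put $\hat\theta'=\hat\theta_0+\sum_{\alpha=1}^3(\hat\theta_0\circ\hat I_\alpha)i_\alpha$ and $\hat{\mathcal H}=\mathrm{Ker}\,\hat\theta'$, an $\hat I_\alpha$-invariant complement of $\mathcal D$. Write $Y^h$ for the lift of $Y$ to $\hat{\mathcal H}$. For a local section $s$ of $\hat\pi$ put $\bar I_\alpha(Y)=\hat\pi_*(\hat I_\alpha Y^h_{s(y)})$ for $Y\in T_y\bar M$; then $\bar Q=\langle\bar I_1,\bar I_2,\bar I_3\rangle$ is a quaternionic structure on $\bar M$ independent of $s$. The connection $\bar\nabla_YW=\hat\pi_*(\hat\nabla^0_{Y^h}W^h)$ is a well-defined quaternionic connection on $(\bar M,\bar Q)$. The vector field $X_P$ (lifted to $\tilde M$) projects to a vector field $\widehat{X_P}=\tilde\pi_*X_P$ on $\hat M$, which in turn projects to $X:=\hat\pi_*\widehat{X_P}$ on $\bar M$. *)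

(* Defs.v *)
From HB Require Import structures.
From mathcomp Require Import all_boot all_order all_algebra.
From mathcomp Require Import all_classical all_reals all_analysis.
Set Implicit Arguments. Unset Strict Implicit. Unset Printing Implicit Defensive.
Import Order.TTheory GRing.Theory Num.Theory.
Import numFieldNormedType.Exports.
Local Open Scope classical_set_scope.
Local Open Scope ring_scope.

Section Euclidean.
Context {R : realType} (n : nat).
Implicit Types (U : set 'rV[R]_n) (f : 'rV[R]_n -> R).

Fixpoint times_differentiable_on (k : nat) U f : Prop :=
  if k is k'.+1 then
    (forall x, U x -> differentiable f x) /\
    (forall v, times_differentiable_on k' U ('D_v f))
  else True.

(* C^oo on U: derivatives of all orders exist on U; since differentiability
   is in the sense of Frechet, they are continuous there. U is meant open. *)
Definition smooth_on U f : Prop := forall k, times_differentiable_on k U f.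

End Euclidean.

(* A chart is a homeomorphism between the open sets cdom and cimg; cmap and
   cinv are total functions whose values elsewhere are irrelevant. *)
Record chart (R : realType) (T : topologicalType) (n : nat) := Chart {
  cdom : set T;
  cimg : set 'rV[R]_n;
  cmap : T -> 'rV[R]_n;
  cinv : 'rV[R]_n -> T;
  open_cdom : open cdom;
  open_cimg : open cimg;
  cmap_img : forall x, cdom x -> cimg (cmap x);
  cinv_dom : forall y, cimg y -> cdom (cinv y);
  cmapK : forall x, cdom x -> cinv (cmap x) = x;
  cinvK : forall y, cimg y -> cmap (cinv y) = y;
  cmap_continuous : forall x, cdom x -> {for x, continuous cmap};
  cinv_continuous : forall y, cimg y -> {for y, continuous cinv}
}.

(* Asking for a countable (not necessarily maximal) smooth atlas is equivalent
   to second countability of the underlying space. *)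
Record manifold (R : realType) := Manifold {
  msort :> topologicalType;
  mdim : nat;
  atlas : set (chart R msort mdim);
  manifold_hausdorff : hausdorff_space msort;
  atlas_countable : countable atlas;
  atlas_cover : forall x : msort, exists2 c, atlas c & cdom c x;
  atlas_smooth : forall c c', atlas c -> atlas c' -> forall j,
    smooth_on (cimg c `&` cinv c @^-1` cdom c') (fun y => cmap c' (cinv c y) 0 j)
}.

Section SmoothLemmas.
Context {R : realType}.

Lemma near_eq_diff (n : nat) (f g : 'rV[R]_n -> R) (x : 'rV[R]_n) :
  (\forall y \near x, f y = g y) -> differentiable f x ->
  differentiable g x /\ 'd g x = 'd f x :> ('rV[R]_n -> R).
Proof.
move=> fg df.
have dg : g \o shift x = cst (g x) + 'd f x +o_ (0 : 'rV[R]_n) id.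
  apply/eqaddoP => e e0.
  have /eqaddoP/(_ e e0) := diff_locally df.
  have : \forall h \near (0 : 'rV[R]_n), f (h + x) = g (h + x).
    have : (fun h : 'rV[R]_n => h + x) @ (0 : 'rV[R]_n) --> x.
      by rewrite -[X in _ --> X]add0r; apply: (@cvgD R 'rV[R]_n _ (nbhs 0) _ id (cst x)); [exact: cvg_id|exact: cvg_cst].
    by move=> /(_ _ fg).
  have fgx : f x = g x by exact: nbhs_singleton fg.
  apply: filterS2 => h /= fgh.
  by rewrite !fctE /= fgh fgx.
have E := diff_unique (diff_continuous df) dg.
by split=> //; apply/diff_locallyP; rewrite E; split => //; exact: diff_continuous.
Qed.

Lemma eq_smooth_on (n : nat) (U : set 'rV[R]_n) (f g : 'rV[R]_n -> R) :
  open U -> (forall x, U x -> f x = g x) -> smooth_on U f -> smooth_on U g.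
Proof.
move=> oU fg sf k; elim: k f g fg {sf}(sf k) => [//|k IH] f g fg [df Df].
have nfg x : U x -> \forall y \near x, f y = g y.
  by move=> Ux; have : nbhs x U; [exact: open_nbhs_nbhs|exact: filterS].
split=> [x Ux|v]; first by have [] := near_eq_diff (nfg x Ux) (df x Ux).
apply: IH (Df v) => x Ux.
have [dg E] := near_eq_diff (nfg x Ux) (df x Ux).
by rewrite !deriveE ?E //; exact: df.
Qed.

Lemma smooth_on_linear (n m : nat) (p : {linear 'rV[R]_n -> 'rV[R]_m})
    (U : set 'rV[R]_n) (W : set 'rV[R]_m) (f : 'rV[R]_m -> R) :
  continuous p -> (forall x, U x -> W (p x)) ->
  smooth_on W f -> smooth_on U (f \o p).
Proof.
move=> cp UW sf k; elim: k f {sf}(sf k) => [//|k IH] f [df Df]; split.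
  move=> x /UW Wx; apply: differentiable_comp; last exact: df.
  exact: linear_differentiable.
move=> v; have -> : 'D_v (f \o p) = 'D_(p v) f \o p.
  apply/funext => x; rewrite /derive /=; 
  apply: (f_equal (fun k : R -> R => lim (k @ 0^'))).
  by apply/funext => h; rewrite -[h *: p v](linearZ_LR p) -linearD.
exact: (IH _ (Df (p v))).
Qed.

Lemma smooth_on_cst (n : nat) (U : set 'rV[R]_n) (a : R) : smooth_on U (cst a).
Proof.
move=> k; elim: k a => [//|k IH] a.
split=> [x _|v]; first exact: differentiable_cst.
have -> : 'D_v (cst a) = cst (0 : R) :> ('rV[R]_n -> R).
  by apply/funext => x; rewrite derive_cst.
exact: IH.
Qed.

Lemma smooth_on_coord (n : nat) (U : set 'rV[R]_n) (j : 'I_n) :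
  smooth_on U (fun x => x 0 j).
Proof.
case=> [//|k]; split=> [x _|v]; first exact: differentiable_coord.
have -> : 'D_v (fun x : 'rV[R]_n => x 0 j : R) = cst (v 0 j).
  have @p : {linear 'rV[R]_n -> R}.
    by exists (fun N : 'rV[R]_n => N 0 j); do 2![eexists]; do ?[constructor];
       rewrite ?mxE// => ? *; rewrite ?mxE//; move=> ?; rewrite !mxE.
  have cp : continuous p by exact: coord_continuous.
  apply/funext => x; rewrite (_ : (fun _ => _) = p) // deriveE ?diff_lin //.
  exact: linear_differentiable.
exact: smooth_on_cst.
Qed.


End SmoothLemmas.

Section ProductManifold.
Context {R : realType}.

Lemma hausdorff_prod (S T : topologicalType) :
  hausdorff_space S -> hausdorff_space T -> hausdorff_space (S * T)%type.
Proof.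
move=> hS hT [x y] [x' y'] cl; congr pair.
  apply: hS => A B nA nB.
  have [] := cl (A `*` setT) (B `*` setT).
  - by exists (A, setT) => //; split => //; exact: filterT.
  - by exists (B, setT) => //; split => //; exact: filterT.
  by move=> [a b] [[/= Aa _] [Ba _]]; exists a.
apply: hT => A B nA nB.
have [] := cl (setT `*` A) (setT `*` B).
- by exists (setT, A) => //; split => //; exact: filterT.
- by exists (setT, B) => //; split => //; exact: filterT.
by move=> [a b] [[/= _ Ab] [_ Bb]]; exists b.
Qed.

Lemma hausdorff_inj (S T : topologicalType) (f : S -> T) :
  continuous f -> injective f -> hausdorff_space T -> hausdorff_space S.
Proof.
move=> cf fi hT x y cl; apply/fi/hT => A B /cf nA /cf nB.
by have [z [Az Bz]] := cl _ _ nA nB; exists (f z).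
Qed.

Lemma row_mx_continuous (T : topologicalType) (m n : nat)
    (f : T -> 'rV[R]_m) (g : T -> 'rV[R]_n) (x : T) :
  {for x, continuous f} -> {for x, continuous g} ->
  {for x, continuous (fun t => row_mx (f t) (g t))}.
Proof.
move=> cf cg A [P nP PA].
pose Pl i j := P i (lshift n j).
pose Pr i j := P i (rshift m j).
have nf : nbhs (f x) [set w | forall i j, Pl i j (w i j)].
  by exists Pl => // i j; have := nP i (lshift n j); rewrite row_mxEl.
have ng : nbhs (g x) [set w | forall i j, Pr i j (w i j)].
  by exists Pr => // i j; have := nP i (rshift m j); rewrite row_mxEr.
have nfx : \forall t \near x, forall i j, Pl i j (f t i j) by exact: cf _ nf.
have ngx : \forall t \near x, forall i j, Pr i j (g t i j) by exact: cg _ ng.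
change (nbhs x [set t | A (row_mx (f t) (g t))]).
apply: filterS2 nfx ngx => t Hf Hg.
apply: PA => i j; rewrite !mxE; case: split_ordP => k jE.
- by have := Hf i k; rewrite /Pl -jE.
- by have := Hg i k; rewrite /Pr -jE.
Qed.

Section ProductChart.
Variables (S T : topologicalType) (m n : nat) (c : chart R S m) (d : chart R T n).

Let dom : set (S * T)%type := cdom c `*` cdom d.
Let img : set 'rV[R]_(m + n) :=
  lsubmx @^-1` cimg c `&` rsubmx @^-1` cimg d.
Let map (p : S * T) : 'rV[R]_(m + n) := row_mx (cmap c p.1) (cmap d p.2).
Let inv (w : 'rV[R]_(m + n)) : S * T := (cinv c (lsubmx w), cinv d (rsubmx w)).

Let dom_open : open dom.
Proof.
rewrite openE => -[x y] [/= cx dy].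
by exists (cdom c, cdom d) => //; split; apply: open_nbhs_nbhs; split => //;
  [exact: open_cdom|exact: open_cdom].
Qed.

Let img_open : open img.
Proof.
apply: openI.
  by move/continuousP: (@continuous_lsubmx R 1 m n); apply; exact: open_cimg.
by move/continuousP: (@continuous_rsubmx R 1 m n); apply; exact: open_cimg.
Qed.

Let map_img p : dom p -> img (map p).
Proof.
by move=> [dp1 dp2]; rewrite /img /map /= ?row_mxKl ?row_mxKr; split;
  rewrite /= ?row_mxKl ?row_mxKr; exact: cmap_img.
Qed.

Let inv_dom w : img w -> dom (inv w).
Proof. by move=> [w1 w2]; split; exact: cinv_dom. Qed.

Let mapK p : dom p -> inv (map p) = p.
Proof.
by case: p => x y [/= ? ?]; rewrite /inv /map row_mxKl row_mxKr !cmapK.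
Qed.

Let invK w : img w -> map (inv w) = w.
Proof. by move=> [? ?]; rewrite /map /inv /= !cinvK // hsubmxK. Qed.

Let map_continuous p : dom p -> {for p, continuous map}.
Proof.
case: p => x y [/= cx dy]; apply: row_mx_continuous.
  by apply: (@continuous_comp _ _ _ fst); [exact: cvg_fst|exact: cmap_continuous].
by apply: (@continuous_comp _ _ _ snd); [exact: cvg_snd|exact: cmap_continuous].
Qed.

Let inv_continuous w : img w -> {for w, continuous inv}.
Proof.
move=> [w1 w2].
have c1 : {for w, continuous (cinv c \o lsubmx)}.
  exact: (@continuous_comp _ _ _ lsubmx (cinv c) w (@continuous_lsubmx R 1 m n w)
    (cinv_continuous w1)).
have c2 : {for w, continuous (cinv d \o rsubmx)}.
  exact: (@continuous_comp _ _ _ rsubmx (cinv d) w (@continuous_rsubmx R 1 m n w)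
    (cinv_continuous w2)).
exact: cvg_pair c1 c2.
Qed.

Definition prod_chart : chart R (S * T)%type (m + n) :=
  Chart dom_open img_open map_img inv_dom mapK invK map_continuous inv_continuous.

End ProductChart.

Variables M N : manifold R.

Let prod_atlas : set (chart R (M * N)%type (mdim M + mdim N)) :=
  [set prod_chart cd.1 cd.2 | cd in @atlas R M `*` @atlas R N].

Let prod_countable : countable prod_atlas.
Proof.
apply: sub_countable (card_image_le _ _) _.
apply: countableX; exact: atlas_countable.
Qed.

Let prod_cover (p : M * N) : exists2 c, prod_atlas c & cdom c p.
Proof.
have [c ac cx] := atlas_cover p.1; have [d ad dy] := atlas_cover p.2.
by exists (prod_chart c d) => //; exists (c, d).
Qed.

Let prod_smooth c c' : prod_atlas c -> prod_atlas c' -> forall j,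
  smooth_on (cimg c `&` cinv c @^-1` cdom c') (fun y => cmap c' (cinv c y) 0 j).
Proof.
move=> [[c1 d1] [/= ac1 ad1] <-] [[c2 d2] [/= ac2 ad2] <-] j.
case: (split_ordP j) => k ->.
  rewrite (_ : (fun _ => _) =
    (fun y => cmap c2 (cinv c1 y) 0 k) \o lsubmx); last first.
    by apply/funext => w /=; rewrite row_mxEl.
  apply: (smooth_on_linear (@continuous_lsubmx R 1 _ _)) (atlas_smooth ac1 ac2 k).
  by move=> w [[? ?] [? ?]].
rewrite (_ : (fun _ => _) =
  (fun y => cmap d2 (cinv d1 y) 0 k) \o rsubmx); last first.
  by apply/funext => w /=; rewrite row_mxEr.
apply: (smooth_on_linear (@continuous_rsubmx R 1 _ _)) (atlas_smooth ad1 ad2 k).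
by move=> w [[? ?] [? ?]].
Qed.

Definition prod_manifold : manifold R :=
  Manifold (hausdorff_prod (@manifold_hausdorff R M) (@manifold_hausdorff R N))
    prod_countable prod_cover prod_smooth.

End ProductManifold.

Section OneChart.
Context {R : realType} (T : topologicalType) (n : nat) (c : chart R T n).
Hypotheses (hT : hausdorff_space T) (cT : cdom c = setT).

Let one_countable : countable [set c].
Proof. exact: countable1. Qed.

Let one_cover (x : T) : exists2 d, [set c] d & cdom d x.
Proof. by exists c => //; rewrite cT. Qed.

Let one_smooth d d' : [set c] d -> [set c] d' -> forall j,
  smooth_on (cimg d `&` cinv d @^-1` cdom d') (fun y => cmap d' (cinv d y) 0 j).
Proof.
move=> -> -> j; rewrite cT setIT.
apply: (@eq_smooth_on _ _ _ (fun y => y 0 j)); first exact: open_cimg.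
  by move=> x cx; rewrite cinvK.
exact: smooth_on_coord.
Qed.

Definition one_chart_manifold : manifold R :=
  Manifold hT one_countable one_cover one_smooth.

End OneChart.

Section RealLine.
Context {R : realType}.

Let line_map (t : R) : 'rV[R]_1 := \row_(_ < 1) t.
Let line_inv (w : 'rV[R]_1) : R := w 0 0.

Let line_mapK t : [set: R] t -> line_inv (line_map t) = t.
Proof. by rewrite /line_inv mxE. Qed.

Let line_invK w : [set: 'rV[R]_1] w -> line_map (line_inv w) = w.
Proof. by move=> _; apply/rowP => i; rewrite mxE /line_inv ord1. Qed.

Let line_map_continuous t : [set: R] t -> {for t, continuous line_map}.
Proof.
move=> _ A [P nP PA]; have := nP 0 0; rewrite mxE; apply: filterS => s Ps.
by apply: PA => i j; rewrite mxE !ord1.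
Qed.

Let line_inv_continuous w : [set: 'rV[R]_1] w -> {for w, continuous line_inv}.
Proof. by move=> _; exact: coord_continuous. Qed.

Definition line_chart : chart R R 1 :=
  Chart openT openT (fun _ _ => I) (fun _ _ => I) line_mapK line_invK
    line_map_continuous line_inv_continuous.

Definition line : manifold R :=
  @one_chart_manifold R _ _ line_chart (@Rhausdorff R) erefl.

End RealLine.

Section Quaternions.
Context {R : realType}.
Implicit Types x y z : 'rV[R]_4.

(* The quaternion x0 + x1 i + x2 j + x3 k is the row vector (x0, x1, x2, x3). *)
Definition qmul x y : 'rV[R]_4 :=
  let x0 := x 0 (inord 0) in let x1 := x 0 (inord 1) in
  let x2 := x 0 (inord 2) in let x3 := x 0 (inord 3) in
  let y0 := y 0 (inord 0) in let y1 := y 0 (inord 1) in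
  let y2 := y 0 (inord 2) in let y3 := y 0 (inord 3) in
  \row_(a < 4) [:: x0 * y0 - x1 * y1 - x2 * y2 - x3 * y3;
                   x0 * y1 + x1 * y0 + x2 * y3 - x3 * y2;
                   x0 * y2 - x1 * y3 + x2 * y0 + x3 * y1;
                   x0 * y3 + x1 * y2 - x2 * y1 + x3 * y0]`_a.

Definition qconj x : 'rV[R]_4 := \row_(a < 4) (if a == 0 then x 0 a else - x 0 a).

Definition qinv x : 'rV[R]_4 := (\sum_(a < 4) x 0 a ^+ 2)^-1 *: qconj x.

Definition qe (a : 'I_4) : 'rV[R]_4 := delta_mx 0 a.

(* Indices alpha = 1, 2, 3 are encoded as 0, 1, 2 : 'I_3; qe (im alpha) is
   the imaginary unit i_alpha. *)
Definition im (al : 'I_3) : 'I_4 := lift ord0 al.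

(* The column of index be holds the coordinates of z i_be z^-1. *)
Definition Ad_mx z : 'M[R]_3 :=
  \matrix_(al, be) qmul (qmul z (qe (im be))) (qinv z) 0 (im al).

Definition Hset : set 'rV[R]_4 := [set x | x != 0].

Let Hone : Hset.
Proof.
exists (qe 0); rewrite inE /Hset /=.
by apply/eqP => /matrixP/(_ 0 0)/eqP; rewrite !mxE !eqxx oner_eq0.
Qed.

Let Hinv x : Hset := insubd Hone x.

Let HinvE x : Hset x -> val (Hinv x) = x.
Proof. by move=> hx; rewrite /Hinv insubdK // inE. Qed.

Let Hset_open : open Hset.
Proof.
rewrite (_ : Hset = ~` [set 0]); last first.
  by apply/seteqP; split => x /= /eqP.
by apply: closed_openC; apply: accessible_closed_set1;
  apply: hausdorff_accessible; exact: norm_hausdorff.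
Qed.

Let Hval_img (z : Hset) : [set: Hset] z -> Hset (val z).
Proof. by move=> _; have := valP z; rewrite inE. Qed.

Let Hval_continuous (z : Hset) : [set: Hset] z -> {for z, continuous (val : Hset -> 'rV[R]_4)}.
Proof. by move=> _; exact: initial_continuous. Qed.

Let Hinv_continuous x : Hset x -> {for x, continuous Hinv}.
Proof.
move=> hx A [B [[C oC <-] Cx] BA].
have : nbhs x (C `&` Hset).
  apply: open_nbhs_nbhs; split; first exact: openI.
  by split => //; rewrite -(HinvE hx).
by apply: filterS => y [Cy hy]; apply: BA; rewrite -(HinvE hy) in Cy.
Qed.

Let HvalK (z : Hset) : [set: Hset] z -> Hinv (val z) = z.
Proof. by move=> _; rewrite /Hinv valKd. Qed.

Definition Hchart : chart R Hset 4 :=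
  Chart openT Hset_open Hval_img (fun _ _ => I) HvalK HinvE
    Hval_continuous Hinv_continuous.

Let Hset_hausdorff : hausdorff_space Hset.
Proof.
apply: (@hausdorff_inj _ _ (val : Hset -> 'rV[R]_4)).
- exact: initial_continuous.
- exact: val_inj.
- exact: norm_hausdorff.
Qed.

Definition Hstar : manifold R :=
  one_chart_manifold Hset_hausdorff (erefl : cdom Hchart = setT).

End Quaternions.

Section Fields.
Context {R : realType}.

(* Tangent vectors at x are the derivations at x of the algebra of smooth
   functions. They are represented by functionals on all functions, which are
   required to vanish on the functions that are not smooth, so that equality
   of functionals is equality of tangent vectors. *)
Definition tvec (M : manifold R) : Type := (M -> R) -> R.

Definition field (M : manifold R) : Type := M -> tvec M.
Definition form1 (M : manifold R) : Type := M -> tvec M -> R.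
Definition form2 (M : manifold R) : Type := M -> tvec M -> tvec M -> R.
Definition endo (M : manifold R) : Type := M -> tvec M -> tvec M.
Definition conn (M : manifold R) : Type := field M -> field M -> field M.

Section OneManifold.
Variable M : manifold R.
Implicit Types (f g : M -> R) (x : M) (v w : tvec M) (X Y W : field M).
Implicit Types (A : endo M) (nabla : conn M).

Definition smooth f : Prop :=
  forall c, @atlas R M c -> smooth_on (cimg c) (f \o cinv c).

Record tangent x v : Prop := {
  tangent_linear : forall (k : R) f g, smooth f -> smooth g ->
    v (fun y => k * f y + g y) = k * v f + v g;
  tangent_leibniz : forall f g, smooth f -> smooth g ->
    v (fun y => f y * g y) = v f * g x + f x * v g;
  tangent_smooth : forall f, ~ smooth f -> v f = 0
}.

(* Tensor fields are smooth when they take smooth values on smooth vector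
   fields. *)
Definition is_field X : Prop :=
  (forall x, tangent x (X x)) /\
  (forall f, smooth f -> smooth (fun x => X x f)).

Record is_form1 (a : form1 M) : Prop := {
  form1_linear : forall x (k : R) v w, tangent x v -> tangent x w ->
    a x (k *: v + w) = k * a x v + a x w;
  form1_smooth : forall X, is_field X -> smooth (fun x => a x (X x))
}.

Record is_form2 (b : form2 M) : Prop := {
  form2_linear : forall x (k : R) u v w,
    tangent x u -> tangent x v -> tangent x w ->
    b x (k *: u + v) w = k * b x u w + b x v w;
  form2_skew : forall x v w, tangent x v -> tangent x w -> b x v w = - b x w v;
  form2_smooth : forall X Y, is_field X -> is_field Y ->
    smooth (fun x => b x (X x) (Y x))
}.

Definition appl A X : field M := fun x => A x (X x).

Record is_endo A : Prop := {
  endo_tangent : forall x v, tangent x v -> tangent x (A x v);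
  endo_linear : forall x (k : R) v w, tangent x v -> tangent x w ->
    A x (k *: v + w) = k *: A x v + A x w;
  endo_smooth : forall X, is_field X -> is_field (appl A X)
}.

Definition bracket X Y : field M := fun x f =>
  X x (fun y => Y y f) - Y x (fun y => X y f).

Definition d1 (a : form1 M) X Y : M -> R := fun x =>
  X x (fun y => a y (Y y)) - Y x (fun y => a y (X y)) - a x (bracket X Y x).

Definition closed2 (b : form2 M) : Prop :=
  forall X Y W, is_field X -> is_field Y -> is_field W -> forall x,
    X x (fun y => b y (Y y) (W y)) - Y x (fun y => b y (X y) (W y))
    + W x (fun y => b y (X y) (Y y))
    - b x (bracket X Y x) (W x) + b x (bracket X W x) (Y x)
    - b x (bracket Y W x) (X x) = 0.

(* (L_X b)(Y, W), (L_X A) Y and (L_X nabla)_Y W *)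
Definition lie_form2 X (b : form2 M) Y W : M -> R := fun x =>
  X x (fun y => b y (Y y) (W y)) - b x (bracket X Y x) (W x)
  - b x (Y x) (bracket X W x).

Definition lie_endo X A Y : field M := bracket X (appl A Y) - appl A (bracket X Y).

Definition lie_conn X nabla Y W : field M :=
  bracket X (nabla Y W) - nabla (bracket X Y) W - nabla Y (bracket X W).

Definition iota2 X (b : form2 M) : form1 M := fun x v => b x (X x) v.

Definition comp_form1 (a : form1 M) A : form1 M := fun x v => a x (A x v).

Record is_connection nabla : Prop := {
  conn_field : forall X Y, is_field X -> is_field Y -> is_field (nabla X Y);
  conn_linear : forall f X X' Y, smooth f ->
    is_field X -> is_field X' -> is_field Y ->
    nabla (fun x => f x *: X x + X' x) Y =
    fun x => f x *: nabla X Y x + nabla X' Y x;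
  conn_add : forall X Y Y', is_field X -> is_field Y -> is_field Y' ->
    nabla X (Y + Y') = nabla X Y + nabla X Y';
  conn_leibniz : forall f X Y, smooth f -> is_field X -> is_field Y ->
    nabla X (fun x => f x *: Y x) =
    fun x => X x f *: Y x + f x *: nabla X Y x
}.

Definition torsion_free nabla : Prop := forall X Y,
  is_field X -> is_field Y -> nabla X Y - nabla Y X = bracket X Y.

Definition parallel nabla A : Prop := forall X Y,
  is_field X -> is_field Y -> nabla X (appl A Y) = appl A (nabla X Y).

Definition idx1 : 'I_3 := @Ordinal 3 0 isT.
Definition idx2 : 'I_3 := @Ordinal 3 1 isT.
Definition idx3 : 'I_3 := @Ordinal 3 2 isT.

(* Integrability is the vanishing of the Nijenhuis tensor. *)
Definition integrable A : Prop := forall X Y, is_field X -> is_field Y ->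
  bracket (appl A X) (appl A Y) =
  bracket X Y + appl A (bracket (appl A X) Y) + appl A (bracket X (appl A Y)).

Record hypercomplex (I : 'I_3 -> endo M) : Prop := {
  hyper_endo : forall al, is_endo (I al);
  hyper_square : forall al x v, tangent x v -> I al x (I al x v) = - v;
  hyper_12 : forall x v, tangent x v -> I idx1 x (I idx2 x v) = I idx3 x v;
  hyper_21 : forall x v, tangent x v -> I idx2 x (I idx1 x v) = - I idx3 x v;
  hyper_integrable : forall al, integrable (I al)
}.

Definition obata (I : 'I_3 -> endo M) nabla : Prop :=
  [/\ is_connection nabla, torsion_free nabla & forall al, parallel nabla (I al)].

Record rotating (I : 'I_3 -> endo M) (Z : field M) : Prop := {
  rotating_field : is_field Z;
  rotating_1 : forall Y, is_field Y -> lie_endo Z (I idx1) Y = 0;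
  rotating_2 : forall Y, is_field Y ->
    lie_endo Z (I idx2) Y = fun x => - 2 *: I idx3 x (Y x)
}.

Definition same_integral_curve X x y : Prop :=
  exists (a b : R) (c : R -> M),
    (forall t, a < t < b -> forall g, smooth g ->
       is_derive t 1 (fun s => g (c s)) (X (c t) g)) /\
    exists s t, [/\ a < s < b, a < t < b, c s = x & c t = y].

End OneManifold.

Section Maps.
Variables M N : manifold R.
Implicit Types F : M -> N.

(* For maps between manifolds this amounts to smoothness in charts. *)
Definition smooth_map F : Prop := forall g, smooth g -> smooth (g \o F).

(* The differential of F. *)
Definition push F (v : tvec M) : tvec N :=
  fun g => if `[< smooth g >] then v (g \o F) else 0.

Definition related F (X : field M) (Y : field N) : Prop :=
  forall x, push F (X x) = Y (F x).

(* F : M -> N exhibits N as the quotient manifold of M by the foliation with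
   tangent distribution D, E being the relation of lying on the same leaf. The
   last clause identifies the tangent spaces of the leaves with those of the
   fibres; it follows from the other ones. *)
Record quotient_submersion (E : M -> M -> Prop) (D : M -> set (tvec M)) F : Prop := {
  quot_smooth : smooth_map F;
  quot_surj : forall y, exists x, F x = y;
  quot_fibre : forall x x', F x = F x' <-> E x x';
  quot_submersion : forall x w, tangent (F x) w ->
    exists2 v, tangent x v & push F v = w;
  quot_kernel : forall x v, tangent x v -> push F v = 0 <-> D x v
}.

(* M is a connected integral manifold of D, injectively immersed in N by F *)
Record integral_manifold (D : N -> set (tvec N)) F : Prop := {
  intman_connected : connected [set: M];
  intman_smooth : smooth_map F;
  intman_inj : injective F;
  intman_immersion : forall x v, tangent x v -> push F v = 0 -> v = 0;
  intman_tangent : forall x w, D (F x) w <-> exists2 v, tangent x v & push F v = w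
}.

End Maps.

Definition same_leaf (M : manifold R) (D : M -> set (tvec M)) (x y : M) : Prop :=
  exists (L : manifold R) (F : L -> M), integral_manifold D F /\
    exists a b, F a = x /\ F b = y.

(* The tangent vector (v, w) at the point p of M x N *)
Definition pair_vec (M N : manifold R) (p : M * N) (v : tvec M) (w : tvec N) :
    tvec (prod_manifold M N) :=
  fun g => if `[< smooth g >]
           then v (fun x => g (x, p.2)) + w (fun y => g (p.1, y)) else 0.

(* U(1) is identified with R / 2 pi Z by t |-> e^(it), and its Lie algebra with
   R: act t p stands for p . e^(it), and the fundamental vector field of xi is
   the velocity of t |-> p . e^(it xi). *)
Section PrincipalBundle.
Variables (P M : manifold R) (act : R -> P -> P) (prj : P -> M).

Definition fundamental (xi : R) : field P := fun p g =>
  if `[< smooth g >] then derive1 (fun t : R => g (act (t * xi) p)) 0 else 0.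

Record principal_U1 : Prop := {
  act_smooth : @smooth_map (prod_manifold line P) P (fun tp => act tp.1 tp.2);
  act0 : forall p, act 0 p = p;
  actD : forall s t p, act (s + t) p = act s (act t p);
  act_free : forall t p, act t p = p <-> exists k : int, t = k%:~R * (2 * pi);
  act_quotient : quotient_submersion
    (fun p q => exists t, act t p = q)
    (fun p => [set v | exists a : R, v = a *: fundamental 1 p]) prj
}.

(* xi is the element of the Lie algebra on which the real-valued connection
   form takes the value 1 (there, fundamental xi is the field X_P). *)
Record connection_form (eta : form1 P) (xi : R) : Prop := {
  cform_form1 : is_form1 eta;
  cform_fundamental : forall p, eta p (fundamental xi p) = 1;
  cform_invariant : forall t p v, tangent p v ->
    eta (act t p) (push (act t) v) = eta p v
}.

(* w is the eta-horizontal lift to p of the tangent vector y at prj p *)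
Definition eta_lift (eta : form1 P) (p : P) (y : tvec M) (w : tvec P) : Prop :=
  [/\ tangent p w, eta p w = 0 & push prj w = y].

(* d eta = prj^* (Theta - 1/2 d ((iota_Z Theta) o J)), tested on vectors that
   are extended to vector fields, A and B on P, Y and W on M *)
Definition has_curvature (eta : form1 P) (Theta : form2 M) (Z : field M)
    (J : endo M) : Prop :=
  forall A B Y W, is_field A -> is_field B -> is_field Y -> is_field W ->
  forall p, push prj (A p) = Y (prj p) -> push prj (B p) = W (prj p) ->
    d1 eta A B p = Theta (prj p) (Y (prj p)) (W (prj p))
      - 2^-1 * d1 (comp_form1 (iota2 Z Theta) J) Y W (prj p).

End PrincipalBundle.

(* The tangent vector of H^* at z with coordinates h *)
Definition Hvec (z : @Hstar R) (h : 'rV[R]_4) : tvec (@Hstar R) := fun g =>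
  if `[< smooth g >] then 'D_h (g \o cinv Hchart) (cmap Hchart z) else 0.

Definition eR (a : 'I_4) : field (@Hstar R) :=
  fun z => Hvec z (qmul (qe a) (cmap Hchart z)).

Definition eL (a : 'I_4) : field (@Hstar R) :=
  fun z => Hvec z (qmul (cmap Hchart z) (qe a)).

(* Real part of the right-invariant Maurer-Cartan form dz z^-1 *)
Definition phi0 : form1 (@Hstar R) := fun z v =>
  qmul (\row_a v (fun y => cmap Hchart y 0 a)) (qinv (cmap Hchart z)) 0 0.

Section HatConstruction.
Variables (M P : manifold R).

Definition Mtilde : manifold R := prod_manifold (@Hstar R) P.

Definition lift_H (X : field (@Hstar R)) : field Mtilde :=
  fun u => pair_vec u (X u.1) 0.

Definition lift_P (X : field P) : field Mtilde := fun u => pair_vec u 0 (X u.2).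

Definition f1_of (Theta : form2 M) (Z : field M) (I1 : endo M) (f : M -> R) :
    M -> R := fun x => f x - 2^-1 * Theta x (Z x) (I1 x (Z x)).

(* Zh is the horizontal lift of Z *)
Definition Z1_of (prj : P -> M) (f1 : M -> R) (Zh XP : field P) : field P :=
  fun p => Zh p + f1 (prj p) *: XP p.

Definition V1_of (Z1 : field P) : field Mtilde :=
  lift_H (eL (im idx1)) - lift_P Z1.

Record is_Itilde (prj : P -> M) (eta : form1 P) (I : 'I_3 -> endo M)
    (V1 : field Mtilde) (It : 'I_3 -> endo Mtilde) : Prop := {
  It_endo : forall al, is_endo (It al);
  It_V1 : forall al u, It al u (V1 u) = 0;
  It_e0 : forall al u, It al u (lift_H (eR 0) u) = lift_H (eR (im al)) u;
  It_eal : forall al u, It al u (lift_H (eR (im al)) u) = - lift_H (eR 0) u;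
  It_ebe : forall al u,
    It al u (lift_H (eR (im (ordS al))) u) = lift_H (eR (im (ordS (ordS al)))) u;
  It_ega : forall al u,
    It al u (lift_H (eR (im (ordS (ordS al)))) u) = - lift_H (eR (im (ordS al))) u;
  It_horizontal : forall al (u : Mtilde) y w w', tangent (prj u.2) y ->
    eta_lift prj eta u.2 y w ->
    eta_lift prj eta u.2
      (\sum_(be < 3) Ad_mx (cmap Hchart u.1) al be *: I be (prj u.2) y) w' ->
    It al u (pair_vec u 0 w) = pair_vec u 0 w'
}.

End HatConstruction.

Section BarConstruction.
Variables (Mhat Mbar : manifold R) (Ih : 'I_3 -> endo Mhat) (V : field Mhat).
Variables (theta0 : form1 Mhat) (prh : Mhat -> Mbar).

Definition Dhat (u : Mhat) : set (tvec Mhat) :=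
  [set v | exists (a : R) (b : 'I_3 -> R),
     v = a *: V u + \sum_(al < 3) b al *: Ih al u (V u)].

Definition theta' (u : Mhat) (v : tvec Mhat) : 'rV[R]_4 :=
  theta0 u v *: qe 0 + \sum_(al < 3) theta0 u (Ih al u v) *: qe (im al).

Definition horizontal (u : Mhat) (v : tvec Mhat) : Prop :=
  tangent u v /\ theta' u v = 0.

(* Yh is the lift of Y to the kernel of theta' *)
Definition hat_lift (Y : field Mbar) (Yh : field Mhat) : Prop :=
  [/\ is_field Yh, forall u, horizontal u (Yh u) & related prh Yh Y].

(* Sections of Qbar. A point u of the fibre over y is the value s(y) of a local
   section s, and w, being horizontal, is the lift to u of the vector push prh w
   at y, so that push prh (Ih al u w) is Ibar_al (push prh w). The span of the
   Ibar_al does not depend on the choice of u. *)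
Definition section_Qbar (A : endo Mbar) : Prop :=
  is_endo A /\
  forall u, exists a : 'I_3 -> R, forall w, horizontal u w ->
    A (prh u) (push prh w) = \sum_(al < 3) a al *: push prh (Ih al u w).

Definition is_nablabar (nabla0 : conn Mhat) (nablabar : conn Mbar) : Prop :=
  is_connection nablabar /\
  forall Y W Yh Wh, is_field Y -> is_field W -> hat_lift Y Yh -> hat_lift W Wh ->
    related prh (nabla0 Yh Wh) (nablabar Y W).

End BarConstruction.

(* X preserves the sections of a subbundle of endomorphisms and the connection *)
Definition affine_quaternionic (M : manifold R) (secQ : endo M -> Prop)
    (nabla : conn M) (X : field M) : Prop :=
  (forall A, secQ A ->
     exists2 B, secQ B & forall Y, is_field Y -> lie_endo X A Y = appl B Y) /\
  (forall Y W, is_field Y -> is_field W -> lie_conn X nabla Y W = 0).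

End Fields.

(* Main.v *)
Require Import Defs.
From HB Require Import structures.
From mathcomp Require Import all_boot all_order all_algebra.
From mathcomp Require Import all_classical all_reals all_analysis.
From mathcomp Require Import ring lra.
Set Implicit Arguments. Unset Strict Implicit. Unset Printing Implicit Defensive.
Import Order.TTheory GRing.Theory Num.Theory.
Import numFieldNormedType.Exports.
Local Open Scope classical_set_scope.
Local Open Scope ring_scope.

(* Everything is transported along the flow of X_P on H^* x P, that is the U(1)
   action on P. It fixes V_1, the right-invariant fields of H^* and the
   horizontal lifts, hence the tensors that define the hypercomplex structure of
   Mhat and the form theta_0; differentiating along the flow gives
   L_Xhat Ihat_alpha = 0 and L_Xhat theta_0 = 0. The Lie derivative S of the
   Obata connection is then symmetric and satisfies S(Y, I W) = I S(Y, W) for the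
   anticommuting structures I = Ihat_alpha, which forces S = 0. Since Xhat
   preserves Ker theta', the bracket of Xhat with the lift of Y is the lift of
   [X, Y], so that L_X nablabar = 0 and L_X preserves the sections of Qbar: if A
   pulls back to sum a_alpha Ihat_alpha on Ker theta', then L_X A pulls back to
   sum Xhat(a_alpha) Ihat_alpha.

   As tangent vectors are derivations, the local computations rest on local
   frames, which are obtained from Hadamard's lemma and smooth cutoffs. *)

(** * Calculus in Euclidean space *)

(** Nothing explicit is known about [Mhat] and [Mbar] beyond their quotient maps, so every identity
    is proved upstairs for a lifted field and then pushed down. The obstacle is the smoothness of
    lifts. A lift is made unique by normalising it with one-forms, [eta] for [prt] and the
    components of [theta'] for [prh]; it then solves a linear system with smooth coefficients and
    injective matrix, and Cramer's rule applies. For [prt] the normalisation is possible because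
    [eta] takes the value [- f1] on [V1]. The quaternionic relations of the [Ihat_alpha] are also
    read off upstairs, where they hold only modulo [V1]: on the right-invariant frame they come from
    the multiplication table, on horizontal lifts from the orthogonality of the matrix of [Ad_z].
    The coefficients a_alpha of a section of [Qbar] are given point by point on [Mhat]. Before Xhat
    can differentiate them they must be shown to be smooth, and this rests on the independence of
    the three endomorphisms modulo the vertical distribution. *)

Section SmoothCalculus.
Context {R : realType}.

Lemma open_near_eq (T : topologicalType) (S : Type) (U : set T) (f g : T -> S) :
  open U -> (forall x, U x -> f x = g x) ->
  forall x, U x -> \forall y \near x, f y = g y.
Proof.
by move=> oU fg x Ux; have : nbhs x U; [exact: open_nbhs_nbhs|exact: filterS].
Qed.

Section Fixed_dimension.
Variable n : nat.
Implicit Types (U W : set 'rV[R]_n) (f g : 'rV[R]_n -> R).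

Lemma near_differentiable f g x :
  (\forall y \near x, f y = g y) -> differentiable f x -> differentiable g x.
Proof. by move=> fg /(near_eq_diff fg)[]. Qed.

Lemma times_differentiable_eq k U f g : open U -> (forall x, U x -> f x = g x) ->
  times_differentiable_on k U f -> times_differentiable_on k U g.
Proof.
move=> oU; elim: k f g => [//|k IH] f g fg [df Df].
have nfg := open_near_eq oU fg.
split=> [x Ux|v]; first exact: near_differentiable (nfg x Ux) (df x Ux).
apply: IH (Df v) => x Ux; exact: near_eq_derive (nfg x Ux).
Qed.

Lemma times_differentiableS k U f :
  times_differentiable_on k.+1 U f -> times_differentiable_on k U f.
Proof.
elim: k f => [//|k IH] f [df Df]; split=> // v.
exact: IH (Df v).
Qed.

Lemma times_differentiable_subset k U W f : W `<=` U ->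
  times_differentiable_on k U f -> times_differentiable_on k W f.
Proof.
move=> WU; elim: k f => [//|k IH] f [df Df]; split=> [x /WU|v]; [exact: df|exact: IH (Df v)].
Qed.

Lemma times_differentiable_local k U f :
  (forall x, U x -> exists W, [/\ open W, W x & times_differentiable_on k W f]) ->
  times_differentiable_on k U f.
Proof.
elim: k f => [//|k IH] f H; split=> [x /H[W [_ Wx [df _]]]|v]; first exact: df.
by apply: IH => x /H[W [oW Wx [_ Df]]]; exists W; split => //; exact: Df.
Qed.

Lemma times_differentiable_cst k U (a : R) : times_differentiable_on k U (cst a).
Proof. exact: smooth_on_cst. Qed.

Lemma times_differentiableD k U f g : open U ->
  times_differentiable_on k U f -> times_differentiable_on k U g ->
  times_differentiable_on k U (fun x => f x + g x).
Proof.
move=> oU; elim: k f g => [//|k IH] f g [df Df] [dg Dg]; split=> [x Ux|v].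
  by apply: differentiableD; [exact: df|exact: dg].
apply: times_differentiable_eq (IH _ _ (Df v) (Dg v)) => // x Ux.
by rewrite -deriveD //; apply: diff_derivable; [exact: df|exact: dg].
Qed.

Lemma times_differentiableM k U f g : open U ->
  times_differentiable_on k U f -> times_differentiable_on k U g ->
  times_differentiable_on k U (fun x => f x * g x).
Proof.
move=> oU; elim: k f g => [//|k IH] f g sf sg; have [df Df] := sf; have [dg Dg] := sg.
split=> [x Ux|v]; first by apply: differentiableM; [exact: df|exact: dg].
apply: (@times_differentiable_eq _ _
  (fun x => f x * 'D_v g x + g x * 'D_v f x)) => // [x Ux|].
  by rewrite deriveM //; apply: diff_derivable; [exact: df|exact: dg].
by apply: times_differentiableD => //; apply: IH => //;
  by [exact: times_differentiableS|exact: Df|exact: Dg].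
Qed.

Lemma times_differentiableV k U f : open U -> (forall x, U x -> f x != 0) ->
  times_differentiable_on k U f -> times_differentiable_on k U (fun x => (f x)^-1).
Proof.
move=> oU f0; elim: k => [//|k IH] sf; have [df Df] := sf.
split=> [x Ux|v]; first by apply: differentiableV; [exact: df|exact: f0].
have sV := IH (times_differentiableS sf).
apply: (@times_differentiable_eq _ _
  (fun x => cst (-1) x * ((f x)^-1 * (f x)^-1) * 'D_v f x)) => // [x Ux|].
  rewrite (@deriveV _ _ f) ?f0 //; last by apply: diff_derivable; exact: df.
  by rewrite /GRing.scale /= mulN1r expr2 invfM.
apply: (times_differentiableM oU _ (Df v)).
apply: (times_differentiableM oU (times_differentiable_cst _ _ _)).
exact: times_differentiableM.
Qed.

Lemma smooth_onD U f g : open U -> smooth_on U f -> smooth_on U g ->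
  smooth_on U (fun x => f x + g x).
Proof. by move=> oU sf sg k; exact: times_differentiableD. Qed.

Lemma smooth_onM U f g : open U -> smooth_on U f -> smooth_on U g ->
  smooth_on U (fun x => f x * g x).
Proof. by move=> oU sf sg k; exact: times_differentiableM. Qed.

Lemma smooth_onV U f : open U -> (forall x, U x -> f x != 0) -> smooth_on U f ->
  smooth_on U (fun x => (f x)^-1).
Proof. by move=> oU f0 sf k; exact: times_differentiableV. Qed.

Lemma smooth_on_sum (J : finType) U (f : J -> 'rV[R]_n -> R) : open U ->
  (forall j, smooth_on U (f j)) -> smooth_on U (fun x => \sum_j f j x).
Proof.
move=> oU sf; have : forall s : seq J, smooth_on U (fun x => \sum_(j <- s) f j x).
  elim=> [|j s IH].
    by under eq_fun do rewrite big_nil; exact: smooth_on_cst.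
  by under eq_fun do rewrite big_cons; exact: smooth_onD.
exact.
Qed.

Lemma smooth_on_subset U W f : W `<=` U -> smooth_on U f -> smooth_on W f.
Proof. by move=> WU sf k; exact: times_differentiable_subset (sf k). Qed.

Lemma smooth_on_local U f :
  (forall x, U x -> exists W, [/\ open W, W x & smooth_on W f]) -> smooth_on U f.
Proof.
move=> H k; apply: times_differentiable_local => x /H[W [oW Wx sf]].
by exists W; split => //; exact: sf.
Qed.

Lemma smooth_on_derive U f v : smooth_on U f -> smooth_on U ('D_v f).
Proof. by move=> sf k; have [_ Df] := sf k.+1; exact: Df. Qed.

Lemma smooth_on_differentiable U f x : smooth_on U f -> U x -> differentiable f x.
Proof. by move=> /(_ 1%N) [df _]; exact: df. Qed.

Lemma smooth_on_continuous U f x : smooth_on U f -> U x -> {for x, continuous f}.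
Proof.
by move=> sf Ux; apply: differentiable_continuous; exact: smooth_on_differentiable sf Ux.
Qed.

Lemma derive_basis f x v : differentiable f x ->
  'D_v f x = \sum_i v 0 i * 'D_(delta_mx 0 i) f x.
Proof.
move=> df; rewrite deriveE // [in LHS](row_sum_delta v) linear_sum.
by apply: eq_bigr => i _; rewrite linearZ deriveE.
Qed.

End Fixed_dimension.

Lemma differentiable_row (n m : nat) (p : 'rV[R]_n -> 'rV[R]_m) x :
  (forall j, differentiable (fun y => p y 0 j) x) -> differentiable p x.
Proof.
move=> dp.
have -> : p = \sum_j (fun y => p y 0 j *: delta_mx 0 j).
  by apply/funext => y; rewrite fct_sumE {1}(row_sum_delta (p y)).
by apply: differentiable_sum => j; exact: differentiableZl.
Qed.

Lemma diff_row_coord (n m : nat) (p : 'rV[R]_n -> 'rV[R]_m) x v j :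
  differentiable p x -> ('d p x v) 0 j = 'D_v (fun y => p y 0 j) x.
Proof.
move=> dp; rewrite -deriveE // (derive_mx (@diff_derivable _ _ _ p x v dp)) mxE.
by congr ('D_v _ x); apply/funext => y.
Qed.

Lemma derive_comp_row (n m : nat) (p : 'rV[R]_n -> 'rV[R]_m) (f : 'rV[R]_m -> R) x v :
  (forall j, differentiable (fun y => p y 0 j) x) -> differentiable f (p x) ->
  'D_v (f \o p) x = \sum_j 'D_v (fun y => p y 0 j) x * 'D_(delta_mx 0 j) f (p x).
Proof.
move=> dpj df; have dp := differentiable_row dpj.
rewrite deriveE; last exact: differentiable_comp.
rewrite diff_comp //= -deriveE // derive_basis //.
by apply: eq_bigr => j _; rewrite diff_row_coord.
Qed.

(** By the chain rule a derivative of [f \o p] is a sum of smooth coefficients times partial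
    derivatives of [f] composed with [p], which have the same form. Only the conclusion is
    stratified by order: [f] stays smooth to all orders, so the induction applies to its partial
    derivatives. *)
Lemma smooth_on_comp (n m : nat) (U : set 'rV[R]_n) (W : set 'rV[R]_m)
    (p : 'rV[R]_n -> 'rV[R]_m) (f : 'rV[R]_m -> R) :
  open U -> (forall x, U x -> W (p x)) -> (forall j, smooth_on U (fun y => p y 0 j)) ->
  smooth_on W f -> smooth_on U (f \o p).
Proof.
move=> oU UW sp sf k; elim: k f sf => [//|k IH] f sf.
have dp x j : U x -> differentiable (fun y => p y 0 j) x.
  by move=> Ux; exact: smooth_on_differentiable (sp j) Ux.
have df x : U x -> differentiable f (p x).
  by move=> /UW; exact: smooth_on_differentiable.
split=> [x Ux|v].
  apply: differentiable_comp; last exact: df.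
  by apply: differentiable_row => j; exact: dp.
apply: (@times_differentiable_eq _ _ _
  (fun x => \sum_j 'D_v (fun y => p y 0 j) x * 'D_(delta_mx 0 j) f (p x))) => //.
  by move=> x Ux; rewrite derive_comp_row; [|move=> j; exact: dp|exact: df].
have H : forall s : seq 'I_m, times_differentiable_on k U
  (fun x => \sum_(j <- s) 'D_v (fun y => p y 0 j) x * 'D_(delta_mx 0 j) f (p x)).
  elim=> [|j s IHs].
    by under eq_fun do rewrite big_nil; exact: smooth_on_cst.
  under eq_fun do rewrite big_cons; apply: times_differentiableD => //.
  apply: times_differentiableM => //; first exact: smooth_on_derive.
  exact: IH (smooth_on_derive _ sf).
exact: H.
Qed.

End SmoothCalculus.

(** * Flat functions and bump functions *)

Section Bump.
Context {R : realType}.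

(* The linear span of these functions is stable under derivation. *)
Definition flat (n : nat) (x : R) : R :=
  if 0 < x then x^-1 ^+ n * expR (- x^-1) else 0.

Lemma flat_ge0 n x : 0 <= flat n x.
Proof.
rewrite /flat; case: ltP => // x0.
by rewrite mulr_ge0 ?expR_ge0 // exprn_ge0 // invr_ge0 ltW.
Qed.

Lemma flat_gt0 n x : 0 < x -> 0 < flat n x.
Proof. by move=> x0; rewrite /flat x0 mulr_gt0 ?expR_gt0 // exprn_gt0 // invr_gt0. Qed.

Lemma flat_le0 n x : x <= 0 -> flat n x = 0.
Proof. by rewrite /flat; case: ltP. Qed.

(** With m = n + 1, exp (y / m) is at least y / m; raising to the power m gives the bound. *)
Lemma exprn_le_expR (n : nat) (y : R) : 0 <= y ->
  y ^+ n.+1 <= n.+1%:R ^+ n.+1 * expR y.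
Proof.
move=> y0; have n0 : 0 < n.+1%:R :> R by rewrite ltr0n.
rewrite -{2}(divfK (lt0r_neq0 n0) y) [y / _ * _]mulrC expRM_natl -exprMn.
rewrite ler_pXn2r ?nnegrE ?mulr_ge0 ?expR_ge0 ?(ltW n0) //.
rewrite -ler_pdivrMl // mulrC.
by apply: le_trans (expR_ge1Dx _); rewrite lerDr.
Qed.

(** Taking y = 1/x in [exprn_le_expR], the surplus power of 1/x becomes the factor |x|. The bound
    serves to differentiate at the origin. *)
Lemma flat_bound n x : flat n x <= n.+1%:R ^+ n.+1 * `|x|.
Proof.
rewrite /flat; case: ltP => x0; last by rewrite mulr_ge0 // exprn_ge0.
have x'0 : 0 < x^-1 by rewrite invr_gt0.
rewrite gtr0_norm // expRN ler_pdivrMr ?expR_gt0 //.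
rewrite -(ler_pM2l x'0) -exprS.
have -> : x^-1 * (n.+1%:R ^+ n.+1 * x * expR x^-1) = n.+1%:R ^+ n.+1 * expR x^-1.
  by rewrite mulrAC mulrCA mulVf ?gt_eqF // mulr1.
have H := exprn_le_expR n (ltW x'0). exact H.
Qed.

Lemma is_derive_flat (n : nat) (x : R) :
  is_derive x 1 (flat n) (- n%:R * flat n.+1 x + flat n.+2 x).
Proof.
have [x0|x0|->] := ltgtP x 0.
- rewrite !flat_le0 ?ltW // mulr0 addr0.
  apply: (near_eq_is_derive _ (is_derive_cst (0 : R) x 1)).
  near=> y; rewrite flat_le0 // ltW //; near: y; exact: lt_nbhsl.
- have x_neq0 : x != 0 by rewrite gt_eqF.
  have dV : is_derive x 1 (@GRing.inv R) (- x ^- 2).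
    by have := @is_deriveV _ id x 1 1 x_neq0 (is_derive_id x 1);
      rewrite /GRing.scale /= mulr1.
  have dN : is_derive x 1 (fun y : R => - y^-1) (x ^- 2).
    by have := is_deriveN dV; rewrite opprK.
  have dE : is_derive x 1 (fun y : R => expR (- y^-1)) (x ^- 2 * expR (- x^-1)).
    have := @is_derive1_comp _ expR (fun y : R => - y^-1) _ _ _ (is_derive_expR (- x^-1)) dN.
    by rewrite mulrC.
  have dX : is_derive x 1 (fun y : R => y^-1 ^+ n) (- n%:R * x^-1 ^+ n.+1).
    have -> : (fun y : R => y^-1 ^+ n) = (@GRing.inv R : R -> R) ^+ n.
      by apply/funext => y; rewrite exprfctE.
    have dX0 := is_deriveX n dV; apply: (is_derive_eq dX0) => {dX0}.
    case: n => [|n]; first by rewrite !mul0r oppr0 mul0r scale0r.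
    by rewrite /GRing.scale /= !exprS; field.
  have dM := is_deriveM dX dE.
  have dF : is_derive x 1 (flat n) (x^-1 ^+ n *: (x ^- 2 * expR (- x^-1)) +
      expR (- x^-1) *: (- n%:R * x^-1 ^+ n.+1)).
    apply: near_eq_is_derive dM.
    near=> y; rewrite /flat ifT //; near: y; exact: lt_nbhsr.
  apply: (is_derive_eq dF).
  rewrite /flat x0 /GRing.scale /= -!exprVn !exprS; ring.
- rewrite !flat_le0 // mulr0 addr0.
  have H : h^-1 *: ((flat n \o shift (0 : R)) h%:A - flat n 0) @[h --> 0^'] --> (0 : R).
    apply/cvgr0Pnorm_le => e e0.
    (* The difference quotient [flat n h / h] is at most [flat n.+1 h], and [C] is the constant of
       [flat_bound] at [n.+1]. *)
    pose C : R := n.+2%:R ^+ n.+2.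
    have C0 : 0 < C by rewrite exprn_gt0.
    near=> h.
    have h_neq0 : h != 0 by near: h; exact: nbhs_dnbhs_neq.
    have hC : `|h| < e / C.
      near: h; apply: dnbhs0_lt; exact: divr_gt0.
    rewrite /= addr0 /GRing.scale /= mulr1 (flat_le0 n (lexx _)) subr0.
    apply: (@le_trans _ _ (flat n.+1 h)).
      rewrite /flat; case: ltP => h0; last by rewrite mulr0 normr0.
      by rewrite mulrA -exprS ger0_norm // mulr_ge0 ?expR_ge0 // exprn_ge0 // invr_ge0 ltW.
    apply: le_trans (flat_bound _ _) _.
    by rewrite mulrC -ler_pdivlMr // ltW.
  by apply: DeriveDef; [apply/cvg_ex; exists 0|exact: cvg_lim H].
Unshelve. all: by end_near. Qed.

Lemma smooth_flat n : smooth_on [set: 'rV[R]_1] (fun w => flat n (w 0 0)).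
Proof.
move=> k; elim: k n => [//|k IH] n.
have cd : forall w : 'rV[R]_1, differentiable (fun w : 'rV[R]_1 => w 0 0 : R) w.
  by move=> w; exact: differentiable_coord.
have fd : forall x, differentiable (flat n) x.
  by move=> x; apply/derivable1_diffP; have [] := is_derive_flat n x.
split=> [x _|v]; first exact: (differentiable_comp (cd x) (fd _)).
apply: (@times_differentiable_eq _ _ _ _ (fun w =>
   cst (v 0 0) w * (cst (- n%:R) w * flat n.+1 (w 0 0) + flat n.+2 (w 0 0)))).
- exact: openT.
- move=> w _; rewrite deriveE; last exact: (differentiable_comp (cd w) (fd _)).
  rewrite (diff_comp (cd w) (fd _)) /= diff1E // derive1E.
  have -> : 'd (fun w : 'rV[R]_1 => w 0 0 : R) w v = v 0 0.
    have -> : 'd (fun w : 'rV[R]_1 => w 0 0 : R) w v = 'd (id : 'rV[R]_1 -> _) w v 0 0.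
      by rewrite diff_row_coord // deriveE.
    by rewrite diff_val.
  by have [_ ->] := is_derive_flat n (w 0 0).
- apply: (times_differentiableM openT (times_differentiable_cst _ _ _)).
  apply: (times_differentiableD openT _ (IH _)).
  exact: (times_differentiableM openT (times_differentiable_cst _ _ _) (IH _)).
Qed.

Lemma smooth_on_flat_comp (n m : nat) (U : set 'rV[R]_m) (q : 'rV[R]_m -> R) :
  open U -> smooth_on U q -> smooth_on U (flat n \o q).
Proof.
move=> oU sq.
have -> : flat n \o q = (fun w : 'rV[R]_1 => flat n (w 0 0)) \o (fun x => \row_(_ < 1) q x).
  by apply/funext => x /=; rewrite mxE.
apply: (@smooth_on_comp _ _ _ _ setT) => //; last exact: smooth_flat.
by move=> j; under eq_fun do rewrite mxE.
Qed.

Lemma bump_function (n : nat) (a : 'rV[R]_n) (r : R) : 0 < r ->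
  exists b : 'rV[R]_n -> R, [/\ smooth_on setT b, \forall x \near a, b x = 1 &
    forall x, b x != 0 -> ball a r x].
Proof.
move=> r0; pose q (x : 'rV[R]_n) := \sum_i (x 0 i - a 0 i) * (x 0 i - a 0 i).
pose s := r * r.
have s0 : 0 < s by exact: mulr_gt0.
have sq : smooth_on setT q.
  apply: smooth_on_sum => [|i]; first exact: openT.
  have sc : smooth_on setT (fun x : 'rV[R]_n => x 0 i - a 0 i).
    by apply: (smooth_onD openT (@smooth_on_coord _ _ _ i) (@smooth_on_cst _ _ _ (- a 0 i))).
  exact: (smooth_onM openT sc sc).
have sN : smooth_on setT (fun x => - q x).
  have := smooth_onM openT (@smooth_on_cst R n setT (-1)) sq.
  by under eq_fun do rewrite mulN1r.
have s1 : smooth_on setT (fun x => flat 0 (s - q x)).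
  apply: (smooth_on_flat_comp 0 openT (q := fun x => s - q x)).
  exact: (smooth_onD openT (@smooth_on_cst _ _ _ s) sN).
have s2 : smooth_on setT (fun x => flat 0 (q x - s / 2)).
  apply: (smooth_on_flat_comp 0 openT (q := fun x => q x - s / 2)).
  exact: (smooth_onD openT sq (@smooth_on_cst _ _ _ (- (s / 2)))).
(* The bump is the quotient of the first summand by [d]. One of the two arguments is always
   positive, so [d] has no zero; the second summand vanishes where [q < s / 2], making the quotient
   1 there. *)
pose d x := flat 0 (s - q x) + flat 0 (q x - s / 2).
have d0 x : d x != 0.
  rewrite gt_eqF // /d; have [xs|xs] := ltP (q x) s.
    by rewrite ltr_pwDl ?flat_ge0 // flat_gt0 // subr_gt0.
  rewrite ltr_wpDl ?flat_ge0 // flat_gt0 //; lra.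
exists (fun x => flat 0 (s - q x) * (d x)^-1); split.
- apply: (smooth_onM openT s1); apply: (smooth_onV openT) => //.
  exact: (smooth_onD openT s1 s2).
- have qa : q a = 0 by rewrite /q big1 // => i _; rewrite subrr mul0r.
  have cq : {for a, continuous q} by apply: smooth_on_continuous sq _.
  have : \forall x \near a, q x < s / 2.
    have nq : nbhs (q a) [set y | y < s / 2] by rewrite qa; apply: lt_nbhsl; rewrite divr_gt0.
    exact: cq _ nq.
  apply: filterS => x qx.
  rewrite /d [flat 0 (q x - _)]flat_le0 ?addr0 ?divff //; last lra.
  by rewrite gt_eqF // flat_gt0 //; lra.
- move=> x bx; have qs : q x < s.
    rewrite ltNge; apply/negP => sqx; move: bx.
    by rewrite flat_le0 ?subr_le0 // mul0r eqxx.
  (* Balls are taken for the sup norm, whereas [q] is the squared Euclidean distance to [a]: each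
     squared coordinate difference is at most [q x]. *)
  rewrite -ball_normE /= [X in X < _]mx_normrE.
  apply/bigmax_ltP; split => //= -[i j] _ /=.
  rewrite (ord1 i) !mxE -ltr_sqr ?nnegrE ?(ltW r0) //.
  rewrite [X in _ < X]expr2 -/s real_normK ?num_real //.
  apply: le_lt_trans qs; rewrite /q (bigD1 j) //= expr2.
  rewrite -[X in X <= _]mulrNN !opprB lerDl sumr_ge0 // => k _.
  by rewrite -expr2 sqr_ge0.
Qed.

End Bump.

(** * Hadamard's lemma by integration along rays *)

Section Hadamard.
Context {R : realType} (n : nat).
Implicit Types (G : 'rV[R]_n -> R) (x y z a h v : 'rV[R]_n).

Lemma line_growth G y h (s : R) :
  (fun t : R => t^-1 *: (((fun u : R => G (u *: h + y)) \o shift s) (t *: 1)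
     - G (s *: h + y))) =
  (fun t : R => t^-1 *: ((G \o shift (s *: h + y)) (t *: h) - G (s *: h + y))).
Proof.
apply/funext => t /=.
by rewrite scalerDl addrA [t *: 1]mulr1.
Qed.

Lemma is_derive_line G y h (s : R) : differentiable G (s *: h + y) ->
  is_derive s 1 (fun u : R => G (u *: h + y)) ('D_h G (s *: h + y)).
Proof.
move=> dG; have := @diff_derivable _ _ _ G _ h dG; rewrite /derivable => dG'.
by apply: DeriveDef; rewrite /derivable /derive line_growth.
Qed.

Lemma closed_norm_le (rho : R) : closed [set z : 'rV[R]_n | `|z| <= rho].
Proof.
apply: (closed_comp (f := fun z : 'rV[R]_n => `|z|) (D := [set u : R | u <= rho])).
  by move=> z _; exact: norm_continuous.
exact: closed_le.
Qed.

Lemma smooth_bounded G (rho : R) : smooth_on setT G ->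
  exists2 C : R, 0 <= C & forall z, `|z| <= rho -> `|G z| <= C.
Proof.
move=> sG; have [rho0|rho0] := leP 0 rho; last first.
  by exists 0 => // z zr; have := normr_ge0 z; lra.
have [|||c _ cmax] := @EVT_max_rV R n (fun z => `|G z|) [set z | `|z| <= rho].
- by exists 0; rewrite /= normr0.
- apply: bounded_closed_compact; last exact: closed_norm_le.
  exists rho; split; first exact: num_real.
  by move=> M rM z /= zr; rewrite (le_trans zr) // ltW.
- apply: continuous_subspaceT => z; apply: continuous_comp; last exact: norm_continuous.
  exact: smooth_on_continuous sG _.
by exists `|G c| => // z zr; apply: cmax; rewrite inE.
Qed.

Lemma row_coord_le v i : `|v 0 i| <= `|v|.
Proof.
rewrite [leRHS]mx_normrE; apply: le_trans (le_bigmax _ _ (0, i)) => //=.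
Qed.

(** Two applications of the mean value theorem on the segment from [y] to [h + y] express the
    remainder by a second derivative. The point is that [C] is uniform in [y], as is required under
    an integral sign. *)
Lemma smooth_taylor2 G (rho : R) : smooth_on setT G ->
  exists2 C : R, 0 <= C & forall y h, `|y| <= rho -> `|h| <= 1 ->
    `|G (h + y) - G y - 'D_h G y| <= C * (`|h| * `|h|).
Proof.
move=> sG; pose e i : 'rV[R]_n := delta_mx 0 i.
have sGi i : smooth_on setT ('D_(e i) G) by exact: smooth_on_derive.
have sGij i j : smooth_on setT ('D_(e j) ('D_(e i) G)) by exact: smooth_on_derive.
have dG h z : differentiable ('D_h G) z.
  exact: smooth_on_differentiable (smooth_on_derive h sG) _.
have /choice[M HM] : forall ij : 'I_n * 'I_n, exists C : R, 0 <= C /\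
    forall z, `|z| <= rho + 1 -> `|'D_(e ij.2) ('D_(e ij.1) G) z| <= C.
  by move=> [i j]; have [C C0 HC] := smooth_bounded (rho + 1) (sGij i j); exists C.
have M0 ij : 0 <= M ij by have [] := HM ij.
(* Sum of bounds for the second partial derivatives on the ball of radius [rho + 1], which contains
   the segment because [h] has norm at most 1. *)
pose C := \sum_i \sum_j M (i, j).
have C0 : 0 <= C by apply: sumr_ge0 => i _; apply: sumr_ge0.
exists C => // y h yr h1.
have D2 z : `|z| <= rho + 1 -> `|'D_h ('D_h G) z| <= C * (`|h| * `|h|).
  move=> zr.
  have -> : 'D_h ('D_h G) z = \sum_i \sum_j h 0 i * h 0 j * 'D_(e j) ('D_(e i) G) z.
    have DhE : 'D_h G = \sum_i (h 0 i *: 'D_(e i) G).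
      apply/funext => w; rewrite derive_basis; last exact: smooth_on_differentiable sG _.
      by rewrite fct_sumE.
    have dz i v w : derivable ('D_(e i) G) w v.
      by apply: diff_derivable; exact: smooth_on_differentiable (sGi i) _.
    rewrite DhE derive_sum; last by move=> i; exact: derivableZ.
    apply: eq_bigr => i _; rewrite deriveZ //.
    rewrite derive_basis; last exact: smooth_on_differentiable (sGi i) _.
    by rewrite /GRing.scale /= mulr_sumr; apply: eq_bigr => j _; rewrite mulrA.
  rewrite /C mulr_suml; apply: le_trans (ler_norm_sum _ _ _) _.
  apply: ler_sum => i _; rewrite mulr_suml.
  apply: le_trans (ler_norm_sum _ _ _) _; apply: ler_sum => j _.
  rewrite !normrM mulrC; apply: ler_pM => //.
    by have [_] := HM (i, j); apply.
  by apply: ler_pM => //; exact: row_coord_le.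
have zr (s : R) : s \in `[0, 1] -> `|s *: h + y| <= rho + 1.
  rewrite in_itv /= => /andP[s0 s1].
  rewrite addrC (le_trans (ler_normD _ _)) // lerD // normrZ ger0_norm //.
  by rewrite -[leRHS]mulr1; apply: ler_pM.
have L0 (s : R) : is_derive s 1 (fun u : R => G (u *: h + y)) ('D_h G (s *: h + y)).
  by apply: is_derive_line; exact: smooth_on_differentiable sG _.
have L1 (s : R) : is_derive s 1 (fun u : R => 'D_h G (u *: h + y)) ('D_h ('D_h G) (s *: h + y)).
  exact: is_derive_line.
have cont (f df : R -> R) (A : set R) :
    (forall s : R, is_derive s 1 f (df s)) -> {within A, continuous f}.
  move=> fd; apply: continuous_subspaceT => s; apply: differentiable_continuous.
  by apply/derivable1_diffP; have [] := fd s.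
have [c c01] := MVT ltr01 (fun s _ => L0 s) (cont _ _ _ L0).
rewrite !scale0r !scale1r !add0r subr0 mulr1 => ->.
move: c01; rewrite in_itv /= => /andP[c0 c1].
have [d d01] := MVT c0 (fun s _ => L1 s) (cont _ _ _ L1).
rewrite scale0r add0r subr0 => ->.
move: d01; rewrite in_itv /= => /andP[d0 d1].
rewrite normrM -[leRHS]mulr1; apply: ler_pM => //.
  by apply/D2/zr; rewrite in_itv /= (ltW d0) ltW // (lt_trans d1).
by rewrite ger0_norm ltW.
Qed.

Notation mu := (@lebesgue_measure R).

(* The parametric integral through which Hadamard's lemma is proved; the
   exponent makes the class of these functions stable under derivation. *)
Definition ray_integral (a : 'rV[R]_n) (w : nat) (G : 'rV[R]_n -> R) x : R :=
  (\int[mu]_(t in `[0%R, 1%R]) (t ^+ w * G (t *: (x - a) + a)))%R.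

Lemma continuous_integrable01 (f : R -> R) : continuous f ->
  mu.-integrable `[0%R, 1%R] (EFin \o f).
Proof.
move=> cf; apply: continuous_compact_integrable; first exact: segment_compact.
exact: continuous_subspaceT.
Qed.

Lemma ray_continuous a w G x : smooth_on setT G ->
  continuous (fun t : R => t ^+ w * G (t *: (x - a) + a)).
Proof.
move=> sG t; apply: cvgM; first exact: exprn_continuous.
have [d _] := @is_derive_line G a (x - a) t (smooth_on_differentiable sG I).
by apply: differentiable_continuous; apply/derivable1_diffP.
Qed.

(** Exhibits the candidate for the differential of a ray integral as a linear form in [v] with
    explicit coefficients, from which continuity follows. *)
Lemma ray_integral_basis a w G v x : smooth_on setT G ->
  ray_integral a w ('D_v G) x =
  \sum_i v 0 i * ray_integral a w ('D_(delta_mx 0 i) G) x.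
Proof.
move=> sG.
have sGi i : smooth_on setT ('D_(delta_mx 0 i : 'rV[R]_n) G) by exact: smooth_on_derive.
pose F i (t : R) := v 0 i * (t ^+ w * 'D_(delta_mx 0 i) G (t *: (x - a) + a)).
have cF i : continuous (F i).
  move=> t; exact: cvgM (@cvg_cst _ (v 0 i) _ _ _) (@ray_continuous a w _ x (sGi i) t).
have -> : ray_integral a w ('D_v G) x =
    (\int[mu]_(t in `[0%R, 1%R]) (\sum_i F i t))%R.
  apply: eq_Rintegral => t _.
  rewrite derive_basis; last exact: smooth_on_differentiable sG _.
  by rewrite mulr_sumr; apply: eq_bigr => i _; rewrite /F mulrCA.
have H (s : seq 'I_n) : continuous (fun t : R => \sum_(i <- s) F i t) /\
    (\int[mu]_(t in `[0%R, 1%R]) (\sum_(i <- s) F i t))%R =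
    \sum_(i <- s) v 0 i * ray_integral a w ('D_(delta_mx 0 i) G) x.
  elim: s => [|i s [IHc IH]]; split.
  - by under eq_fun do rewrite big_nil; exact: cst_continuous.
  - by under eq_Rintegral do rewrite big_nil; rewrite big_nil Rintegral_cst // mul0r.
  - by under eq_fun do rewrite big_cons; move=> t; apply: cvgD; [exact: cF|exact: IHc].
  - under eq_Rintegral do rewrite big_cons.
    rewrite RintegralD //; [|exact: continuous_integrable01..].
    rewrite big_cons IH RintegralZl //.
    by apply: continuous_integrable01; exact: ray_continuous (sGi i).
by have [_ ->] := H (index_enum _).
Qed.

(** Differentiation under the integral sign: when [x] moves by [h], the point of the ray at time t
    moves by t h, and the factor t raises the exponent by one. The error is the integral of the
    uniform Taylor remainder. *)
Lemma ray_integral_diff a w G x : smooth_on setT G ->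
  differentiable (ray_integral a w G) x /\
  forall v, 'D_v (ray_integral a w G) x = ray_integral a w.+1 ('D_v G) x.
Proof.
move=> sG.
pose c i := ray_integral a w.+1 ('D_(delta_mx 0 i) G) x.
pose l (v : 'rV[R]_n) : R := \sum_i v 0 i * c i.
have lin : linear l.
  move=> k u v; rewrite /l scaler_sumr -big_split; apply: eq_bigr => i _ /=.
  by rewrite !mxE mulrDl /GRing.scale /= mulrA.
pose lM := GRing.isLinear.Build _ _ _ _ _ lin.
pose L : {linear 'rV[R]_n -> R} := HB.pack l lM.
have cl : continuous L.
  have sl : smooth_on setT l.
    apply: smooth_on_sum openT _ => i.
    exact: (smooth_onM openT (@smooth_on_coord _ _ _ i) (@smooth_on_cst _ _ _ (c i))).
  by move=> v; exact: smooth_on_continuous sl _.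
have LE v : L v = ray_integral a w.+1 ('D_v G) x by rewrite ray_integral_basis.
(* This radius bounds all points [t *: (x - a) + a] with t between 0 and 1. *)
have [C C0 HC] := smooth_taylor2 (`|x - a| + `|a|) sG.
have intJ y k F : smooth_on setT F ->
    mu.-integrable `[0%R, 1%R] (EFin \o (fun t : R => t ^+ k * F (t *: (y - a) + a))).
  by move=> sF; apply: continuous_integrable01; exact: ray_continuous sF.
have bound h : `|h| <= 1 ->
    `|ray_integral a w G (h + x) - (ray_integral a w G x + L h)| <= C * (`|h| * `|h|).
  move=> h1; have sDh := smooth_on_derive h sG.
  have iD : mu.-integrable `[0%R, 1%R] (EFin \o (fun t : R =>
      t ^+ w * G (t *: (h + x - a) + a) - t ^+ w * G (t *: (x - a) + a))).
    apply: continuous_integrable01 => t.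
    exact: cvgB (@ray_continuous a w _ (h + x) sG t) (@ray_continuous a w _ x sG t).
  have iDD : mu.-integrable `[0%R, 1%R] (EFin \o (fun t : R =>
      (t ^+ w * G (t *: (h + x - a) + a) - t ^+ w * G (t *: (x - a) + a))
      - t ^+ w.+1 * 'D_h G (t *: (x - a) + a))).
    apply: continuous_integrable01 => t.
    exact: cvgB (cvgB (@ray_continuous a w _ (h + x) sG t) (@ray_continuous a w _ x sG t))
      (@ray_continuous a w.+1 _ x sDh t).
  rewrite opprD addrA LE /ray_integral -RintegralB //; [|exact: intJ..].
  rewrite -RintegralB //; last exact: (intJ x w.+1 _ sDh).
  apply: le_trans (le_normr_Rintegral _ _) _ => //.
  have -> : C * (`|h| * `|h|) = (\int[mu]_(t in `[0%R, 1%R]) (C * (`|h| * `|h|)))%R.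
    by rewrite Rintegral_cst //= lebesgue_measure_itv /= lte_fin ltr01 /= subr0 mulr1.
  apply: le_Rintegral => //.
  - have := continuous_integrable01 (f := fun t : R =>
      `|(t ^+ w * G (t *: (h + x - a) + a) - t ^+ w * G (t *: (x - a) + a))
      - t ^+ w.+1 * 'D_h G (t *: (x - a) + a)|); apply => t.
    exact: cvg_norm (cvgB (cvgB (@ray_continuous a w _ (h + x) sG t) (@ray_continuous a w _ x sG t))
      (@ray_continuous a w.+1 _ x sDh t)).
  - by apply: continuous_integrable01 => t; exact: cvg_cst.
  move=> t; rewrite /= in_itv /= => /andP[t0 t1].
  have -> : t ^+ w * G (t *: (h + x - a) + a) - t ^+ w * G (t *: (x - a) + a)
      - t ^+ w.+1 * 'D_h G (t *: (x - a) + a) =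
    t ^+ w * (G (t *: h + (t *: (x - a) + a)) - G (t *: (x - a) + a)
      - 'D_(t *: h) G (t *: (x - a) + a)).
    have dG : differentiable G (t *: (x - a) + a) by exact: smooth_on_differentiable sG _.
    have -> : t *: (h + x - a) + a = t *: h + (t *: (x - a) + a).
      by rewrite -(addrA h) scalerDr addrA.
    have -> : 'D_(t *: h) G (t *: (x - a) + a) = t * 'D_h G (t *: (x - a) + a).
      by rewrite !deriveE // linearZ.
    by rewrite exprSr; ring.
  have tw : `|t ^+ w| <= 1 by rewrite normrX ger0_norm // exprn_ile1.
  have th : `|t *: h| <= `|h| by rewrite normrZ ger0_norm // ler_piMl.
  rewrite normrM -[leRHS]mul1r; apply: ler_pM => //.
  apply: le_trans (HC _ _ _ _) _.
  - apply: le_trans (ler_normD _ _) _; rewrite lerD2r normrZ ger0_norm //.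
    by rewrite ler_piMl.
  - exact: le_trans th h1.
  - by rewrite ler_wpM2l // ler_pM.
have expand : ray_integral a w G \o shift x = cst (ray_integral a w G x) + L +o_ (0 : 'rV[R]_n) id.
  apply/eqaddoP => e e0.
  have C1 : 0 < C + 1 by rewrite ltr_wpDl.
  have n1 : \forall h \near (0 : 'rV[R]_n), `|h| <= 1.
    by have := @nbhs0_le _ 'rV[R]_n 1 ltr01; exact.
  have n2 : \forall h \near (0 : 'rV[R]_n), `|h| <= e / (C + 1).
    by have := @nbhs0_le _ 'rV[R]_n _ (divr_gt0 e0 C1); exact.
  apply: filterS2 n1 n2 => h h1 he; rewrite !fctE /=; apply: le_trans (bound h h1) _.
  rewrite mulrA ler_wpM2r // mulrC; rewrite ler_pdivlMr // in he.
  by apply: le_trans he; rewrite ler_wpM2l // lerDl.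
have E := diff_unique cl expand.
have df : differentiable (ray_integral a w G) x by apply/diff_locallyP; rewrite E.
by split=> // v; rewrite deriveE // E LE.
Qed.

Lemma smooth_ray_integral a w G : smooth_on setT G -> smooth_on setT (ray_integral a w G).
Proof.
move=> sG k; elim: k w G sG => [//|k IH] w G sG; split=> [x _|v].
  by have [] := ray_integral_diff a w x sG.
have -> : 'D_v (ray_integral a w G) = ray_integral a w.+1 ('D_v G).
  by apply/funext => x; have [_ ->] := ray_integral_diff a w x sG.
exact: IH (smooth_on_derive v sG).
Qed.

(** The fundamental theorem of calculus on the ray from [a] to [x] writes [G x - G a] as the
    integral of the derivative in direction [x - a]; [h i] is the integrated partial derivative,
    whose integrand is constant when [x = a]. *)
Lemma hadamard a G : smooth_on setT G -> exists h : 'I_n -> 'rV[R]_n -> R,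
  [/\ forall i, smooth_on setT (h i),
      forall x, G x = G a + \sum_i (x 0 i - a 0 i) * h i x &
      forall i, h i a = 'D_(delta_mx 0 i) G a].
Proof.
move=> sG; exists (fun i => ray_integral a 0 ('D_(delta_mx 0 i) G)); split.
- by move=> i; apply: smooth_ray_integral; exact: smooth_on_derive.
- move=> x; have sDv := smooth_on_derive (x - a) sG.
  transitivity (G a + ray_integral a 0 ('D_(x - a) G) x); last first.
    by rewrite ray_integral_basis //; congr (_ + _); apply: eq_bigr => i _; rewrite !mxE.
  have L0 (s : R) : is_derive s 1 (fun u : R => G (u *: (x - a) + a))
      ('D_(x - a) G (s *: (x - a) + a)).
    by apply: is_derive_line; exact: smooth_on_differentiable sG _.
  have cL : continuous (fun u : R => G (u *: (x - a) + a)).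
    move=> s; apply: differentiable_continuous.
    by apply/derivable1_diffP; have [] := L0 s.
  have H := @continuous_FTC2 R (fun t => 'D_(x - a) G (t *: (x - a) + a))
    (fun u : R => G (u *: (x - a) + a)) 0 1 ltr01.
  rewrite /ray_integral /Rintegral; under eq_integral do rewrite expr0 mul1r.
  rewrite H.
  + have -> : 1 *: (x - a) + a = x by rewrite scale1r subrK.
    have -> : (0 : R) *: (x - a) + a = a by rewrite scale0r add0r.
    by rewrite -EFinB /=; ring.
  + apply: continuous_subspaceT => t.
    have := @ray_continuous a 0 _ x sDv t.
    by under eq_fun do rewrite expr0 mul1r.
  + split.
    * by move=> t _; have [] := L0 t.
    * by apply: cvg_at_right_filter; exact: cL.
    * by apply: cvg_at_left_filter; exact: cL.
  + by move=> t _; rewrite derive1E; have [_ ->] := L0 t.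
- move=> i; rewrite /ray_integral.
  under eq_Rintegral do rewrite expr0 mul1r subrr scaler0 add0r.
  by rewrite Rintegral_cst //= lebesgue_measure_itv /= lte_fin ltr01 /= subr0 mulr1.
Qed.

End Hadamard.

(** * Smooth functions and vector fields on manifolds *)

Section LocalSmoothness.
Context {R : realType} (M : manifold R).
Implicit Types (f g : M -> R) (x y : M) (c : chart R M (mdim M)).

(** One chart is enough, since smooth transition maps transfer the condition to any other chart
    around [x] ([smooth_at_chart]). This local form is the one stable under gluing. *)
Definition smooth_at f x : Prop := exists c, [/\ @atlas R M c, cdom c x &
  exists W, [/\ open W, W (cmap c x), W `<=` cimg c & smooth_on W (f \o cinv c)]].

Lemma nbhs_cinv c x (A : set M) : cdom c x -> nbhs x A ->
  nbhs (cmap c x) (cimg c `&` cinv c @^-1` A).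
Proof.
move=> cx nA; apply: filterI.
  by apply: open_nbhs_nbhs; split; [exact: open_cimg|exact: cmap_img].
by apply: (cinv_continuous (cmap_img cx)); rewrite cmapK.
Qed.

Lemma nbhs_cmap c x (A : set 'rV[R]_(mdim M)) : cdom c x -> nbhs (cmap c x) A ->
  nbhs x (cdom c `&` cmap c @^-1` A).
Proof.
move=> cx nA; apply: filterI.
  by apply: open_nbhs_nbhs; split => //; exact: open_cdom.
exact: (cmap_continuous cx) nA.
Qed.

Lemma open_chart_change c c' (W : set 'rV[R]_(mdim M)) : open W ->
  open (cimg c' `&` cinv c' @^-1` (cdom c `&` cmap c @^-1` W)).
Proof.
move=> oW; rewrite openE => z [z' [dz Wz]].
rewrite /interior -{1}(cinvK z').
apply: nbhs_cinv; first exact: cinv_dom.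
by apply: nbhs_cmap => //; exact: open_nbhs_nbhs.
Qed.

Lemma smooth_on_chart_change c c' f (W : set 'rV[R]_(mdim M)) :
  @atlas R M c -> @atlas R M c' -> open W -> smooth_on W (f \o cinv c) ->
  smooth_on (cimg c' `&` cinv c' @^-1` (cdom c `&` cmap c @^-1` W)) (f \o cinv c').
Proof.
move=> ac ac' oW sf; have oW' := @open_chart_change c c' _ oW.
apply: (@eq_smooth_on _ _ _ ((f \o cinv c) \o (cmap c \o cinv c'))) => //.
  by move=> z [z' [dz Wz]] /=; rewrite cmapK.
apply: (@smooth_on_comp _ _ _ _ W) => //; first by move=> z [_ [_]].
move=> j; apply: smooth_on_subset (atlas_smooth ac' ac j) => z [z' [dz _]].
by split.
Qed.

Lemma smooth_at_chart c f x : @atlas R M c -> cdom c x -> smooth_at f x ->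
  exists W, [/\ open W, W (cmap c x), W `<=` cimg c & smooth_on W (f \o cinv c)].
Proof.
move=> ac cx [d [ad dx [W [oW Wx Wd sf]]]].
exists (cimg c `&` cinv c @^-1` (cdom d `&` cmap d @^-1` W)); split.
- exact: open_chart_change.
- by split; [exact: cmap_img|rewrite /= cmapK].
- by move=> z [].
- exact: smooth_on_chart_change.
Qed.

Lemma smoothP f : smooth f <-> forall x, smooth_at f x.
Proof.
split=> [sf x|sf c ac].
  have [c ac cx] := atlas_cover x; exists c; split => //; exists (cimg c); split => //.
  - exact: open_cimg.
  - exact: cmap_img.
  - exact: sf.
apply: smooth_on_local => z zc.
have [W [oW Wx Wc sW]] := smooth_at_chart ac (cinv_dom zc) (sf (cinv c z)).
by exists W; split => //; rewrite cinvK in Wx.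
Qed.

Lemma smooth_at_smooth f x : smooth f -> smooth_at f x.
Proof. by move/smoothP. Qed.

Lemma smooth_at_eq f g x : (\forall y \near x, f y = g y) -> smooth_at f x -> smooth_at g x.
Proof.
move=> fg [c [ac cx [W [oW Wx Wc sf]]]]; exists c; split => //.
have /nbhs_cinv -/(_ c cx) := fg; rewrite nbhsE => -[U [oU Ux] UH].
exists (W `&` U); split => //.
- exact: openI.
- by move=> z [/Wc].
apply: (@eq_smooth_on _ _ _ (f \o cinv c)); first exact: openI.
  by move=> z [_ /UH[_]].
by apply: smooth_on_subset sf => z [].
Qed.

Lemma smooth_at_op2 (op : R -> R -> R) f g x :
  (forall (U : set 'rV[R]_(mdim M)) F G, open U -> smooth_on U F -> smooth_on U G ->
     smooth_on U (fun z => op (F z) (G z))) ->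
  smooth_at f x -> smooth_at g x -> smooth_at (fun y => op (f y) (g y)) x.
Proof.
move=> H [c [ac cx [W [oW Wx Wc sf]]]] sg.
have [W' [oW' Wx' Wc' sg']] := smooth_at_chart ac cx sg.
exists c; split => //; exists (W `&` W'); split => //.
- exact: openI.
- by move=> z [/Wc].
- apply: (H _ (f \o cinv c) (g \o cinv c)); first exact: openI.
  + by apply: smooth_on_subset sf => z [].
  + by apply: smooth_on_subset sg' => z [].
Qed.

Lemma smooth_atD f g x : smooth_at f x -> smooth_at g x -> smooth_at (fun y => f y + g y) x.
Proof. by apply: (smooth_at_op2 (op := +%R)) => *; exact: smooth_onD. Qed.

Lemma smooth_atM f g x : smooth_at f x -> smooth_at g x -> smooth_at (fun y => f y * g y) x.
Proof. by apply: (smooth_at_op2 (op := *%R)) => *; exact: smooth_onM. Qed.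

Lemma smooth_at_cst (a : R) x : smooth_at (fun=> a) x.
Proof.
by apply: smooth_at_smooth => c ac; exact: (smooth_on_cst _ a).
Qed.

Lemma smooth_at_continuous f x : smooth_at f x -> {for x, continuous f}.
Proof.
move=> [c [ac cx [W [oW Wx Wc sf]]]] A nA.
have cf := smooth_on_continuous sf Wx.
have : nbhs (cmap c x) ((f \o cinv c) @^-1` A) by apply: cf; rewrite /= cmapK.
move=> /(nbhs_cmap cx); apply: filterS => y [dy] /=.
by rewrite /= cmapK.
Qed.

Lemma smooth_atV f x : f x != 0 -> smooth_at f x -> smooth_at (fun y => (f y)^-1) x.
Proof.
move=> fx0 sf.
have n0 : \forall y \near x, f y != 0.
  have n0' : nbhs (f x) [set t | t != 0].
    by apply: open_nbhs_nbhs; split => //; exact: open_neq.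
  exact: (smooth_at_continuous sf) n0'.
have [c [ac cx [W [oW Wx Wc sW]]]] := sf.
exists c; split => //.
have /nbhs_cinv -/(_ c cx) := n0; rewrite nbhsE => -[U [oU Ux] UH].
exists (W `&` U); split => //.
- exact: openI.
- by move=> z [/Wc].
apply: (@smooth_onV _ _ _ (f \o cinv c)); first exact: openI.
  by move=> z [_ /UH[_]].
by apply: smooth_on_subset sW => z [].
Qed.

Lemma smooth_at_sum (J : finType) (P : pred J) (f : J -> M -> R) x :
  (forall j, P j -> smooth_at (f j) x) -> smooth_at (fun y => \sum_(j | P j) f j y) x.
Proof.
move=> sf; have : forall s : seq J, smooth_at (fun y => \sum_(j <- s | P j) f j y) x.
  elim=> [|j s IH].
    by under eq_fun do rewrite big_nil; exact: smooth_at_cst.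
  under eq_fun do rewrite big_cons.
  by have [Pj|//] := boolP (P j); apply: smooth_atD => //; exact: sf.
exact.
Qed.

Lemma smooth_at_prod (J : finType) (f : J -> M -> R) x :
  (forall j, smooth_at (f j) x) -> smooth_at (fun y => \prod_j f j y) x.
Proof.
move=> sf; have : forall s : seq J, smooth_at (fun y => \prod_(j <- s) f j y) x.
  elim=> [|j s IH].
    by under eq_fun do rewrite big_nil; exact: smooth_at_cst.
  by under eq_fun do rewrite big_cons; exact: smooth_atM.
exact.
Qed.

Lemma smooth_cst (a : R) : smooth (fun _ : M => a).
Proof. by apply/smoothP => x; exact: smooth_at_cst. Qed.

Lemma smoothD f g : smooth f -> smooth g -> smooth (fun y => f y + g y).
Proof. by move=> /smoothP sf /smoothP sg; apply/smoothP => x; exact: smooth_atD. Qed.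

Lemma smoothM f g : smooth f -> smooth g -> smooth (fun y => f y * g y).
Proof. by move=> /smoothP sf /smoothP sg; apply/smoothP => x; exact: smooth_atM. Qed.

Lemma smoothN f : smooth f -> smooth (fun y => - f y).
Proof.
move=> sf; have := smoothM (smooth_cst (-1)) sf.
by under eq_fun do rewrite mulN1r.
Qed.

Lemma smoothB f g : smooth f -> smooth g -> smooth (fun y => f y - g y).
Proof. by move=> sf sg; apply: smoothD => //; exact: smoothN. Qed.

Lemma smooth_sum (J : finType) (P : pred J) (f : J -> M -> R) :
  (forall j, P j -> smooth (f j)) -> smooth (fun y => \sum_(j | P j) f j y).
Proof.
by move=> sf; apply/smoothP => x; apply: smooth_at_sum => j /sf; exact: smooth_at_smooth.
Qed.

Lemma smooth_continuous f : smooth f -> continuous f.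
Proof. by move=> /smoothP sf x; exact: smooth_at_continuous. Qed.

(** * Extension of functions from a chart to the manifold *)

Section Cutoff.
Variables (c : chart R M (mdim M)) (b : 'rV[R]_(mdim M) -> R) (K : set 'rV[R]_(mdim M)).
Hypotheses (ac : @atlas R M c) (sb : smooth_on setT b) (cK : compact K)
  (Kc : K `<=` cimg c) (bK : forall z, b z != 0 -> K z).
Implicit Types G : 'rV[R]_(mdim M) -> R.

(** Two open sets cover the space: [cimg c], where both factors are smooth, and the complement of
    the compact [K], where the product is zero whatever [G] is. *)
Lemma smooth_on_cutoff G : smooth_on (cimg c) G -> smooth_on setT (fun z => b z * G z).
Proof.
move=> sG; apply: smooth_on_local => z _; have [Kz|Kz] := pselect (K z).
  exists (cimg c); split; [exact: open_cimg|exact: Kc|].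
  by apply: smooth_onM; [exact: open_cimg|exact: smooth_on_subset sb|].
exists (~` K); split => //.
  by apply: closed_openC; apply: compact_closed cK; exact: norm_hausdorff.
apply: (@eq_smooth_on _ _ _ (cst 0)); last exact: smooth_on_cst.
  by apply: closed_openC; apply: compact_closed cK; exact: norm_hausdorff.
move=> w /= nKw; have [->|/eqP/bK//] := pselect (b w = 0).
by rewrite mul0r.
Qed.

(** The case distinction is forced by [cmap c] being arbitrary outside [cdom c]. *)
Definition chart_cutoff G (y : M) : R :=
  if `[< cdom c y >] then b (cmap c y) * G (cmap c y) else 0.

Lemma chart_cutoffE G y : cdom c y -> chart_cutoff G y = b (cmap c y) * G (cmap c y).
Proof. by move=> cy; rewrite /chart_cutoff asboolT. Qed.

(** Outside the chart the function vanishes near each point: the support lies in the image of [K],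
    which is compact, hence closed because the manifold is Hausdorff. *)
Lemma smooth_chart_cutoff G : smooth_on (cimg c) G -> smooth (chart_cutoff G).
Proof.
move=> sG; apply/smoothP => y; have [cy|ncy] := pselect (cdom c y).
  exists c; split => //; exists (cimg c); split => //; [exact: open_cimg|exact: cmap_img|].
  apply: (@eq_smooth_on _ _ _ (fun z => b z * G z)); first exact: open_cimg.
    by move=> z cz /=; rewrite chart_cutoffE ?cinvK //; exact: cinv_dom.
  by apply: smooth_on_subset (smooth_on_cutoff sG).
pose L := cinv c @` K.
have cL : closed L.
  apply: compact_closed; first exact: manifold_hausdorff.
  apply: continuous_compact => //; apply: continuous_in_subspaceT => z /[!inE] /Kc cz.
  exact: cinv_continuous.
have nLy : ~ L y by move=> [z /Kc cz zy]; apply: ncy; rewrite -zy; exact: cinv_dom.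
have : nbhs y (~` L) by apply: open_nbhs_nbhs; split => //; exact: closed_openC.
move=> nL; apply: (@smooth_at_eq (fun=> 0)); last exact: smooth_at_cst.
apply: filterS nL => w /= nLw; rewrite /chart_cutoff; case: asboolP => // cw.
have [->|/eqP/bK Kw] := pselect (b (cmap c w) = 0); first by rewrite mul0r.
by exfalso; apply: nLw; exists (cmap c w) => //; rewrite cmapK.
Qed.

End Cutoff.

Lemma cutoff_exists (a : 'rV[R]_(mdim M)) (U : set 'rV[R]_(mdim M)) : nbhs a U ->
  exists b K, [/\ smooth_on setT b, \forall z \near a, b z = 1, compact K, K `<=` U &
    forall z, b z != 0 -> K z].
Proof.
move=> /nbhs_ballP[e /= e0 eU].
(* Half the radius, so that the closed ball, which is compact, still lies in [U]. *)
have e20 : 0 < e / 2 by rewrite divr_gt0.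
have [b [sb b1 bb]] := bump_function a e20.
exists b, (closed_ball a (e / 2)); split => //.
- apply: bounded_closed_compact; last exact: closed_ball_closed.
  exists (`|a| + e / 2); split; first exact: num_real.
  move=> C aC z; rewrite closed_ballE // => /= az.
  have az' : `|a - z| <= e / 2 by exact: az.
  apply: le_trans (ltW aC); rewrite -[z in `|z|](subKr a).
  by apply: le_trans (ler_normB _ _) _; rewrite lerD2l.
- apply: subset_trans eU => z; rewrite closed_ballE // -ball_normE /= => /le_lt_trans; apply.
  by rewrite gtr_pMr // invf_lt1 // ltr1n.
- by move=> z /bb; exact: subset_closed_ball.
Qed.

Lemma bump_manifold x (A : set M) : nbhs x A ->
  exists b : M -> R, [/\ smooth b, \forall y \near x, b y = 1 & forall y, b y != 0 -> A y].
Proof.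
move=> nA; have [c ac cx] := atlas_cover x.
have [b [K [sb b1 cK KA bK]]] := cutoff_exists (nbhs_cinv cx nA).
exists (chart_cutoff c b (cst 1)); split.
- apply: (smooth_chart_cutoff ac sb cK _ bK); first by move=> z /KA[].
  exact: smooth_on_cst.
- apply: filterS (nbhs_cmap cx b1) => y [cy /=].
  by rewrite chart_cutoffE // => ->; rewrite mulr1.
- move=> y; rewrite /chart_cutoff; case: asboolP => [cy|]; last by rewrite eqxx.
  by rewrite mulr1 => /bK/KA[_] /=; rewrite cmapK.
Qed.

End LocalSmoothness.

Lemma derive_coord {R : realType} (n : nat) (v x : 'rV[R]_n) (j : 'I_n) :
  'D_v (fun z : 'rV[R]_n => z 0 j) x = v 0 j.
Proof.
have [di Di] := is_diff_id x; have <- := @diff_row_coord R n n id x v j di.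
by rewrite Di.
Qed.

(** * Derivations and local frames *)

Section Tangent.
Context {R : realType} (M : manifold R).
Implicit Types (f g : M -> R) (x y : M) (v w : tvec M) (X Y : field M).

Lemma tangent_ext x v w : tangent x v -> tangent x w ->
  (forall f, smooth f -> v f = w f) -> v = w.
Proof.
move=> tv tw vw; apply/funext => f; have [sf|nsf] := pselect (smooth f); first exact: vw.
by rewrite (tangent_smooth tv nsf) (tangent_smooth tw nsf).
Qed.

Lemma tangentD x v f g : tangent x v -> smooth f -> smooth g ->
  v (fun y => f y + g y) = v f + v g.
Proof.
move=> tv sf sg; have := tangent_linear tv 1 sf sg.
by rewrite mul1r; under eq_fun do rewrite mul1r.
Qed.

Lemma tangent_cst x v (a : R) : tangent x v -> v (fun=> a) = 0.
Proof.
move=> tv; have s1 := @smooth_cst R M 1; have s0 := @smooth_cst R M 0.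
have v0 : v (fun=> 0) = 0.
  have := tangentD tv s0 s0; under eq_fun do rewrite addr0.
  by move/(congr1 (fun t => t - v (fun=> 0))); rewrite subrr addrK.
have v1 : v (fun=> 1) = 0.
  have := tangent_leibniz tv s1 s1; under eq_fun do rewrite mulr1.
  by rewrite mulr1 mul1r => /(congr1 (fun t => t - v (fun=> 1))); rewrite subrr addrK.
have := tangent_linear tv a s1 s0; under eq_fun do rewrite mulr1 addr0.
by rewrite v0 v1 mulr0 addr0.
Qed.

Lemma tangentZ x v (a : R) f : tangent x v -> smooth f -> v (fun y => a * f y) = a * v f.
Proof.
move=> tv sf; have := tangent_linear tv a sf (smooth_cst 0).
by under eq_fun do rewrite addr0; rewrite (tangent_cst 0 tv) addr0.
Qed.

Lemma tangentB x v f g : tangent x v -> smooth f -> smooth g ->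
  v (fun y => f y - g y) = v f - v g.
Proof.
move=> tv sf sg; have := tangent_linear tv (-1) sg sf.
by under eq_fun do rewrite mulN1r addrC; rewrite mulN1r addrC.
Qed.

Lemma tangent_sum (J : finType) x v (f : J -> M -> R) : tangent x v ->
  (forall j, smooth (f j)) -> v (fun y => \sum_j f j y) = \sum_j v (f j).
Proof.
move=> tv sf; have H (s : seq J) : smooth (fun y => \sum_(j <- s) f j y) /\
    v (fun y => \sum_(j <- s) f j y) = \sum_(j <- s) v (f j).
  elim: s => [|j s [IHs IH]]; split.
  - by under eq_fun do rewrite big_nil; exact: smooth_cst.
  - by under eq_fun do rewrite big_nil; rewrite (tangent_cst 0 tv) big_nil.
  - by under eq_fun do rewrite big_cons; exact: smoothD.
  - by under eq_fun do rewrite big_cons; rewrite (tangentD tv) // IH big_cons.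
by have [] := H (index_enum J).
Qed.

(** With a bump [b] supported where [f = g], the product [(f - g) b] is identically zero; the
    Leibniz rule at [x], where [b] is 1 and [f - g] is 0, leaves [v (f - g) = 0]. *)
Lemma tangent_local x v f g : tangent x v -> smooth f -> smooth g ->
  (\forall y \near x, f y = g y) -> v f = v g.
Proof.
move=> tv sf sg fg; have [b [sb b1 bfg]] := bump_manifold fg.
have bx : b x = 1 by exact: nbhs_singleton b1.
have fgx : f x - g x = 0 by rewrite (nbhs_singleton fg) subrr.
have := tangent_leibniz tv (smoothB sf sg) sb.
have -> : (fun y => (f y - g y) * b y) = fun=> 0.
  apply/funext => y; have [->|/eqP/bfg ->] := pselect (b y = 0); first by rewrite mulr0.
  by rewrite subrr mul0r.
rewrite (tangent_cst 0 tv) (tangentB tv) // bx fgx mulr1 mul0r addr0 => /esym/eqP.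
by rewrite subr_eq0 => /eqP.
Qed.

Lemma tangentP_linear x (k : R) v w : tangent x v -> tangent x w -> tangent x (k *: v + w).
Proof.
move=> tv tw; have E f : (k *: v + w) f = k * v f + w f by [].
split=> [a f g sf sg|f g sf sg|f nsf]; rewrite !E.
- rewrite (tangent_linear tv) // (tangent_linear tw) //; ring.
- rewrite (tangent_leibniz tv) // (tangent_leibniz tw) //; ring.
- by rewrite (tangent_smooth tv) // (tangent_smooth tw) // mulr0 addr0.
Qed.

Lemma tangent0 x : tangent x (0 : tvec M).
Proof. by split=> [a f g _ _|f g _ _|//]; rewrite /= ?mulr0 ?mul0r addr0. Qed.

Lemma tangent_add x v w : tangent x v -> tangent x w -> tangent x (v + w).
Proof. by move=> tv /(tangentP_linear 1 tv); rewrite scale1r. Qed.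

Lemma tangent_scale x (k : R) v : tangent x v -> tangent x (k *: v).
Proof. by move=> tv; have := tangentP_linear k tv (tangent0 x); rewrite addr0. Qed.

Lemma tangent_opp x v : tangent x v -> tangent x (- v).
Proof. by rewrite -scaleN1r; exact: tangent_scale. Qed.

Lemma tangent_sub x v w : tangent x v -> tangent x w -> tangent x (v - w).
Proof. by move=> tv /tangent_opp; exact: tangent_add. Qed.

Lemma tangent_sumv (J : finType) x (v : J -> tvec M) :
  (forall j, tangent x (v j)) -> tangent x (\sum_j v j).
Proof.
by move=> tv; elim/big_ind: _ => //; [exact: tangent0|exact: tangent_add].
Qed.

Lemma sum_tvecE (J : finType) (v : J -> tvec M) f : (\sum_j v j) f = \sum_j v j f.
Proof. by rewrite fct_sumE. Qed.

(* A frame near a point of the chart [c], together with functions that extend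
   the coordinates of [c] near that point. *)
Lemma local_frame (c : chart R M (mdim M)) x : @atlas R M c -> cdom c x ->
  exists (X : 'I_(mdim M) -> M -> R) (E : 'I_(mdim M) -> field M),
  [/\ forall i, smooth (X i), forall i, is_field (E i) & \forall y \near x,
    [/\ cdom c y, forall i, X i y = cmap c y 0 i,
        forall v, tangent y v -> v = \sum_i v (X i) *: E i y &
        forall i j, E i y (X j) = (i == j)%:R]].
Proof.
move=> ac cx.
have nc : nbhs (cmap c x) (cimg c).
  by apply: open_nbhs_nbhs; split; [exact: open_cimg|exact: cmap_img].
have [b [K [sb b1 cK Kc bK]]] := cutoff_exists nc.
pose e i : 'rV[R]_(mdim M) := delta_mx 0 i.
pose ext := chart_cutoff c b.
have sext G : smooth_on (cimg c) G -> smooth (ext G).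
  exact: (smooth_chart_cutoff ac sb cK Kc bK).
have sD g i : smooth g -> smooth_on (cimg c) ('D_(e i) (g \o cinv c)).
  by move=> sg; apply: smooth_on_derive; exact: sg.
have dg g y : smooth g -> cdom c y -> differentiable (g \o cinv c) (cmap c y).
  move=> sg cy; apply: smooth_on_differentiable (cmap_img cy); exact: sg.
have dg' g y i : smooth g -> cdom c y -> derivable (g \o cinv c) (cmap c y) (e i).
  by move=> sg cy; apply: diff_derivable; exact: dg.
pose X i := ext (fun z => z 0 i).
have sX i : smooth (X i) by apply: sext; exact: smooth_on_coord.
pose E i : field M := fun y g =>
  if `[< smooth g >] then ext ('D_(e i) (g \o cinv c)) y else 0.
have EE i y g : smooth g -> E i y g = ext ('D_(e i) (g \o cinv c)) y.
  by move=> sg; rewrite /E asboolT.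
have tE i y : tangent y (E i y).
  split=> [k f g sf sg|f g sf sg|f nsf]; last by rewrite /E asboolF.
  - rewrite !EE //; last by apply: smoothD => //; apply: smoothM => //; exact: smooth_cst.
    rewrite /ext /chart_cutoff; case: asboolP => [cy|]; last by rewrite mulr0 addr0.
    have -> : (fun y0 => k * f y0 + g y0) \o cinv c =
      (k *: (f \o cinv c)) + (g \o cinv c) by [].
    rewrite deriveD ?deriveZ //; [|exact: dg'|by apply: derivableZ; exact: dg'|exact: dg'].
    by rewrite /GRing.scale /=; ring.
  - rewrite !EE //; last exact: smoothM.
    rewrite /ext /chart_cutoff; case: asboolP => [cy|]; last by rewrite mulr0 mul0r addr0.
    have -> : (fun y0 => f y0 * g y0) \o cinv c = (f \o cinv c) * (g \o cinv c) by [].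
    rewrite deriveM; [|exact: dg'..].
    by rewrite /GRing.scale /= cmapK //; ring.
have fE i : is_field (E i).
  split=> // g sg; have -> : (fun y => E i y g) = ext ('D_(e i) (g \o cinv c)).
    by apply/funext => y; exact: EE.
  by apply: sext; exact: sD.
exists X, E; split => //.
(* Passing to the interior makes [b = 1] hold near each nearby point, not merely at it, so that
   germs at that point can be compared. *)
have b2 := nbhs_interior b1.
apply: filterS (nbhs_cmap cx b2) => y [cy] /= {}b2.
have b_y : b (cmap c y) = 1 by exact: nbhs_singleton b2.
split=> //.
- by move=> i; rewrite /X /ext chart_cutoffE // b_y mul1r.
- move=> v tv; apply: (tangent_ext tv).
    by apply: tangent_sumv => i; apply: tangent_scale.
  move=> g sg; rewrite sum_tvecE.
  (* Hadamard's lemma needs a function smooth on the whole space, hence the factor [b]. In the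
     resulting expansion around [y], the Leibniz rule leaves only the terms in which [v]
     differentiates a coordinate. *)
  have sG : smooth_on setT (fun z => b z * (g \o cinv c) z).
    by apply: (smooth_on_cutoff sb cK Kc bK); exact: sg.
  have [h [sh hG h0]] := hadamard (cmap c y) sG.
  have sh' i : smooth_on (cimg c) (h i) by apply: smooth_on_subset (sh i).
  pose H i := ext (h i).
  have sH i : smooth (H i) by exact: sext.
  have sXc i : smooth (fun y' => X i y' - X i y) by apply: smoothB => //; exact: smooth_cst.
  have gE : \forall y' \near y, g y' = g y + \sum_i (X i y' - X i y) * H i y'.
    apply: filterS (nbhs_cmap cy (nbhs_interior b2)) => y' [cy'] /= {}b2.
    have b_y' : b (cmap c y') = 1 by exact: nbhs_singleton b2.
    have := hG (cmap c y'); rewrite b_y b_y' !mul1r /= !cmapK // => ->.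
    congr (_ + _); apply: eq_bigr => i _.
    by rewrite /X /H /ext !chart_cutoffE // b_y b_y' !mul1r.
  have sS : smooth (fun y' => \sum_i (X i y' - X i y) * H i y').
    by apply: smooth_sum => i _; exact: smoothM.
  rewrite (tangent_local tv sg (smoothD (smooth_cst (g y)) sS) gE).
  rewrite (tangentD tv) //; last exact: smooth_cst.
  rewrite (tangent_cst _ tv) add0r (tangent_sum tv); last by move=> i; exact: smoothM.
  apply: eq_bigr => i _; rewrite (tangent_leibniz tv) // subrr mul0r addr0.
  rewrite (tangentB tv) //; last exact: smooth_cst.
  rewrite (tangent_cst _ tv) subr0; congr (_ * _).
  rewrite EE // /H /ext !chart_cutoffE // b_y !mul1r h0.
  apply: near_eq_derive; apply: filterS b2 => z bz.
  by rewrite bz mul1r.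
- move=> i j; rewrite EE // /ext chart_cutoffE // b_y mul1r.
  have bc : \forall z \near cmap c y, (X j \o cinv c) z = z 0 j.
    have ncy : nbhs (cmap c y) (cimg c).
      by apply: open_nbhs_nbhs; split; [exact: open_cimg|exact: cmap_img].
    apply: filterS2 b2 ncy => z bz cz /=.
    by rewrite /X /ext chart_cutoffE ?cinvK ?bz ?mul1r //; exact: cinv_dom.
  rewrite (near_eq_derive _ bc).
  by rewrite derive_coord !mxE eq_sym.
Qed.

End Tangent.

(** * Vector fields, smooth linear systems and cotangent vectors *)

Section Fields.
Context {R : realType}.

Section OneManifold.
Variable M : manifold R.
Implicit Types (f g : M -> R) (x y : M) (v w : tvec M) (X Y W : field M).

Lemma field_tangent X x : is_field X -> tangent x (X x).
Proof. by case. Qed.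

Lemma field_smooth X f : is_field X -> smooth f -> smooth (fun x => X x f).
Proof. by move=> [_]; apply. Qed.

(** Smoothness of a field defined point by point is reduced to that of its coefficients in genuine
    fields, which may depend on the point considered. *)
Lemma is_field_local X : (forall x, tangent x (X x)) ->
  (forall x, exists (m : nat) (a : 'I_m -> M -> R) (E : 'I_m -> field M),
     [/\ forall i, smooth_at (a i) x, forall i, is_field (E i) &
         \forall y \near x, X y = \sum_i a i y *: E i y]) ->
  is_field X.
Proof.
move=> tX loc; split=> // f sf; apply/smoothP => x.
have [m [a [E [sa fE XE]]]] := loc x.
apply: (@smooth_at_eq _ _ (fun y => \sum_i a i y * E i y f)).
  by apply: filterS XE => y ->; rewrite sum_tvecE.
apply: smooth_at_sum => i _; apply: smooth_atM => //.
by apply: smooth_at_smooth; exact: field_smooth.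
Qed.

Lemma field0 : is_field (0 : field M).
Proof. by split=> [x|f _]; [exact: tangent0|exact: smooth_cst]. Qed.

Lemma fieldZ f X : smooth f -> is_field X -> is_field (fun x => f x *: X x).
Proof.
move=> sf fX; split=> [x|g sg]; first by apply: tangent_scale; exact: field_tangent.
by apply: smoothM => //; exact: field_smooth.
Qed.

Lemma fieldD X Y : is_field X -> is_field Y -> is_field (X + Y).
Proof.
move=> fX fY; split=> [x|g sg]; first by apply: tangent_add; exact: field_tangent.
by apply: smoothD; exact: field_smooth.
Qed.

Lemma fieldN X : is_field X -> is_field (- X).
Proof.
move=> fX; split=> [x|g sg]; first by apply: tangent_opp; exact: field_tangent.
by apply: smoothN; exact: field_smooth.
Qed.

Lemma fieldB X Y : is_field X -> is_field Y -> is_field (X - Y).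
Proof. by move=> fX /fieldN; exact: fieldD. Qed.

Lemma field_sum (J : finType) (E : J -> field M) :
  (forall j, is_field (E j)) -> is_field (fun x => \sum_j E j x).
Proof.
move=> fE; split=> [x|g sg]; first by apply: tangent_sumv => j; exact: field_tangent.
by under eq_fun do rewrite sum_tvecE; apply: smooth_sum => j _; exact: field_smooth.
Qed.

Lemma field_bracket X Y : is_field X -> is_field Y -> is_field (bracket X Y).
Proof.
move=> fX fY; split=> [x|f sf]; last first.
  by apply: smoothB; apply: field_smooth => //; exact: field_smooth.
have tX := field_tangent x fX; have tY := field_tangent x fY.
have sX f : smooth f -> smooth (fun y => X y f) by exact: field_smooth.
have sY f : smooth f -> smooth (fun y => Y y f) by exact: field_smooth.
split=> [k f g sf sg|f g sf sg|f nsf]; rewrite /bracket.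
- have EX : (fun y => X y (fun y => k * f y + g y)) = fun y => k * X y f + X y g.
    by apply/funext => y; apply: (tangent_linear (field_tangent y fX)).
  have EY : (fun y => Y y (fun y => k * f y + g y)) = fun y => k * Y y f + Y y g.
    by apply/funext => y; apply: (tangent_linear (field_tangent y fY)).
  rewrite EX EY (tangent_linear tX) ?(tangent_linear tY); auto; ring.
- have EX : (fun y => X y (fun y => f y * g y)) = fun y => X y f * g y + f y * X y g.
    by apply/funext => y; apply: (tangent_leibniz (field_tangent y fX)).
  have EY : (fun y => Y y (fun y => f y * g y)) = fun y => Y y f * g y + f y * Y y g.
    by apply/funext => y; apply: (tangent_leibniz (field_tangent y fY)).
  rewrite EX EY (tangentD tX) ?(tangentD tY); try by apply: smoothM; auto.
  rewrite !(tangent_leibniz tX) ?(tangent_leibniz tY); auto; ring.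
- have EX : (fun y => X y f) = fun=> 0.
    by apply/funext => y; exact: (tangent_smooth (field_tangent y fX)).
  have EY : (fun y => Y y f) = fun=> 0.
    by apply/funext => y; exact: (tangent_smooth (field_tangent y fY)).
  by rewrite EX EY (tangent_cst _ tX) (tangent_cst _ tY) subr0.
Qed.

Lemma field_ext X Y : is_field X -> is_field Y ->
  (forall x f, smooth f -> X x f = Y x f) -> X = Y.
Proof.
move=> fX fY E; apply/funext => x.
by apply: (tangent_ext (field_tangent x fX) (field_tangent x fY)) => f; exact: E.
Qed.

Lemma linear_on_tangent0 x (L : tvec M -> R) :
  (forall k v w, tangent x v -> tangent x w -> L (k *: v + w) = k * L v + L w) -> L 0 = 0.
Proof.
move=> linL; have := linL 1 0 0 (tangent0 x) (tangent0 x).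
by rewrite scaler0 addr0 mul1r => /(congr1 (fun t => t - L 0)); rewrite subrr addrK.
Qed.

Lemma linear_on_tangent_sum x (L : tvec M -> R) (J : finType) (k : J -> R) (v : J -> tvec M) :
  (forall k v w, tangent x v -> tangent x w -> L (k *: v + w) = k * L v + L w) ->
  (forall j, tangent x (v j)) -> L (\sum_j k j *: v j) = \sum_j k j * L (v j).
Proof.
move=> linL tv; have H (s : seq J) : tangent x (\sum_(j <- s) k j *: v j) /\
    L (\sum_(j <- s) k j *: v j) = \sum_(j <- s) k j * L (v j).
  elim: s => [|j s [IHt IH]].
    by rewrite !big_nil (linear_on_tangent0 linL); split => //; exact: tangent0.
  by rewrite !big_cons linL // IH; split => //; exact: tangentP_linear.
by have [] := H (index_enum J).
Qed.

Lemma local_frame_at x : exists (X : 'I_(mdim M) -> M -> R) (E : 'I_(mdim M) -> field M),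
  [/\ forall i, smooth (X i), forall i, is_field (E i) & \forall y \near x,
    (forall v, tangent y v -> v = \sum_i v (X i) *: E i y) /\
    (forall i j, E i y (X j) = (i == j)%:R)].
Proof.
have [c ac cx] := atlas_cover x.
have [X [E [sX fE H]]] := local_frame ac cx.
by exists X, E; split => //; apply: filterS H => y [].
Qed.

(* Every cotangent vector is the differential of a function. *)
Lemma cotangent_repr x (L : tvec M -> R) :
  (forall k v w, tangent x v -> tangent x w -> L (k *: v + w) = k * L v + L w) ->
  exists2 h, smooth h & forall v, tangent x v -> L v = v h.
Proof.
move=> linL; have [X [E [sX fE /nbhs_singleton[H _]]]] := local_frame_at x.
have sF i : smooth (fun y => L (E i x) * X i y) by apply: smoothM => //; exact: smooth_cst.
exists (fun y => \sum_i L (E i x) * X i y); first by apply: smooth_sum.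
move=> v tv; rewrite {1}(H v tv) (linear_on_tangent_sum _ linL) //; last first.
  by move=> i; exact: field_tangent.
rewrite (tangent_sum tv) //; apply: eq_bigr => i _.
by rewrite (tangentZ _ tv) // mulrC.
Qed.

Lemma tangent_field x v : tangent x v -> exists2 Y, is_field Y & Y x = v.
Proof.
move=> tv; have [X [E [sX fE /nbhs_singleton[H _]]]] := local_frame_at x.
exists (fun y => \sum_i v (X i) *: E i y); last exact/esym/H.
by apply: field_sum => i; apply: fieldZ => //; exact: smooth_cst.
Qed.

Lemma smooth_at_det (m : nat) (A : M -> 'M[R]_m) x :
  (forall i j, smooth_at (fun y => A y i j) x) -> smooth_at (fun y => \det (A y)) x.
Proof.
move=> sA; apply: smooth_at_sum => s _; apply: smooth_atM; first exact: smooth_at_cst.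
exact: smooth_at_prod.
Qed.

Lemma smooth_at_mulmx (m n k : nat) (A : M -> 'M[R]_(m, n)) (B : M -> 'M[R]_(n, k)) x :
  (forall i j, smooth_at (fun y => A y i j) x) ->
  (forall i j, smooth_at (fun y => B y i j) x) ->
  forall i j, smooth_at (fun y => (A y *m B y) i j) x.
Proof.
move=> sA sB i j; under eq_fun do rewrite mxE.
by apply: smooth_at_sum => l _; exact: smooth_atM.
Qed.

Lemma smooth_at_adj (m : nat) (A : M -> 'M[R]_m) x :
  (forall i j, smooth_at (fun y => A y i j) x) ->
  forall i j, smooth_at (fun y => (\adj (A y)) i j) x.
Proof.
move=> sA i j; under eq_fun do rewrite mxE /cofactor.
apply: smooth_atM; first exact: smooth_at_cst.
by apply: smooth_at_det => k l; under eq_fun do rewrite !mxE.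
Qed.

(** A constant right inverse [D] of [C x] makes the system square: [C y *m D] has determinant 1 at
    [x], hence is invertible nearby, and Cramer's rule gives [a] as a smooth function of [b] and
    [C]. *)
Lemma smooth_solve (m k : nat) (a : M -> 'rV[R]_m) (C : M -> 'M[R]_(m, k))
    (b : M -> 'rV[R]_k) x :
  (forall i j, smooth_at (fun y => C y i j) x) ->
  (forall j, smooth_at (fun y => b y 0 j) x) ->
  row_free (C x) -> (\forall y \near x, a y *m C y = b y) ->
  forall i, smooth_at (fun y => a y 0 i) x.
Proof.
move=> sC sb /row_freeP[D CD] aC i.
pose A y := C y *m D.
have sA p q : smooth_at (fun y => A y p q) x.
  by apply: smooth_at_mulmx => // ? ?; exact: smooth_at_cst.
have sdet := smooth_at_det sA.
have detx : \det (A x) != 0 by rewrite /A CD det1 oner_eq0.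
have ndet : \forall y \near x, \det (A y) != 0.
  have n0 : nbhs (\det (A x)) [set t : R | t != 0].
    by apply: open_nbhs_nbhs; split => //; exact: open_neq.
  exact: (smooth_at_continuous sdet) n0.
apply: (@smooth_at_eq _ _ (fun y => (\det (A y))^-1 * (b y *m D *m \adj (A y)) 0 i)).
  apply: filterS2 aC ndet => y <- d0.
  by rewrite -(mulmxA _ (C y)) -mulmxA mul_mx_adj mul_mx_scalar mxE mulKf.
apply: smooth_atM; first exact: smooth_atV.
apply: (@smooth_at_mulmx 1 _ _ (fun y => b y *m D)) => [p q|]; last exact: smooth_at_adj.
by apply: smooth_at_mulmx => [? ?|? ?]; [rewrite ord1|exact: smooth_at_cst].
Qed.

End OneManifold.

(** * Differentials of smooth maps and smooth lifts of fields *)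

Section TwoManifolds.
Variables (M N : manifold R) (F : M -> N).
Hypothesis sF : smooth_map F.
Implicit Types (v w : tvec M).

Lemma pushE v g : smooth g -> push F v g = v (g \o F).
Proof. by move=> sg; rewrite /push asboolT. Qed.

Lemma push_tangent x v : tangent x v -> tangent (F x) (push F v).
Proof.
move=> tv; split=> [k f g sf sg|f g sf sg|f nsf]; last by rewrite /push asboolF.
- rewrite !pushE //; last by apply: smoothD => //; apply: smoothM => //; exact: smooth_cst.
  by rewrite -(tangent_linear tv) //; exact: sF.
- rewrite !pushE //; last exact: smoothM.
  by rewrite -(tangent_leibniz tv) //; exact: sF.
Qed.

Lemma push_linear (k : R) v w : push F (k *: v + w) = k *: push F v + push F w.
Proof.
apply/funext => g; rewrite -[RHS]/(k * push F v g + push F w g) /push.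
by case: asboolP => // _; rewrite mulr0 addr0.
Qed.

Lemma push0 : push F 0 = 0.
Proof. by apply/funext => g; rewrite /push; case: ifP. Qed.

Lemma pushD v w : push F (v + w) = push F v + push F w.
Proof. by have := push_linear 1 v w; rewrite !scale1r. Qed.

Lemma pushZ (k : R) v : push F (k *: v) = k *: push F v.
Proof. by have := push_linear k v 0; rewrite push0 !addr0. Qed.

Lemma pushN v : push F (- v) = - push F v.
Proof. by rewrite -scaleN1r pushZ scaleN1r. Qed.

Lemma pushB v w : push F (v - w) = push F v - push F w.
Proof. by rewrite pushD pushN. Qed.

Lemma push_sum (J : finType) (v : J -> tvec M) : push F (\sum_j v j) = \sum_j push F (v j).
Proof.
by apply: (big_morph (push F) (id1 := 0) (op1 := +%R)); [exact: pushD|exact: push0].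
Qed.

(** Smoothness of a map only speaks of pulled-back functions. Continuity is recovered from a bump
    supported in the given neighbourhood: its pullback is continuous and nonzero at [x]. *)
Lemma smooth_map_continuous : continuous F.
Proof.
move=> x A nA; have [b [sb b1 bA]] := bump_manifold nA.
have sbF : smooth (b \o F) by exact: sF.
have n0 : nbhs ((b \o F) x) [set t : R | t != 0].
  apply: open_nbhs_nbhs; split; first exact: open_neq.
  by rewrite /= (nbhs_singleton b1) oner_neq0.
have nF : nbhs x [set y | b (F y) != 0] by exact: (smooth_continuous sbF) n0.
change (nbhs x (F @^-1` A)).
by apply: filterS nF => y /bA.
Qed.

Lemma related_smooth X Y g : related F X Y -> smooth g ->
  forall x, X x (g \o F) = Y (F x) g.
Proof. by move=> XY sg x; rewrite -XY pushE. Qed.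

Lemma related_bracket X X' Y Y' : is_field X -> is_field Y -> is_field X' -> is_field Y' ->
  related F X X' -> related F Y Y' -> related F (bracket X Y) (bracket X' Y').
Proof.
move=> fX fY fX' fY' rX rY x.
have fB := field_bracket fX fY; have fB' := field_bracket fX' fY'.
apply: (tangent_ext (push_tangent (field_tangent x fB)) (field_tangent _ fB')) => g sg.
rewrite pushE // /bracket.
have EY : (fun y => Y y (g \o F)) = (fun y => Y' y g) \o F.
  by apply/funext => y; exact: related_smooth.
have EX : (fun y => X y (g \o F)) = (fun y => X' y g) \o F.
  by apply/funext => y; exact: related_smooth.
by rewrite EX EY (related_smooth rX) ?(related_smooth rY) //; exact: field_smooth.
Qed.

Lemma relatedB X X' Y Y' : related F X X' -> related F Y Y' -> related F (X - Y) (X' - Y').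
Proof. by move=> rX rY x; rewrite -[LHS]/(push F (X x - Y x)) pushB rX rY. Qed.

(* In local frames a lift is the solution of a linear system with smooth
   coefficients and injective matrix. *)
Lemma lift_field (r : nat) (th : 'I_r -> form1 M) (Y : field N) :
  (forall a, is_form1 (th a)) ->
  (forall u v, tangent u v -> push F v = 0 -> (forall a, th a u v = 0) -> v = 0) ->
  (forall u (w : tvec N), tangent (F u) w ->
     exists2 v, tangent u v & push F v = w /\ forall a, th a u v = 0) ->
  is_field Y -> exists Yh, [/\ is_field Yh, related F Yh Y & forall a u, th a u (Yh u) = 0].
Proof.
move=> fth inj surj fY.
have /choice[Yh HYh] u : exists v, [/\ tangent u v, push F v = Y (F u) & forall a, th a u v = 0].
  by have [v tv [pv av]] := surj u _ (field_tangent (F u) fY); exists v; split.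
exists Yh; split=> [|u|a u]; last 2 first.
- by have [] := HYh u.
- by have [_ _] := HYh u; apply.
have tYh u : tangent u (Yh u) by have [] := HYh u.
have linth a y : forall k v w, tangent y v -> tangent y w ->
    th a y (k *: v + w) = k * th a y v + th a y w.
  by move=> k v w; exact: form1_linear.
apply: is_field_local => // u.
have [X [E [sX fE HX]]] := local_frame_at u.
have [Y_ [E' [sY fE' /nbhs_singleton[HY _]]]] := local_frame_at (F u).
have sYF j : smooth (Y_ j \o F) by exact: sF.
exists (mdim M), (fun i y => Yh y (X i)), E; split=> //; last first.
  by apply: filterS HX => y [Hy _]; exact: Hy.
(* Matrix, in the frame [E], of the map sending a tangent vector to its image coordinates and its
   values under the forms [th]. *)
pose C y : 'M[R]_(mdim M, mdim N + r) :=
  row_mx (\matrix_(i, j) E i y (Y_ j \o F)) (\matrix_(i, a) th a y (E i y)).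
pose b y : 'rV[R]_(mdim N + r) := row_mx (\row_j Y (F y) (Y_ j)) 0.
have := @smooth_solve M _ _ (fun y => \row_i Yh y (X i)) C b u.
have aE : (forall i, smooth_at (fun y => (\row_i0 Yh y (X i0)) 0 i) u) ->
    forall i, smooth_at (fun y => Yh y (X i)) u.
  by move=> H i; have := H i; under eq_fun do rewrite mxE.
move=> H; apply: aE; apply: H.
- move=> i j; case: (split_ordP j) => k ->.
    under eq_fun do rewrite row_mxEl mxE.
    by apply: smooth_at_smooth; exact: field_smooth.
  under eq_fun do rewrite row_mxEr mxE.
  by apply: smooth_at_smooth; exact: form1_smooth.
- move=> j; case: (split_ordP j) => k ->.
    under eq_fun do rewrite row_mxEl mxE.
    by apply: smooth_at_smooth; apply: (sF (g := fun y => Y y (Y_ k))); exact: field_smooth.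
  under eq_fun do rewrite row_mxEr mxE.
  exact: smooth_at_cst.
(* Full rank is the hypothesis [inj]: a row in the left kernel is the coordinate vector of a tangent
   vector killed by [push F] and by all the [th]. *)
- rewrite -kermx_eq0; apply/eqP/row_matrixP => i0; rewrite row0.
  have : (row i0 (kermx (C u)) *m C u) = 0 by rewrite -row_mul mulmx_ker row0.
  move: (row i0 _) => z; rewrite mul_mx_row -[0]row_mx0 => /eq_row_mx[z1 z2].
  have [Hv XE] := nbhs_singleton HX.
  pose v := \sum_i z 0 i *: E i u.
  have tE i : tangent u (E i u) by exact: field_tangent.
  have tv : tangent u v by apply: tangent_sumv => i; exact: tangent_scale.
  have v0 : v = 0.
    apply: (inj u) => //.
      rewrite (HY _ (push_tangent tv)) big1 // => j _.
      rewrite pushE // /v sum_tvecE.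
      have := congr1 (fun A : 'rV[R]_(mdim N) => A 0 j) z1; rewrite !mxE => zj.
      rewrite (_ : \sum_i _ = 0) ?scale0r // -{2}zj.
      by apply: eq_bigr => i _; rewrite mxE.
    move=> a; rewrite /v (linear_on_tangent_sum _ (linth a u)) //.
    have := congr1 (fun A : 'rV[R]_r => A 0 a) z2; rewrite !mxE => za.
    by rewrite -{2}za; apply: eq_bigr => i _; rewrite mxE.
  apply/rowP => i; rewrite mxE.
  have := congr1 (fun v : tvec M => v (X i)) v0; rewrite /v sum_tvecE -[RHS]/(0 : R) => <-.
  have ZE j : (z 0 j *: E j u) (X i) = z 0 j * (j == i)%:R by rewrite -XE.
  under eq_bigr do rewrite ZE.
  rewrite (bigD1 i) //= eqxx mulr1 big1 ?addr0 // => j ji.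
  by rewrite (negbTE ji) mulr0.
- apply: filterS HX => y [Hy _]; rewrite mul_mx_row; congr row_mx.
    apply/rowP => j; rewrite !mxE.
    have [_ py _] := HYh y; rewrite -py pushE // [in RHS](Hy _ (tYh y)) sum_tvecE.
    by apply: eq_bigr => i _; rewrite !mxE.
  apply/rowP => a; rewrite !mxE.
  transitivity (\sum_i Yh y (X i) * th a y (E i y)).
    by apply: eq_bigr => i _; rewrite !mxE.
  rewrite -(linear_on_tangent_sum (fun i => Yh y (X i)) (linth a y)); last first.
    by move=> i; exact: field_tangent.
  by rewrite -(Hy _ (tYh y)); have [_ _] := HYh y; apply.
Qed.

End TwoManifolds.

Lemma push_comp (M N L : manifold R) (F : M -> N) (G : N -> L) (v : tvec M) :
  smooth_map G -> push G (push F v) = push (G \o F) v.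
Proof.
move=> sG; apply/funext => g; rewrite /push; case: asboolP => // sg.
by rewrite asboolT //; exact: sG.
Qed.

Lemma push_id (M : manifold R) x (v : tvec M) : tangent x v -> push id v = v.
Proof.
move=> tv; apply/funext => g; rewrite /push; case: asboolP => // nsg.
by rewrite (tangent_smooth tv).
Qed.

End Fields.

(** * Product manifolds *)

Section SmoothMaps.
Context {R : realType}.

Lemma smooth_at_family (M : manifold R) (c : chart R M (mdim M)) (J : finType)
    (f : J -> M -> R) (x : M) :
  @atlas R M c -> cdom c x -> (forall j, smooth_at (f j) x) ->
  exists W, [/\ open W, W (cmap c x), W `<=` cimg c & forall j, smooth_on W (f j \o cinv c)].
Proof.
move=> ac cx sf; have H (s : seq J) : exists W, [/\ open W, W (cmap c x), W `<=` cimg c &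
    forall j, j \in s -> smooth_on W (f j \o cinv c)].
  elim: s => [|j s [W [oW Wx Wc sW]]].
    by exists (cimg c); split => //; [exact: open_cimg|exact: cmap_img].
  have [W' [oW' Wx' Wc' sW']] := smooth_at_chart ac cx (sf j).
  exists (W `&` W'); split => //; first exact: openI.
    by move=> z [/Wc].
  move=> i; rewrite inE => /orP[/eqP ->|/sW sWi].
    by apply: smooth_on_subset sW' => z [].
  by apply: smooth_on_subset sWi => z [].
have [W [oW Wx Wc sW]] := H (enum J); exists W; split => // j.
by apply: sW; rewrite mem_enum.
Qed.

(** Continuity keeps [F] inside the single target chart near [l]; the rest is composition in
    coordinates. *)
Lemma smooth_at_comp_chart (L N : manifold R) (c : chart R N (mdim N)) (F : L -> N)
    (l : L) (g : N -> R) :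
  @atlas R N c -> cdom c (F l) -> {for l, continuous F} ->
  (forall j, smooth_at (fun l' => cmap c (F l') 0 j) l) -> smooth g -> smooth_at (g \o F) l.
Proof.
move=> ac cF contF sF sg; have [d ad dl] := atlas_cover l.
have [W [oW Wl Wd sW]] := smooth_at_family ad dl sF.
have ncF : nbhs l (F @^-1` cdom c).
  by apply: contF; apply: open_nbhs_nbhs; split => //; exact: open_cdom.
have := nbhs_cinv dl ncF; rewrite nbhsE => -[U [oU Ul] UF].
exists d; split => //; exists (W `&` U); split => //.
- exact: openI.
- by move=> z [/Wd].
apply: (@eq_smooth_on _ _ _ ((g \o cinv c) \o (fun z => cmap c (F (cinv d z))))).
- exact: openI.
- by move=> z [_ /UF[_ /= cz]] /=; rewrite cmapK.
apply: (@smooth_on_comp _ _ _ _ (cimg c)).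
- exact: openI.
- by move=> z [_ /UF[_ /= cz]]; exact: cmap_img.
- by move=> j; apply: smooth_on_subset (sW j) => z [].
- exact: sg.
Qed.

Lemma smooth_map_id (M : manifold R) : smooth_map (id : M -> M).
Proof. by move=> g. Qed.

Lemma smooth_map_cst (M N : manifold R) (y : N) : smooth_map (fun _ : M => y).
Proof. by move=> g _; exact: smooth_cst. Qed.

Lemma smooth_map_comp (M N L : manifold R) (G : N -> L) (F : M -> N) :
  smooth_map G -> smooth_map F -> smooth_map (G \o F).
Proof. by move=> sG sF g /sG /sF. Qed.

End SmoothMaps.

Section ProductFields.
Context {R : realType} (M N : manifold R).
Notation MN := (prod_manifold M N).

Definition pr1 : MN -> M := fun p => p.1.
Definition pr2 : MN -> N := fun p => p.2.

Lemma smooth_pr1 : smooth_map pr1.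
Proof.
move=> g sg c' [[c d] [/= ac ad] <-].
rewrite (_ : _ \o _ = (g \o cinv c) \o lsubmx) //.
by apply: (smooth_on_linear (@continuous_lsubmx R 1 _ _)) (sg _ ac) => w [].
Qed.

Lemma smooth_pr2 : smooth_map pr2.
Proof.
move=> g sg c' [[c d] [/= ac ad] <-].
rewrite (_ : _ \o _ = (g \o cinv d) \o rsubmx) //.
by apply: (smooth_on_linear (@continuous_rsubmx R 1 _ _)) (sg _ ad) => w [].
Qed.

(** Smoothness of [F] and [G] can be tested on globally defined functions only, so the chart
    coordinates are replaced by the smooth functions that extend them near the given point. *)
Lemma smooth_map_pair (L : manifold R) (F : L -> M) (G : L -> N) :
  smooth_map F -> smooth_map G -> smooth_map ((fun l => (F l, G l)) : L -> MN).
Proof.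
move=> sF sG g sg; apply/smoothP => l.
have [c ac cx] := atlas_cover (F l); have [d ad dx] := atlas_cover (G l).
have [X [EX [sX _ HX]]] := local_frame ac cx.
have [Y [EY [sY _ HY]]] := local_frame ad dx.
have contF := smooth_map_continuous sF (x := l); have contG := smooth_map_continuous sG (x := l).
apply: (@smooth_at_comp_chart _ _ MN (prod_chart c d)) => //.
- by exists (c, d).
- exact: cvg_pair contF contG.
move=> j; case: (split_ordP j) => k ->.
  apply: (@smooth_at_eq _ _ (X k \o F)); last by apply: smooth_at_smooth; exact: sF.
  have nF : nbhs l (F @^-1` [set y | X k y = cmap c y 0 k]).
    by apply: contF; apply: filterS HX => y [_ H _ _]; exact: H.
  by apply: filterS nF => l' /= ->; rewrite row_mxEl.
apply: (@smooth_at_eq _ _ (Y k \o G)); last by apply: smooth_at_smooth; exact: sG.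
have nG : nbhs l (G @^-1` [set y | Y k y = cmap d y 0 k]).
  by apply: contG; apply: filterS HY => y [_ H _ _]; exact: H.
by apply: filterS nG => l' /= ->; rewrite row_mxEr.
Qed.

Definition slice1 (y : N) : M -> MN := fun x => (x, y).
Definition slice2 (x : M) : N -> MN := fun y => (x, y).

Lemma smooth_slice1 y : smooth_map (slice1 y).
Proof. exact: smooth_map_pair (@smooth_map_id _ _) (@smooth_map_cst _ _ _ y). Qed.

Lemma smooth_slice2 x : smooth_map (slice2 x).
Proof. exact: smooth_map_pair (@smooth_map_cst _ _ _ x) (@smooth_map_id _ _). Qed.

Lemma pair_vecE (p : MN) v w : pair_vec p v w = push (slice1 p.2) v + push (slice2 p.1) w.
Proof.
apply/funext => g; rewrite -[RHS]/(push (slice1 p.2) v g + push (slice2 p.1) w g).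
by rewrite /pair_vec /push; case: asboolP => // _; rewrite addr0.
Qed.

Lemma pair_vec_smooth (p : MN) v w g : smooth g ->
  pair_vec p v w g = v (fun x => g (x, p.2)) + w (fun y => g (p.1, y)).
Proof. by move=> sg; rewrite /pair_vec asboolT. Qed.

Lemma pair_vec_tangent (p : MN) v w : tangent p.1 v -> tangent p.2 w -> tangent p (pair_vec p v w).
Proof.
case: p => x y /= tv tw; rewrite pair_vecE; apply: tangent_add.
  exact: (push_tangent (@smooth_slice1 y) tv).
exact: (push_tangent (@smooth_slice2 x) tw).
Qed.

Lemma push_pr1_pair (p : MN) v w : tangent p.1 v -> tangent p.2 w ->
  push pr1 (pair_vec p v w) = v.
Proof.
move=> tv tw; apply: (tangent_ext (x := p.1)) => //.
  exact: (push_tangent smooth_pr1 (pair_vec_tangent tv tw)).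
move=> f sf; rewrite pushE // pair_vec_smooth; last exact: smooth_pr1.
by rewrite /= (tangent_cst _ tw) addr0.
Qed.

Lemma push_pr2_pair (p : MN) v w : tangent p.1 v -> tangent p.2 w ->
  push pr2 (pair_vec p v w) = w.
Proof.
move=> tv tw; apply: (tangent_ext (x := p.2)) => //.
  exact: (push_tangent smooth_pr2 (pair_vec_tangent tv tw)).
move=> f sf; rewrite pushE // pair_vec_smooth; last exact: smooth_pr2.
by rewrite /= (tangent_cst _ tv) add0r.
Qed.

(** The coordinates of the product chart agree near [p] with those pulled back from the factors.
    Thus a tangent vector of the product is determined by its two projections. *)
Lemma product_frame (p : MN) : exists (X : 'I_(mdim M) -> M -> R) (Y : 'I_(mdim N) -> N -> R)
    (F : 'I_(mdim MN) -> MN -> R) (E : 'I_(mdim MN) -> field MN),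
  [/\ (forall i, smooth (X i)) /\ (forall i, smooth (Y i)), forall k, smooth (F k),
      forall k, is_field (E k) &
      \forall q \near p, forall v, tangent q v ->
        [/\ v = \sum_k v (F k) *: E k q,
            forall i, v (F (lshift (mdim N) i)) = push pr1 v (X i) &
            forall j, v (F (rshift (mdim M) j)) = push pr2 v (Y j)]].
Proof.
have [c ac cx] := atlas_cover p.1; have [d ad dx] := atlas_cover p.2.
have [X [EX [sX _ HX]]] := local_frame ac cx.
have [Y [EY [sY _ HY]]] := local_frame ad dx.
have acd : @atlas R MN (prod_chart c d) by exists (c, d).
have cdx : cdom (prod_chart c d) p by split.
have [F [E [sF fE HF]]] := local_frame acd cdx.
exists X, Y, F, E; split => //.
have c1 := smooth_map_continuous smooth_pr1 (x := p).
have c2 := smooth_map_continuous smooth_pr2 (x := p).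
have n1 : nbhs p (pr1 @^-1` [set y | forall i, X i y = cmap c y 0 i]).
  by apply: c1; apply: filterS HX => y [_ H _ _]; exact: H.
have n2 : nbhs p (pr2 @^-1` [set y | forall i, Y i y = cmap d y 0 i]).
  by apply: c2; apply: filterS HY => y [_ H _ _]; exact: H.
have nE1 : nbhs p [set q | forall i, F (lshift (mdim N) i) q = X i q.1].
  apply: filterS2 n1 HF => q /= q1 [_ Fq _ _] i.
  by rewrite Fq q1 /= row_mxEl.
have nE2 : nbhs p [set q | forall j, F (rshift (mdim M) j) q = Y j q.2].
  apply: filterS2 n2 HF => q /= q1 [_ Fq _ _] i.
  by rewrite Fq q1 /= row_mxEr.
have nI1 := nbhs_interior nE1; have nI2 := nbhs_interior nE2.
apply: filterS3 nI1 nI2 HF => q {}nE1 {}nE2 [_ _ Hq _] v tv; split; first exact: Hq.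
- move=> i; rewrite pushE //; apply: (tangent_local tv) => //; first exact: smooth_pr1.
  by apply: filterS nE1 => q' /(_ i).
- move=> j; rewrite pushE //; apply: (tangent_local tv) => //; first exact: smooth_pr2.
  by apply: filterS nE2 => q' /(_ j).
Qed.

Lemma product_tangent_ext (p : MN) v w : tangent p v -> tangent p w ->
  push pr1 v = push pr1 w -> push pr2 v = push pr2 w -> v = w.
Proof.
move=> tv tw e1 e2.
have [X [Y [F [E [_ _ _ /nbhs_singleton H]]]]] := product_frame p.
have [vE v1 v2] := H v tv; have [wE w1 w2] := H w tw; rewrite vE wE {vE wE}.
apply: eq_bigr => k _; congr (_ *: _); case: (split_ordP k) => i ->.
  by rewrite (v1 i) (w1 i) e1.
by rewrite (v2 i) (w2 i) e2.
Qed.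

Lemma product_tangentE (p : MN) v : tangent p v -> v = pair_vec p (push pr1 v) (push pr2 v).
Proof.
move=> tv; have t1 := push_tangent smooth_pr1 tv; have t2 := push_tangent smooth_pr2 tv.
by apply: (product_tangent_ext tv (pair_vec_tangent t1 t2));
  rewrite ?push_pr1_pair ?push_pr2_pair.
Qed.

Definition product_field (X : field M) (Y : field N) : field MN :=
  fun p => pair_vec p (X p.1) (Y p.2).

Lemma is_product_field X Y : is_field X -> is_field Y -> is_field (product_field X Y).
Proof.
move=> fX fY; have tXY p : tangent p (product_field X Y p).
  by apply: pair_vec_tangent; exact: field_tangent.
apply: is_field_local => // p.
have [X' [Y' [F [E [[sX' sY'] sF fE H]]]]] := product_frame p.
exists _, (fun k q => product_field X Y q (F k)), E; split => //; last first.
  by apply: filterS H => q /(_ _ (tXY q))[].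
move=> k; case: (split_ordP k) => i ->.
  apply: (@smooth_at_eq _ _ (fun q : MN => X q.1 (X' i))); last first.
    apply: smooth_at_smooth; apply: (smooth_pr1 (g := fun x => X x (X' i))).
    exact: field_smooth.
  apply: filterS H => q /(_ _ (tXY q))[_ -> _].
  by rewrite push_pr1_pair //; exact: field_tangent.
apply: (@smooth_at_eq _ _ (fun q : MN => Y q.2 (Y' i))); last first.
  apply: smooth_at_smooth; apply: (smooth_pr2 (g := fun x => Y x (Y' i))).
  exact: field_smooth.
apply: filterS H => q /(_ _ (tXY q))[_ _ ->].
by rewrite push_pr2_pair //; exact: field_tangent.
Qed.

Lemma product_field_pr1 X Y : is_field X -> is_field Y -> related pr1 (product_field X Y) X.
Proof. by move=> fX fY p; rewrite push_pr1_pair //; exact: field_tangent. Qed.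

Lemma product_field_pr2 X Y : is_field X -> is_field Y -> related pr2 (product_field X Y) Y.
Proof. by move=> fX fY p; rewrite push_pr2_pair //; exact: field_tangent. Qed.

(** The projection of the bracket to [M] is [X, 0] and that to [N] is [0, Y]. This commutation lets
    a time derivative pass through a field on the other factor. *)
Lemma bracket_fst_snd X Y : is_field X -> is_field Y ->
  bracket (product_field X 0) (product_field 0 Y) = 0.
Proof.
move=> fX fY; have f1 := @field0 R M; have f2 := @field0 R N.
have fX0 := is_product_field fX f2; have fY0 := is_product_field f1 fY.
have E1 : bracket X (0 : field M) = 0.
  apply: field_ext => // [|x f sf]; first exact: field_bracket.
  by rewrite /bracket (tangent_cst 0 (field_tangent x fX)) subr0.
have E2 : bracket (0 : field N) Y = 0.
  apply: field_ext => // [|x f sf]; first exact: field_bracket.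
  by rewrite /bracket (tangent_cst 0 (field_tangent x fY)) subr0.
apply/funext => p; apply: (product_tangent_ext (p := p)).
- by apply: field_tangent; exact: field_bracket.
- exact: tangent0.
- rewrite (related_bracket smooth_pr1 fX0 fY0 fX f1) ?E1; last 2 first.
  + exact: product_field_pr1.
  + exact: product_field_pr1.
  by rewrite push0.
- rewrite (related_bracket smooth_pr2 fX0 fY0 f2 fY) ?E2; last 2 first.
  + exact: product_field_pr2.
  + exact: product_field_pr2.
  by rewrite push0.
Qed.

End ProductFields.

(** The pushed vectors [push F (X y)] need not form a field on [N], so they are expanded in a frame
    of [N] near [F u], on which [a] is smooth. *)
Lemma form1_pullback {R : realType} (M N : manifold R) (F : M -> N) (a : form1 N) :
  smooth_map F -> is_form1 a -> is_form1 (fun u v => a (F u) (push F v)).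
Proof.
move=> sF fa; split=> [x k v w tv tw|X fX].
  by rewrite push_linear (form1_linear fa) //; exact: push_tangent.
apply/smoothP => u.
have [Y [E [sY fE H]]] := local_frame_at (F u).
have lina y k v w : tangent y v -> tangent y w -> a y (k *: v + w) = k * a y v + a y w.
  exact: form1_linear.
apply: (@smooth_at_eq _ _ (fun y => \sum_i X y (Y i \o F) * a (F y) (E i (F y)))).
  have nH := smooth_map_continuous sF H.
  apply: (filterS _ (nH : nbhs u _)) => y [Hy _].
  have tX := push_tangent sF (field_tangent y fX).
  rewrite [in RHS](Hy _ tX) (linear_on_tangent_sum _ (lina (F y))).
    by apply: eq_bigr => i _; rewrite pushE.
  by move=> i; exact: field_tangent.
apply: smooth_at_smooth; apply: smooth_sum => i _; apply: smoothM.
  by apply: field_smooth => //; exact: sF.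
by apply: (sF (fun y => a y (E i y))); exact: form1_smooth.
Qed.

(** * Flows and Lie derivatives *)

Section RealLineMaps.
Context {R : realType}.
Notation L := (@line R).

Lemma derive1_linear (k : R) (f g : R -> R) (t : R) : derivable f t 1 -> derivable g t 1 ->
  derive1 (fun s => k * f s + g s) t = k * derive1 f t + derive1 g t.
Proof.
move=> df dg; rewrite !derive1E.
have dkf := is_deriveZ k (derivableP df).
by have [_ ->] := is_deriveD dkf (derivableP dg).
Qed.

Lemma derive1_mul (f g : R -> R) (t : R) : derivable f t 1 -> derivable g t 1 ->
  derive1 (fun s => f s * g s) t = derive1 f t * g t + f t * derive1 g t.
Proof.
move=> df dg; rewrite !derive1E.
have [_ ->] := is_deriveM (derivableP df) (derivableP dg).
by rewrite addrC [_ * g t]mulrC.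
Qed.

Lemma derive1_compN (f : R -> R) : derivable f 0 1 ->
  derive1 (fun t => f (- t)) 0 = - derive1 f 0.
Proof.
move=> df; rewrite !derive1E.
have dI := is_derive_id (0 : R) (1 : R); have dN := is_deriveN dI.
have df0 : is_derive (- (0 : R)) 1 f ('D_1 f 0) by rewrite oppr0; exact: derivableP.
have [_ ->] := @is_derive1_comp _ f (fun t : R => - t) _ _ _ df0 dN.
by rewrite mulrN1.
Qed.

Lemma smooth_line_derive (g : L -> R) (t : R) : smooth g ->
  is_derive t 1 (g : R -> R)
    ('D_(\row_(_ < 1) 1) (g \o cinv (@line_chart R)) (cmap (@line_chart R) t)).
Proof.
move=> sg; pose e : 'rV[R]_1 := \row__ 1.
have dG : differentiable (g \o cinv (@line_chart R)) (t *: e + 0).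
  exact: smooth_on_differentiable (sg (@line_chart R) erefl) I.
have := is_derive_line dG.
have -> : (fun u => (g \o cinv (@line_chart R)) (u *: e + 0)) = g :> (R -> R).
  by apply/funext => u /=; rewrite addr0 !mxE mulr1.
suff -> : t *: e + 0 = cmap (@line_chart R) t by [].
by apply/rowP => i; rewrite addr0 !mxE mulr1.
Qed.

Lemma smooth_line_derivable (g : L -> R) (t : R) : smooth g -> derivable (g : R -> R) t 1.
Proof. by move=> sg; have [] := smooth_line_derive t sg. Qed.

Definition d_dt : field L := fun t g => if `[< smooth g >] then derive1 (g : R -> R) t else 0.

Lemma d_dtE (t : R) (g : L -> R) : smooth g -> d_dt t g = derive1 (g : R -> R) t.
Proof. by move=> sg; rewrite /d_dt asboolT. Qed.

Lemma field_d_dt : is_field d_dt.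
Proof.
split=> [t|g sg]; last first.
  have -> : (fun t => d_dt t g) =
      (fun t => 'D_(\row_(_ < 1) 1) (g \o cinv (@line_chart R)) (cmap (@line_chart R) t)).
    apply/funext => t; rewrite d_dtE // derive1E.
    by have [_ ->] := smooth_line_derive t sg.
  move=> c ->; apply: (@eq_smooth_on _ _ _ ('D_(\row_(_ < 1) 1) (g \o cinv (@line_chart R)))).
  - exact: open_cimg.
  - by move=> w cw /=; rewrite -[in LHS](cinvK cw).
  - by apply: smooth_on_derive; exact: sg.
split=> [k f g sf sg|f g sf sg|f nsf]; last by rewrite /d_dt asboolF.
- have df := @smooth_line_derivable f t sf; have dg := @smooth_line_derivable g t sg.
  rewrite !d_dtE //; last by apply: smoothD => //; apply: smoothM => //; exact: smooth_cst.
  exact: derive1_linear.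
- have df := @smooth_line_derivable f t sf; have dg := @smooth_line_derivable g t sg.
  rewrite !d_dtE //; last exact: smoothM.
  exact: derive1_mul.
Qed.

Lemma smooth_map_line (M : manifold R) (f : M -> R) : smooth f -> smooth_map (f : M -> L).
Proof.
move=> sf g sg; apply/smoothP => x.
apply: (@smooth_at_comp_chart _ _ L (@line_chart R)) => //.
  exact: smooth_continuous.
move=> j; apply: smooth_at_smooth.
by have -> : (fun l' => cmap (@line_chart R) (f l') 0 j) = f by apply/funext => y; rewrite mxE.
Qed.

Lemma smooth_line_id : smooth (id : L -> R).
Proof.
move=> c ->; have -> : (id : L -> R) \o cinv (@line_chart R) = fun w => w 0 0 by [].
exact: smooth_on_coord.
Qed.

End RealLineMaps.

(** * One-parameter groups, their generators and invariant tensors *)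

Section Flow.
Context {R : realType} (M : manifold R) (Phi : R -> M -> M).
Notation L := (@line R).
Hypotheses (sPhi : @smooth_map R (prod_manifold line M) M (fun tp => Phi tp.1 tp.2))
  (Phi0 : forall x, Phi 0 x = x) (PhiD : forall s t x, Phi (s + t) x = Phi s (Phi t x)).

Definition generator : field M := fun x => push (fun t : L => Phi t x) (d_dt (0 : R)).

Lemma smooth_orbit x : smooth_map (fun t : L => Phi t x).
Proof. exact: (smooth_map_comp sPhi (@smooth_slice1 _ L M x)). Qed.

Lemma smooth_flow t : smooth_map (Phi t).
Proof. exact: (smooth_map_comp sPhi (@smooth_slice2 _ L M t)). Qed.

Lemma flowK t x : Phi (- t) (Phi t x) = x.
Proof. by rewrite -PhiD addNr Phi0. Qed.

Lemma generatorE x g : smooth g -> generator x g = derive1 (fun t : R => g (Phi t x)) 0.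
Proof.
by move=> sg; rewrite /generator pushE // d_dtE //; exact: (@smooth_orbit x).
Qed.

(** For smooth [g], the function [generator x g] is the derivative of the two-variable function
    [g (Phi t x)] along the field d/dt of R x M, restricted to the smooth slice t = 0. *)
Lemma field_generator : is_field generator.
Proof.
split=> [x|g sg].
  by rewrite -{1}(Phi0 x); apply: (push_tangent (@smooth_orbit x)); exact: field_tangent field_d_dt.
have fD := is_product_field field_d_dt (@field0 R M).
pose k : prod_manifold L M -> R := fun p => g (Phi p.1 p.2).
have sk : smooth k by exact: sPhi.
have -> : (fun x => generator x g) = (fun p => product_field d_dt 0 p k) \o slice2 (0 : L).
  apply/funext => x /=; rewrite /product_field pair_vec_smooth //= addr0.
  by rewrite /generator pushE.
by apply: smooth_slice2; exact: field_smooth.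
Qed.

(* The function t |-> Y (Phi t u) (h o Phi (- t)) is the restriction to the curve
   (t, Phi t u) of a function on R x M; the two terms of the bracket are its
   derivatives along the two factors. *)
Lemma flow_derivative (Y : field M) (h : M -> R) u : is_field Y -> smooth h ->
  derive1 (fun t : R => Y (Phi t u) (h \o Phi (- t))) 0 = bracket generator Y u h.
Proof.
move=> fY sh; pose LM := prod_manifold L M.
pose neg : LM -> LM := fun p => ((- p.1 : R), p.2).
have sneg : smooth_map neg.
  apply: (smooth_map_pair (N := M)); last exact: smooth_pr2.
  have s1 : smooth (fun p : LM => (p.1 : R)) by exact: (smooth_pr1 smooth_line_id).
  exact: (smooth_map_line (smoothN s1)).
pose k : LM -> R := fun p => h (Phi (- p.1) p.2).
have sk : smooth k by exact: (smooth_map_comp sPhi sneg).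
have fDY := is_product_field (@field0 R L) fY.
have fD0 := is_product_field (@field_d_dt R) (@field0 R M).
pose K p := product_field (0 : field L) Y p k.
have sK : smooth K by exact: field_smooth.
have KE t x : K (t, x) = Y x (h \o Phi (- t)).
  by rewrite /K /product_field pair_vec_smooth //= add0r.
pose ga : L -> LM := fun t => (t, Phi t u).
have sga : smooth_map ga by exact: smooth_map_pair (@smooth_map_id _ _) (@smooth_orbit u).
have -> : (fun t : R => Y (Phi t u) (h \o Phi (- t))) = K \o ga.
  by apply/funext => t; rewrite /= KE.
rewrite -d_dtE; last exact: sga.
have tD := @field_tangent R L _ (0 : R) (@field_d_dt R).
(* The velocity of the curve [ga] at 0 is the pair formed by d/dt and [generator u], which splits
   the derivative into its two partial terms. *)
rewrite -(pushE ga) // (product_tangentE (push_tangent sga tD)).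
rewrite pair_vec_smooth // push_comp; last exact: smooth_pr1.
rewrite push_comp; last exact: smooth_pr2.
have -> : @pr1 _ L M \o ga = id by [].
rewrite (push_id tD) /= Phi0.
have -> : push (@pr2 _ L M \o ga) (d_dt (0 : R)) = generator u by [].
have E0 : (fun y => K ((0 : R), y)) = fun y => Y y h.
  apply/funext => y; rewrite KE; congr (Y y _).
  by apply/funext => z /=; rewrite oppr0 Phi0.
rewrite E0 /bracket addrC; congr (_ + _).
have E1 : d_dt (0 : R) (fun t => K (t, u)) = product_field (@d_dt R) 0 ((0 : R), u) K.
  by rewrite /product_field pair_vec_smooth //= addr0.
rewrite E1.
(* On R x M the fields d/dt and [Y] commute, so the time derivative may be taken before [Y] is
   applied. *)
have := bracket_fst_snd (@field_d_dt R) fY.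
move/(congr1 (fun V : field LM => V ((0 : R), u) k)); rewrite /bracket -/K => /eqP.
rewrite subr_eq0 => /eqP ->.
rewrite {1}/product_field pair_vec_smooth //=; last exact: field_smooth.
rewrite add0r -[RHS]mulN1r -(tangentZ (-1) (field_tangent u fY)); last first.
  by apply: field_smooth => //; exact: field_generator.
(* The flow enters [k] with time reversed; this sign is that of the second term of the bracket. *)
congr (Y u _); apply/funext => x; rewrite mulN1r generatorE //.
rewrite /product_field pair_vec_smooth //= addr0 d_dtE; last first.
  exact: (@smooth_slice1 _ L M x _ sk).
have dh : derivable (fun t : R => h (Phi t x)) 0 1.
  exact: (@smooth_line_derivable _ _ 0 (@smooth_orbit x _ sh)).
exact: (derive1_compN dh).
Qed.

(* Writing A u _ f as the differential of a function h at u, invariance turns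
   (A Y) (Phi t u) (f o Phi (- t)) into Y (Phi t u) (h o Phi (- t)). *)
Lemma invariant_endo_bracket (A : endo M) (Y : field M) : is_endo A ->
  (forall t x v, tangent x v -> A (Phi t x) (push (Phi t) v) = push (Phi t) (A x v)) ->
  is_field Y -> bracket generator (appl A Y) = appl A (bracket generator Y).
Proof.
move=> eA invA fY; have fG := field_generator.
have fB := field_bracket fG fY; have fAY := endo_smooth eA fY.
apply: field_ext => [||u f sf]; [exact: field_bracket|exact: endo_smooth|].
have [h sh hE] := @cotangent_repr R M u (fun v => A u v f) (fun k v w tv tw =>
  congr1 (fun w : tvec M => w f) (endo_linear eA k tv tw)).
rewrite /appl hE; last exact: field_tangent.
rewrite -!flow_derivative //; congr (derive1 _ 0); apply/funext => t.
have tY := field_tangent (Phi t u) fY.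
have s1 := @smooth_flow (- t).
rewrite -!(pushE (Phi (- t))) // -invA // flowK hE //.
by rewrite -[in tangent u](flowK t u); exact: push_tangent.
Qed.

(** The covector [a u] is the differential at [u] of some [h]; by invariance, [a] on [Y] along the
    orbit is then [Y] applied to [h \o Phi (- t)], which [flow_derivative] differentiates. *)
Lemma invariant_form_derivative (a : form1 M) (Y : field M) : is_form1 a ->
  (forall t x v, tangent x v -> a (Phi t x) (push (Phi t) v) = a x v) ->
  is_field Y -> forall u, generator u (fun x => a x (Y x)) = a u (bracket generator Y u).
Proof.
move=> fa inva fY u; have fG := field_generator; have fB := field_bracket fG fY.
have [h sh hE] := @cotangent_repr R M u (a u) (fun k v w tv tw => form1_linear fa k tv tw).
rewrite hE; last exact: field_tangent.
rewrite -flow_derivative // generatorE; last exact: form1_smooth.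
congr (derive1 _ 0); apply/funext => t.
have tY := field_tangent (Phi t u) fY.
have s1 := @smooth_flow (- t).
rewrite -(inva (- t)) // flowK hE ?pushE //.
by rewrite -[in tangent u](flowK t u); exact: push_tangent.
Qed.

End Flow.

(** * Quaternions *)

Section QuaternionAlgebra.
Context {R : realType}.
Implicit Types (x y z h : 'rV[R]_4).

Lemma I4_case (Q : 'I_4 -> Prop) : Q (inord 0) -> Q (inord 1) -> Q (inord 2) -> Q (inord 3) ->
  forall a, Q a.
Proof.
move=> Q0 Q1 Q2 Q3 [[|[|[|[|//]]]] Ha].
- by rewrite (_ : Ordinal Ha = inord 0) //; apply: val_inj; rewrite /= inordK.
- by rewrite (_ : Ordinal Ha = inord 1) //; apply: val_inj; rewrite /= inordK.
- by rewrite (_ : Ordinal Ha = inord 2) //; apply: val_inj; rewrite /= inordK.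
- by rewrite (_ : Ordinal Ha = inord 3) //; apply: val_inj; rewrite /= inordK.
Qed.

Lemma I3_case (Q : 'I_3 -> Prop) : Q idx1 -> Q idx2 -> Q idx3 -> forall a, Q a.
Proof.
move=> Q0 Q1 Q2 [[|[|[|//]]] Ha].
- by rewrite (_ : Ordinal Ha = idx1) //; apply: val_inj.
- by rewrite (_ : Ordinal Ha = idx2) //; apply: val_inj.
- by rewrite (_ : Ordinal Ha = idx3) //; apply: val_inj.
Qed.

Lemma sum4 (V : nmodType) (F : 'I_4 -> V) :
  \sum_a F a = F (inord 0) + F (inord 1) + F (inord 2) + F (inord 3).
Proof.
rewrite !big_ord_recl big_ord0 addr0 !addrA.
by do !congr (_ + _); congr F; apply: val_inj; rewrite /= inordK.
Qed.

Lemma sum3 (V : nmodType) (F : 'I_3 -> V) : \sum_a F a = F idx1 + F idx2 + F idx3.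
Proof.
rewrite !big_ord_recl big_ord0 addr0 !addrA.
by do !congr (_ + _); congr F; apply: val_inj.
Qed.

Lemma im1 : im idx1 = inord 1. Proof. by apply: val_inj; rewrite /= inordK. Qed.
Lemma im2 : im idx2 = inord 2. Proof. by apply: val_inj; rewrite /= inordK. Qed.
Lemma im3 : im idx3 = inord 3. Proof. by apply: val_inj; rewrite /= inordK. Qed.
Lemma I4_zero : (0 : 'I_4) = inord 0. Proof. by apply: val_inj; rewrite /= inordK. Qed.

Lemma qmul0 x y : qmul x y 0 (inord 0) = x 0 (inord 0) * y 0 (inord 0)
  - x 0 (inord 1) * y 0 (inord 1) - x 0 (inord 2) * y 0 (inord 2) - x 0 (inord 3) * y 0 (inord 3).
Proof. by rewrite mxE inordK. Qed.

Lemma qmul1 x y : qmul x y 0 (inord 1) = x 0 (inord 0) * y 0 (inord 1)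
  + x 0 (inord 1) * y 0 (inord 0) + x 0 (inord 2) * y 0 (inord 3) - x 0 (inord 3) * y 0 (inord 2).
Proof. by rewrite mxE inordK. Qed.

Lemma qmul2 x y : qmul x y 0 (inord 2) = x 0 (inord 0) * y 0 (inord 2)
  - x 0 (inord 1) * y 0 (inord 3) + x 0 (inord 2) * y 0 (inord 0) + x 0 (inord 3) * y 0 (inord 1).
Proof. by rewrite mxE inordK. Qed.

Lemma qmul3 x y : qmul x y 0 (inord 3) = x 0 (inord 0) * y 0 (inord 3)
  + x 0 (inord 1) * y 0 (inord 2) - x 0 (inord 2) * y 0 (inord 1) + x 0 (inord 3) * y 0 (inord 0).
Proof. by rewrite mxE inordK. Qed.

Lemma inord4_eq (a b : nat) : (a < 4)%N -> (b < 4)%N -> (inord a == inord b :> 'I_4) = (a == b).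
Proof. by move=> ha hb; rewrite -val_eqE /= !inordK. Qed.

Definition qnorm2 z : R := z 0 (inord 0) * z 0 (inord 0) + z 0 (inord 1) * z 0 (inord 1)
  + z 0 (inord 2) * z 0 (inord 2) + z 0 (inord 3) * z 0 (inord 3).

Lemma qinvE z (a : 'I_4) : qinv z 0 a = (qnorm2 z)^-1 * (if a == inord 0 then z 0 a else - z 0 a).
Proof. by rewrite !mxE sum4 !expr2 /qnorm2 I4_zero. Qed.

Lemma qnorm2_neq0 z : z != 0 -> qnorm2 z != 0.
Proof.
apply: contraNneq => n0; apply/eqP/rowP => a; rewrite !mxE; move: n0; rewrite /qnorm2.
have sq (t : R) : 0 <= t * t by rewrite -expr2 sqr_ge0.
set t0 := z 0 (inord 0); set t1 := z 0 (inord 1); set t2 := z 0 (inord 2); set t3 := z 0 (inord 3).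
move=> H; have := sq t0; have := sq t1; have := sq t2; have := sq t3 => h3 h2 h1 h0.
have sq0 (t : R) : t * t = 0 -> t = 0 by move/eqP; rewrite mulf_eq0 orbb => /eqP.
by move: a; apply: I4_case; apply: sq0; rewrite -?/t0 -?/t1 -?/t2 -?/t3; lra.
Qed.

Definition qcoordE := (qmul0, qmul1, qmul2, qmul3, qinvE, @inord4_eq 0 0 isT isT,
  @inord4_eq 1 0 isT isT, @inord4_eq 2 0 isT isT, @inord4_eq 3 0 isT isT).

Lemma qmulKr h z : z != 0 -> qmul (qmul h z) (qinv z) = h.
Proof.
move=> /qnorm2_neq0 n0; apply/rowP; apply: I4_case; rewrite !qcoordE /=;
  move: n0; rewrite /qnorm2 => n0; field; exact: n0.
Qed.

Lemma qmulVr h z : z != 0 -> qmul (qmul h (qinv z)) z = h.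
Proof.
move=> /qnorm2_neq0 n0; apply/rowP; apply: I4_case; rewrite !qcoordE /=;
  move: n0; rewrite /qnorm2 => n0; field; exact: n0.
Qed.

Lemma qmul_sum (c : 'I_4 -> R) z i :
  \sum_a c a * qmul (qe a) z 0 i = qmul (\row_a c a) z 0 i.
Proof.
move: i; apply: I4_case; rewrite sum4 !qcoordE !mxE !inord4_eq //=; ring.
Qed.

Lemma qeE (a b : 'I_4) : qe a 0 b = (b == a)%:R :> R.
Proof. by rewrite mxE eqxx. Qed.

Lemma Ad_mxE z (al be : 'I_3) :
  Ad_mx z al be = qmul (qmul z (qe (im be))) (qinv z) 0 (im al).
Proof. by rewrite mxE. Qed.

(** These are the Euler-Rodrigues entries of the rotation defined by the quaternion a + b i + c j +
    d k, [n] being the inverse of its squared norm. *)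
Lemma rotation_orthonormal (a b c d n : R) (r : 'I_3 -> 'I_3 -> R) :
  n * (a * a + b * b + c * c + d * d) = 1 ->
  r idx1 idx1 = n * (a * a + b * b - c * c - d * d) ->
  r idx1 idx2 = n * (2 * (b * c - a * d)) -> r idx1 idx3 = n * (2 * (b * d + a * c)) ->
  r idx2 idx1 = n * (2 * (b * c + a * d)) ->
  r idx2 idx2 = n * (a * a - b * b + c * c - d * d) ->
  r idx2 idx3 = n * (2 * (c * d - a * b)) -> r idx3 idx1 = n * (2 * (b * d - a * c)) ->
  r idx3 idx2 = n * (2 * (c * d + a * b)) ->
  r idx3 idx3 = n * (a * a - b * b - c * c + d * d) ->
  forall al be, \sum_ga r al ga * r be ga = (al == be)%:R.
Proof.
move=> n1 r11 r12 r13 r21 r22 r23 r31 r32 r33 al be; rewrite sum3.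
(* Inserting the square of the normalisation, which is 1, makes every case a polynomial identity. *)
transitivity ((al == be)%:R * (n * (a * a + b * b + c * c + d * d)) ^+ 2); last first.
  by rewrite n1 expr1n mulr1.
by move: al be; apply: I3_case; apply: I3_case;
  rewrite ?(r11, r12, r13, r21, r22, r23, r31, r32, r33) /=; ring.
Qed.

Lemma Ad_mx_orthonormal z (al be : 'I_3) : z != 0 ->
  \sum_ga Ad_mx z al ga * Ad_mx z be ga = (al == be)%:R.
Proof.
move=> /qnorm2_neq0 n0.
apply: (@rotation_orthonormal (z 0 (inord 0)) (z 0 (inord 1)) (z 0 (inord 2)) (z 0 (inord 3))
  (qnorm2 z)^-1 (fun al be => Ad_mx z al be)); first by rewrite mulVf.
all: rewrite Ad_mxE ?im1 ?im2 ?im3 !qcoordE !qeE !inord4_eq //=; ring.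
Qed.

End QuaternionAlgebra.

(** * Tangent vectors of the group of nonzero quaternions *)

Section HstarTangent.
Context {R : realType}.
Notation H := (@Hstar R).
Implicit Types (z : H) (v w : tvec H).

Lemma Hstar_neq0 z : cmap (@Hchart R) z != 0.
Proof. exact: (@cmap_img _ _ _ (@Hchart R) z I). Qed.

Definition Hcoord (a : 'I_4) : H -> R := fun z => cmap (@Hchart R) z 0 a.

Lemma smooth_Hcoord a : smooth (Hcoord a).
Proof.
move=> c ->; apply: (@eq_smooth_on _ 4 _ (fun w : 'rV[R]_4 => w 0 a)); first exact: open_cimg.
  by move=> w cw; rewrite /Hcoord /= -[in LHS](cinvK cw).
exact: smooth_on_coord.
Qed.

Lemma Hstar_tangent_ext z v w : tangent z v -> tangent z w ->
  (forall a, v (Hcoord a) = w (Hcoord a)) -> v = w.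
Proof.
move=> tv tw vw.
have [X [E [sX _ HX]]] := @local_frame R H (@Hchart R) z erefl I.
have [_ _ HE _] := nbhs_singleton HX; rewrite (HE v tv) (HE w tw).
apply: eq_bigr => i _; congr (_ *: _).
have XE : \forall y \near z, X i y = Hcoord i y by apply: filterS HX => y [_ H0 _ _]; exact: H0.
by rewrite (tangent_local tv _ _ XE) // ?(tangent_local tw _ _ XE) //; exact: smooth_Hcoord.
Qed.

Lemma Hvec_tangent z h : tangent z (Hvec z h).
Proof.
have df (f : H -> R) : smooth f -> derivable (f \o cinv (@Hchart R)) (cmap (@Hchart R) z) h.
  move=> sf; apply: diff_derivable.
  by apply: smooth_on_differentiable (cmap_img (c := @Hchart R) (x := z) I); exact: sf.
have zK : cinv (@Hchart R) (cmap (@Hchart R) z) = z by exact: (@cmapK _ _ _ (@Hchart R) z I).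
split=> [k f g sf sg|f g sf sg|f nsf]; last by rewrite /Hvec asboolF.
- rewrite /Hvec !asboolT //; last by apply: smoothD => //; apply: smoothM => //; exact: smooth_cst.
  have dkf := is_deriveZ k (derivableP (df _ sf)).
  by have [_ ->] := is_deriveD dkf (derivableP (df _ sg)).
- rewrite /Hvec !asboolT //; last exact: smoothM.
  have [_ ->] := is_deriveM (derivableP (df _ sf)) (derivableP (df _ sg)).
  have fz (k : H -> R) : (k \o cinv (@Hchart R)) (cmap (@Hchart R) z) = k z := congr1 k zK.
  by rewrite !fz addrC; congr (_ + _); rewrite /GRing.scale /= mulrC.
Qed.

Lemma Hvec_coord z h a : Hvec z h (Hcoord a) = h 0 a.
Proof.
rewrite /Hvec asboolT; last exact: smooth_Hcoord.
rewrite -(derive_coord h (cmap (@Hchart R) z) a); apply: near_eq_derive.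
have : nbhs (cmap (@Hchart R) z) (cimg (@Hchart R)).
  by apply: open_nbhs_nbhs; split; [exact: open_cimg|exact: Hstar_neq0].
by apply: filterS => w cw; rewrite /Hcoord /= -[in RHS](cinvK cw).
Qed.

Lemma eR_tangent a z : tangent z (eR a z).
Proof. exact: Hvec_tangent. Qed.

Lemma eL_tangent a z : tangent z (eL a z).
Proof. exact: Hvec_tangent. Qed.

(** Right-invariance means that [eR a] at z has coordinates [qe a] times z, so the coefficients are
    the components of h z^-1, with h the coordinate vector of [v]. *)
Lemma eR_span z v : tangent z v -> exists c : 'I_4 -> R, v = \sum_a c a *: eR a z.
Proof.
move=> tv; pose h : 'rV[R]_4 := \row_a v (Hcoord a).
exists (fun a => qmul h (qinv (cmap (@Hchart R) z)) 0 a).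
apply: Hstar_tangent_ext tv _ _.
  by apply: tangent_sumv => a; apply: tangent_scale; exact: eR_tangent.
move=> i; rewrite sum_tvecE.
under eq_bigr => a _ do rewrite -[(_ *: _) _]/(_ * eR a z (Hcoord i)) /eR Hvec_coord.
rewrite qmul_sum (_ : \row_a _ = qmul h (qinv (cmap (@Hchart R) z))).
  by rewrite qmulVr ?mxE //; exact: Hstar_neq0.
by apply/rowP => a; rewrite mxE.
Qed.

Lemma phi0_eR a z : phi0 z (eR a z) = (a == 0)%:R.
Proof.
rewrite /phi0 (_ : \row_b _ = qmul (qe a) (cmap (@Hchart R) z)); last first.
  by apply/rowP => b; rewrite mxE; exact: Hvec_coord.
by rewrite qmulKr; [rewrite qeE eq_sym|exact: Hstar_neq0].
Qed.

End HstarTangent.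

(** * The manifolds Mtilde and Mhat *)

Section PrincipalBundleTangent.
Context {R : realType} (P M : manifold R) (act : R -> P -> P) (prj : P -> M)
  (eta : form1 P) (xi : R).
Hypotheses (hP : principal_U1 act prj) (heta : connection_form act eta xi).
Notation L := (@line R).
Notation XP := (fundamental act xi).
Implicit Types (p : P) (v w : tvec P) (y : tvec M).

Lemma smooth_prj : smooth_map prj.
Proof. exact: quot_smooth (act_quotient hP). Qed.

Lemma smooth_act t : smooth_map (act t).
Proof. exact: (smooth_map_comp (act_smooth hP) (@smooth_slice2 _ L P t)). Qed.

Lemma smooth_scaled_act (c : R) :
  @smooth_map R (prod_manifold L P) P (fun tp => act (tp.1 * c) tp.2).
Proof.
have s1 : smooth_map (fun tp : prod_manifold L P => ((tp.1 * c, tp.2) : prod_manifold L P)).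
  apply: (smooth_map_pair (M := L)); last exact: smooth_pr2.
  have := smoothM (smooth_pr1 (N := P) smooth_line_id) (smooth_cst c).
  exact: smooth_map_line.
exact: (smooth_map_comp (act_smooth hP) s1).
Qed.

Lemma scaled_act0 (c : R) p : act (0 * c) p = p.
Proof. by rewrite mul0r (act0 hP). Qed.

Lemma scaled_actD (c : R) (s t : R) p : act ((s + t) * c) p = act (s * c) (act (t * c) p).
Proof. by rewrite mulrDl (actD hP). Qed.

(** Brings the fundamental fields under the lemmas on flows; on functions that are not smooth both
    sides are zero by convention. *)
Lemma fundamental_generator (c : R) : fundamental act c = generator (fun t => act (t * c)).
Proof.
apply/funext => p; apply/funext => g; have [sg|nsg] := pselect (smooth g).
  by rewrite (generatorE (@smooth_scaled_act c)) // /fundamental asboolT.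
by rewrite /fundamental /generator /push !asboolF.
Qed.

Lemma field_fundamental (c : R) : is_field (fundamental act c).
Proof.
rewrite fundamental_generator.
exact: (field_generator (@smooth_scaled_act c) (@scaled_act0 c)).
Qed.

Lemma derive1_scale (c : R) (G : R -> R) : derivable G 0 1 ->
  derive1 (fun t => G (t * c)) 0 = c * derive1 G 0.
Proof.
move=> dG; rewrite !derive1E.
have dM : is_derive (0 : R) 1 (fun t : R => t * c) c.
  have dM0 := is_deriveM (is_derive_id (0 : R) (1 : R)) (is_derive_cst c (0 : R) (1 : R)).
  by apply: (is_derive_eq dM0); rewrite scaler0 add0r /GRing.scale /= mulr1.
have dG0 : is_derive ((0 : R) * c) 1 G ('D_1 G 0) by rewrite mul0r; exact: derivableP.
have [_ ->] := @is_derive1_comp _ G (fun t : R => t * c) _ _ _ dG0 dM.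
by rewrite mulrC.
Qed.

Lemma fundamentalZ (c : R) p : fundamental act c p = c *: fundamental act 1 p.
Proof.
apply/funext => g; rewrite -[RHS]/(c * fundamental act 1 p g) /fundamental.
case: asboolP => sg; last by rewrite mulr0.
have sG : smooth ((fun t => g (act t p)) : L -> R).
  exact: (smooth_map_comp (act_smooth hP) (@smooth_slice1 _ L P p) sg).
rewrite (derive1_scale c (smooth_line_derivable (t := 0) sG)).
by congr (c * _); congr (derive1 _ 0); apply/funext => t; rewrite mulr1.
Qed.

Lemma prj_act t p : prj (act t p) = prj p.
Proof.
apply/esym/(quot_fibre (act_quotient hP)); by exists t.
Qed.

Lemma push_prj_fundamental p : push prj (XP p) = 0.
Proof.
apply/(quot_kernel (act_quotient hP)); first exact: field_tangent (field_fundamental xi).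
by exists xi; exact: fundamentalZ.
Qed.

Lemma eta_linear p (k : R) v w : tangent p v -> tangent p w ->
  eta p (k *: v + w) = k * eta p v + eta p w.
Proof. by move=> tv tw; apply: (form1_linear (cform_form1 heta)). Qed.

Lemma eta0 p : eta p 0 = 0.
Proof. exact: linear_on_tangent0 (@eta_linear p). Qed.

(** A vertical vector is a multiple of [fundamental act 1], on which [eta] cannot vanish since it
    equals 1 on the multiple by [xi]. *)
Lemma eta_lift0 p w : tangent p w -> eta p w = 0 -> push prj w = 0 -> w = 0.
Proof.
move=> tw ew /(quot_kernel (act_quotient hP) tw)[a wE].
have tF : tangent p (fundamental act 1 p) by exact: field_tangent (field_fundamental 1).
have eZ k : eta p (k *: fundamental act 1 p) = k * eta p (fundamental act 1 p).
  by have := eta_linear k tF (tangent0 p); rewrite !addr0 eta0 addr0.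
have := cform_fundamental heta p; rewrite fundamentalZ eZ => /esym e1.
have : eta p (fundamental act 1 p) != 0.
  by apply/eqP => e0; move/eqP: e1; rewrite e0 mulr0 oner_eq0.
move: ew; rewrite wE eZ => /eqP; rewrite mulf_eq0 => /orP[/eqP ->|/eqP ->].
  by rewrite scale0r.
by rewrite eqxx.
Qed.

Lemma eta_lift_unique p y w w' : eta_lift prj eta p y w -> eta_lift prj eta p y w' -> w = w'.
Proof.
move=> [tw ew pw] [tw' ew' pw']; apply/eqP; rewrite -subr_eq0; apply/eqP.
apply: (@eta_lift0 p); first exact: tangent_sub.
  by rewrite addrC -scaleN1r eta_linear // ew ew' mulr0 addr0.
by rewrite pushB // ?pw ?pw' ?subrr //; exact: smooth_prj.
Qed.

Lemma eta_lift_exists p y : tangent (prj p) y -> exists w, eta_lift prj eta p y w.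
Proof.
move=> ty; have [v tv vy] := quot_submersion (act_quotient hP) ty.
have tX : tangent p (XP p) by exact: field_tangent (field_fundamental xi).
exists (- eta p v *: XP p + v); split.
- exact: tangentP_linear.
- by rewrite eta_linear // (cform_fundamental heta) mulr1 addNr.
- by rewrite push_linear push_prj_fundamental scaler0 add0r.
Qed.

Lemma eta_lift_linear p (k : R) y y' w w' : eta_lift prj eta p y w -> eta_lift prj eta p y' w' ->
  eta_lift prj eta p (k *: y + y') (k *: w + w').
Proof.
move=> [tw ew pw] [tw' ew' pw']; split; first exact: tangentP_linear.
  by rewrite eta_linear // ew ew' mulr0 addr0.
by rewrite push_linear pw pw'.
Qed.

Lemma eta_lift_act t p y w : eta_lift prj eta p y w ->
  eta_lift prj eta (act t p) y (push (act t) w).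
Proof.
move=> [tw ew pw]; split.
- exact: (push_tangent (@smooth_act t)).
- by rewrite (cform_invariant heta).
- rewrite push_comp; last exact: smooth_prj.
  by have -> : prj \o act t = prj by apply/funext => q; exact: prj_act.
Qed.

(** The structure group is abelian. *)
Lemma push_act_fundamental t p : push (act t) (XP p) = XP (act t p).
Proof.
have fX := field_fundamental xi.
apply: tangent_ext; first exact: (push_tangent (@smooth_act t) (field_tangent p fX)).
  exact: field_tangent.
move=> g sg; rewrite pushE // /fundamental !asboolT //; last exact: smooth_act.
congr (derive1 _ 0); apply/funext => s /=.
by rewrite -!(actD hP) addrC.
Qed.

End PrincipalBundleTangent.

Section TangentLinear.
Context {R : realType} (M N : manifold R).
Implicit Types (x : M) (F G : tvec M -> tvec N) (v w : tvec M).

(** Linearity is restricted to tangent vectors because [tvec] also contains arbitrary functionals,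
    on which endomorphism fields are unconstrained. *)
Definition tangent_linear_map x F : Prop := forall (k : R) v w,
  tangent x v -> tangent x w -> F (k *: v + w) = k *: F v + F w.

Lemma tlinear0 x F : tangent_linear_map x F -> F 0 = 0.
Proof.
move=> lF; have := lF 1 0 0 (tangent0 x) (tangent0 x).
by rewrite scaler0 addr0 scale1r => /(congr1 (fun t => t - F 0)); rewrite subrr addrK.
Qed.

Lemma tlinearZ x F (k : R) v : tangent_linear_map x F -> tangent x v -> F (k *: v) = k *: F v.
Proof.
by move=> lF tv; have := lF k v 0 tv (tangent0 x); rewrite (tlinear0 lF) !addr0.
Qed.

Lemma tlinearN x F v : tangent_linear_map x F -> tangent x v -> F (- v) = - F v.
Proof. by move=> lF tv; rewrite -scaleN1r (tlinearZ _ lF) // scaleN1r. Qed.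

Lemma tlinearD x F v w : tangent_linear_map x F -> tangent x v -> tangent x w ->
  F (v + w) = F v + F w.
Proof. by move=> lF tv tw; have := lF 1 v w tv tw; rewrite !scale1r. Qed.

Lemma tlinear_sum (J : finType) x F (k : J -> R) (v : J -> tvec M) :
  tangent_linear_map x F -> (forall j, tangent x (v j)) ->
  F (\sum_j k j *: v j) = \sum_j k j *: F (v j).
Proof.
move=> lF tv; have H (s : seq J) : tangent x (\sum_(j <- s) k j *: v j) /\
    F (\sum_(j <- s) k j *: v j) = \sum_(j <- s) k j *: F (v j).
  elim: s => [|j s [IHt IH]].
    by rewrite !big_nil (tlinear0 lF); split => //; exact: tangent0.
  by rewrite !big_cons lF // IH; split => //; exact: tangentP_linear.
by have [] := H (index_enum J).
Qed.

End TangentLinear.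

Lemma endo_tlinear {R : realType} (M : manifold R) (A : endo M) x :
  is_endo A -> tangent_linear_map x (A x).
Proof. by move=> eA k v w; exact: endo_linear. Qed.

Lemma pair_vec_linear {R : realType} (M N : manifold R) (p : prod_manifold M N) (k : R) v v' w w' :
  pair_vec p (k *: v + v') (k *: w + w') = k *: pair_vec p v w + pair_vec p v' w'.
Proof. by rewrite !pair_vecE !push_linear scalerDr addrACA. Qed.

Lemma pair_vecD {R : realType} (M N : manifold R) (p : prod_manifold M N) v v' w w' :
  pair_vec p (v + v') (w + w') = pair_vec p v w + pair_vec p v' w'.
Proof. by have := pair_vec_linear p 1 v v' w w'; rewrite !scale1r. Qed.

Lemma pair_vec0 {R : realType} (M N : manifold R) (p : prod_manifold M N) : pair_vec p 0 0 = 0.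
Proof. by rewrite pair_vecE !push0 addr0. Qed.

Lemma pair_vecN {R : realType} (M N : manifold R) (p : prod_manifold M N) v w :
  pair_vec p (- v) (- w) = - pair_vec p v w.
Proof.
have := pair_vec_linear p (-1) v 0 w 0.
by rewrite !addr0 !scaleN1r pair_vec0 addr0.
Qed.

Lemma hypercomplex_anticommute {R : realType} (M : manifold R) (I : 'I_3 -> endo M) x v al be :
  hypercomplex I -> tangent x v ->
  I al x (I be x v) + I be x (I al x v) = (- 2 * (al == be)%:R) *: v.
Proof.
move=> hI tv.
have tI a w : tangent x w -> tangent x (I a x w) by apply: endo_tangent; exact: hyper_endo.
have N a w : tangent x w -> I a x (- w) = - I a x w.
  by apply: tlinearN; apply: endo_tlinear; exact: hyper_endo.
have sq a w : tangent x w -> I a x (I a x w) = - w by exact: hyper_square.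
have I12 w : tangent x w -> I idx1 x (I idx2 x w) = I idx3 x w by exact: hyper_12.
have I21 w : tangent x w -> I idx2 x (I idx1 x w) = - I idx3 x w by exact: hyper_21.
have I3E w : tangent x w -> I idx3 x w = - I idx2 x (I idx1 x w).
  by move=> tw; rewrite I21 // opprK.
have I13 : I idx1 x (I idx3 x v) = - I idx2 x v by rewrite -I12 // sq //; exact: tI.
have I23 : I idx2 x (I idx3 x v) = I idx1 x v.
  by rewrite I3E // N ?sq ?opprK //; auto.
have I31 : I idx3 x (I idx1 x v) = I idx2 x v.
  by rewrite I3E ?sq // ?N ?opprK //; auto.
have I32 : I idx3 x (I idx2 x v) = - I idx1 x v.
  by rewrite -I12 ?sq ?N //; auto.
have d2 : (- 2 * 1) *: v = - v - v by rewrite mulr1 scaleNr scaler_nat mulr2n opprD.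
move: al be; apply: I3_case; apply: I3_case; rewrite ?sq ?I12 ?I21 ?I13 ?I23 ?I31 ?I32 //=;
  rewrite ?d2 ?mulr0 ?scale0r ?subrr ?addNr //.
Qed.

(** The hypotheses are the table of left multiplication by i, j, k on 1, i, j, k. They constrain [J]
    only on the vectors plus or minus [e a], which is all that is known of [It] along the
    right-invariant frame. *)
Lemma quaternion_table_anticommute {R : realType} (V : lmodType R) (J : 'I_3 -> V -> V)
    (e : 'I_4 -> V) :
  (forall al a, J al (- e a) = - J al (e a)) ->
  (forall al, J al (e 0) = e (im al)) -> (forall al, J al (e (im al)) = - e 0) ->
  (forall al, J al (e (im (ordS al))) = e (im (ordS (ordS al)))) ->
  (forall al, J al (e (im (ordS (ordS al)))) = - e (im (ordS al))) ->
  forall al be a, J al (J be (e a)) + J be (J al (e a)) = (- 2 * (al == be)%:R) *: e a.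
Proof.
move=> JN J0 J1 J2 J3.
have S1 : ordS idx1 = idx2 by exact: val_inj.
have S2 : ordS idx2 = idx3 by exact: val_inj.
have S3 : ordS idx3 = idx1 by exact: val_inj.
have := (J1 idx1, J1 idx2, J1 idx3); have := (J2 idx1, J2 idx2, J2 idx3).
have := (J3 idx1, J3 idx2, J3 idx3); have := (J0 idx1, J0 idx2, J0 idx3).
rewrite !(S1, S2, S3) im1 im2 im3 I4_zero => j0 j3 j2 j1.
have d2 w : (- 2 * 1) *: w = - w - w by rewrite mulr1 scaleNr scaler_nat mulr2n opprD.
apply: I3_case; apply: I3_case; apply: I4_case => /=;
  rewrite ?(j0, j1, j2, j3, JN) ?(j0, j1, j2, j3, JN) ?(j0, j1, j2, j3, JN) ?d2 ?mulr0 ?scale0r;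
  by rewrite ?(j0, j1, j2, j3, JN) ?opprK ?subrr ?addNr.
Qed.

Lemma I3_cyclic (al be : 'I_3) : [\/ be = al, be = ordS al | be = ordS (ordS al)].
Proof.
move: al be; apply: I3_case; apply: I3_case;
  by [constructor 1; exact: val_inj|constructor 2; exact: val_inj|constructor 3; exact: val_inj].
Qed.

Lemma I4_cyclic (al : 'I_3) (a : 'I_4) :
  [\/ a = 0, a = im al, a = im (ordS al) | a = im (ordS (ordS al))].
Proof.
case: (unliftP ord0 a) => [be ->|->]; last by constructor 1.
by have [->|->|->] := I3_cyclic al be; [constructor 2|constructor 3|constructor 4].
Qed.

(** * The tensors of Mtilde, their invariance, and fields lifted from Mhat *)

Section Mtilde.
Context {R : realType} (M P Mhat : manifold R)
  (I : 'I_3 -> endo M) (Theta : form2 M) (Z : field M) (f : M -> R)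
  (act : R -> P -> P) (prj : P -> M) (eta : form1 P) (xi : R) (Zh : field P)
  (V1 : field (Mtilde P)) (prt : Mtilde P -> Mhat) (It : 'I_3 -> endo (Mtilde P))
  (Ih : 'I_3 -> endo Mhat).
Notation f1 := (f1_of Theta Z (I idx1) f).
Notation XP := (fundamental act xi).
Notation Z1 := (Z1_of prj f1 Zh XP).
Notation Mt := (Mtilde P).
Hypotheses (hI : hypercomplex I) (f1_neq0 : forall x, f1 x != 0)
  (hP : principal_U1 act prj) (heta : connection_form act eta xi)
  (ZhE : forall p, eta_lift prj eta p (Z (prj p)) (Zh p))
  (V1E : V1 = V1_of Z1)
  (hprt : quotient_submersion (same_integral_curve V1)
     (fun u => [set v | exists a : R, v = a *: V1 u]) prt)
  (hIt : is_Itilde prj eta I V1 It) (hIh : forall al, is_endo (Ih al))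
  (IhE : forall al u v, tangent u v ->
     push prt (It al u v) = Ih al (prt u) (push prt v)).
Implicit Types (u : Mt) (v : tvec Mt).

Let fXP : is_field XP := field_fundamental hP xi.
Let sprt : smooth_map prt := quot_smooth hprt.

Lemma Z1_tangent p : tangent p (Z1 p).
Proof.
have [tZ _ _] := ZhE p; apply: tangent_add => //; apply: tangent_scale.
exact: field_tangent.
Qed.

Lemma eta_Z1 p : eta p (Z1 p) = f1 (prj p).
Proof.
have [tZ eZ _] := ZhE p; rewrite /Z1_of addrC.
rewrite (eta_linear heta _ (field_tangent p fXP) tZ) eZ addr0.
by rewrite (cform_fundamental heta) mulr1.
Qed.

Lemma V1_pair u : V1 u = pair_vec u (eL (im idx1) u.1) (- Z1 u.2).
Proof.
rewrite V1E -[LHS]/(pair_vec u (eL (im idx1) u.1) 0 - pair_vec u 0 (Z1 u.2)).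
by rewrite -pair_vecN -pair_vecD oppr0 addr0 add0r.
Qed.

Lemma V1_tangent u : tangent u (V1 u).
Proof.
rewrite V1_pair; apply: pair_vec_tangent; first exact: eL_tangent.
by apply: tangent_opp; exact: Z1_tangent.
Qed.

Lemma push_V1 u : push prt (V1 u) = 0.
Proof.
by apply/(quot_kernel hprt); [exact: V1_tangent|exists 1; rewrite scale1r].
Qed.

Lemma lift_H_tangent a u : tangent u (lift_H (P := P) (eR a) u).
Proof. by apply: pair_vec_tangent; [exact: eR_tangent|exact: tangent0]. Qed.

(* [Z1] has [eta]-component [f1], which vanishes nowhere: this is what makes
   [V1] transverse to the sum of the right-invariant and horizontal directions. *)
Lemma Mtilde_linear_ext (N : manifold R) (F G : tvec Mt -> tvec N) u :
  tangent_linear_map u F -> tangent_linear_map u G -> F (V1 u) = G (V1 u) ->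
  (forall a, F (lift_H (eR a) u) = G (lift_H (eR a) u)) ->
  (forall y w, tangent (prj u.2) y -> eta_lift prj eta u.2 y w ->
     F (pair_vec u 0 w) = G (pair_vec u 0 w)) ->
  forall v, tangent u v -> F v = G v.
Proof.
move=> lF lG FV FE Fw v tv.
have t1 := push_tangent (@smooth_pr1 R (@Hstar R) P) tv.
have t2 := push_tangent (@smooth_pr2 R (@Hstar R) P) tv.
set v1 := push _ v in t1; set v2 := push _ v in t2.
(* Chosen so that [v2 - k Z1] is horizontal: [eta] equals [f1] on [Z1]. Adding [k V1] to [v] then
   leaves one vector tangent to the group and one horizontal vector. *)
pose k := eta u.2 v2 / f1 (prj u.2).
have tL := eL_tangent (im idx1) u.1; have tZ := Z1_tangent u.2.
have tx1 : tangent u.1 (k *: eL (im idx1) u.1 + v1) by exact: tangentP_linear.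
have tx2 : tangent u.2 (- k *: Z1 u.2 + v2) by exact: tangentP_linear.
have vE : v = - k *: V1 u + (pair_vec u (k *: eL (im idx1) u.1 + v1) 0
    + pair_vec u 0 (- k *: Z1 u.2 + v2)).
  rewrite {1}(product_tangentE tv) V1_pair -pair_vecD -pair_vec_linear; congr pair_vec.
    by rewrite addr0 addrA -scalerDl addNr scale0r add0r.
  by rewrite add0r addrA scalerN scaleNr opprK subrr add0r.
have tH : tangent u (pair_vec u (k *: eL (im idx1) u.1 + v1) 0).
  by apply: pair_vec_tangent => //; exact: tangent0.
have tW : tangent u (pair_vec u 0 (- k *: Z1 u.2 + v2)).
  by apply: pair_vec_tangent => //; exact: tangent0.
have tV := V1_tangent u.
rewrite vE lF ?lG ?FV //; try exact: tangent_add.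
rewrite (tlinearD lF) // (tlinearD lG) //; congr (_ + (_ + _)).
  have [c ->] := eR_span tx1.
  have -> : pair_vec u (\sum_a c a *: eR a u.1) 0 = \sum_a c a *: lift_H (eR a) u.
    rewrite pair_vecE push0 addr0 push_sum; apply: eq_bigr => a _.
    by rewrite pushZ /lift_H pair_vecE push0 addr0.
  have tE a : tangent u (lift_H (eR a) u) by exact: lift_H_tangent.
  rewrite (tlinear_sum c lF) // (tlinear_sum c lG) //.
  by apply: eq_bigr => a _; rewrite FE.
apply: (Fw (push prj (- k *: Z1 u.2 + v2))); first exact: (push_tangent (smooth_prj hP)).
by split=> //; rewrite (eta_linear heta) // eta_Z1 /k mulNr divfK ?addNr.
Qed.

Lemma ItN al u v : tangent u v -> It al u (- v) = - It al u v.
Proof. by apply: tlinearN; apply: endo_tlinear; exact: (It_endo hIt). Qed.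

Lemma It_tangent al u v : tangent u v -> tangent u (It al u v).
Proof. by apply: endo_tangent; exact: (It_endo hIt). Qed.

(** The structure I'_al of the construction, at the point [prj u.2] and for the group element
    [u.1]. *)
Definition rotated al u (y : tvec M) : tvec M :=
  \sum_(be < 3) Ad_mx (cmap Hchart u.1) al be *: I be (prj u.2) y.

Lemma rotated_tangent al u y : tangent (prj u.2) y -> tangent (prj u.2) (rotated al u y).
Proof.
move=> ty; apply: tangent_sumv => be; apply: tangent_scale.
by apply: endo_tangent => //; exact: hyper_endo.
Qed.

Lemma It_horizontal_lift al u y w : tangent (prj u.2) y -> eta_lift prj eta u.2 y w ->
  exists2 w', eta_lift prj eta u.2 (rotated al u y) w' & It al u (pair_vec u 0 w) = pair_vec u 0 w'.
Proof.
move=> ty hw; have [w' hw'] := eta_lift_exists hP heta (rotated_tangent al ty).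
by exists w' => //; apply: (It_horizontal hIt ty hw).
Qed.

(** In the symmetrised double sum only anticommutators of the [I] occur, so the diagonal alone
    survives; it is the scalar product of two rows of the orthogonal matrix of [Ad_z]. *)
Lemma rotated_anticommute al be u y : tangent (prj u.2) y ->
  rotated al u (rotated be u y) + rotated be u (rotated al u y) = (- 2 * (al == be)%:R) *: y.
Proof.
move=> ty; set A := Ad_mx (cmap Hchart u.1).
have tI a : tangent (prj u.2) (I a (prj u.2) y).
  by apply: endo_tangent => //; exact: hyper_endo.
have dbl a b : rotated a u (rotated b u y) =
    \sum_i \sum_j (A a i * A b j) *: I i (prj u.2) (I j (prj u.2) y).
  apply: eq_bigr => i _.
  have lI : tangent_linear_map (prj u.2) (I i (prj u.2)) by apply: endo_tlinear; exact: hyper_endo.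
  rewrite /rotated (tlinear_sum _ lI) // scaler_sumr; apply: eq_bigr => j _.
  by rewrite scalerA.
rewrite !dbl [X in _ + X]exchange_big -big_split /=.
under eq_bigr => i _.
  rewrite -big_split /=.
  under eq_bigr => j _.
    rewrite [A be j * A al i]mulrC -scalerDr (hypercomplex_anticommute _ _ hI ty) scalerA.
    over.
  over.
rewrite -(Ad_mx_orthonormal al be (Hstar_neq0 u.1)) mulr_sumr scaler_suml.
apply: eq_bigr => i _; rewrite (bigD1 i) //= eqxx big1 ?addr0 => [|j ji].
  by rewrite mulr1 mulrC.
by rewrite eq_sym (negbTE ji) !mulr0 scale0r.
Qed.

(** Compared after [push prt], because upstairs the relation fails on [V1], which every [It] kills.
    Once pushed, both sides vanish there, and the frame and the horizontal lifts are left. *)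
Lemma Ih_anticommute al be x (w : tvec Mhat) : tangent x w ->
  Ih al x (Ih be x w) + Ih be x (Ih al x w) = (- 2 * (al == be)%:R) *: w.
Proof.
have [u <- tw] := quot_surj hprt x.
have [v tv <-] := quot_submersion hprt tw.
have tI a v' : tangent u v' -> tangent u (It a u v') by exact: It_tangent.
rewrite -!IhE //; try by do ?apply: tI.
have lI a : tangent_linear_map u (It a u) by apply: endo_tlinear; exact: (It_endo hIt).
pose F v := push prt (It al u (It be u v)) + push prt (It be u (It al u v)).
pose G v := (- 2 * (al == be)%:R) *: push prt v.
apply: (Mtilde_linear_ext (F := F) (G := G)) tv => {v tw}.
- move=> k v v' tv tv'; rewrite /F !lI //; try by do ?apply: tI.
  by rewrite !push_linear addrACA scalerDr.
- move=> k v v' tv tv'; rewrite /G push_linear scalerDr !scalerA.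
  by rewrite mulrC.
- by rewrite /F /G !(It_V1 hIt) !(tlinear0 (lI _)) push0 addr0 push_V1 scaler0.
- move=> a; rewrite /F /G -pushD -pushZ; congr push.
  apply: (@quaternion_table_anticommute _ _ (fun al => It al u) (fun a => lift_H (eR a) u)).
  + by move=> ? ?; apply: ItN; exact: lift_H_tangent.
  + by move=> ?; exact: (It_e0 hIt).
  + by move=> ?; exact: (It_eal hIt).
  + by move=> ?; exact: (It_ebe hIt).
  + by move=> ?; exact: (It_ega hIt).
- move=> y w0 ty hw; rewrite /F /G.
  have [wa ha Ea] := It_horizontal_lift al ty hw.
  have [wb hb Eb] := It_horizontal_lift be ty hw.
  have [wab hab Eab] := It_horizontal_lift al (rotated_tangent be ty) hb.
  have [wba hba Eba] := It_horizontal_lift be (rotated_tangent al ty) ha.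
  rewrite Eb Ea Eab Eba -pushD -pushZ; congr push.
  have := eta_lift_linear heta 1 hab hba; rewrite !scale1r rotated_anticommute // => h1.
  have h0 : eta_lift prj eta u.2 0 0.
    by split; [exact: tangent0|exact: eta0 heta _|exact: push0].
  have := eta_lift_linear heta (- 2 * (al == be)%:R) hw h0; rewrite !addr0 => h2.
  rewrite -pair_vecD addr0 (eta_lift_unique hP heta h1 h2).
  have := pair_vec_linear u (- 2 * (al == be)%:R) 0 0 w0 0.
  by rewrite scaler0 !addr0 pair_vec0 addr0.
Qed.

(** The sign and the index are uniform in [u], so the same formula can be used at both ends of a
    flow line. *)
Lemma It_eR al a : exists (s : R) (b : 'I_4), forall u,
  It al u (lift_H (eR a) u) = s *: lift_H (eR b) u.
Proof.
have [->|->|->|->] := I4_cyclic al a.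
- by exists 1, (im al) => u; rewrite (It_e0 hIt) scale1r.
- by exists (- 1), 0 => u; rewrite (It_eal hIt) scaleN1r.
- by exists 1, (im (ordS (ordS al))) => u; rewrite (It_ebe hIt) scale1r.
- by exists (- 1), (im (ordS al)) => u; rewrite (It_ega hIt) scaleN1r.
Qed.

Definition Phit (t : R) (u : Mt) : Mt := (u.1, act (t * xi) u.2).

Lemma smooth_Phit : @smooth_map R (prod_manifold line Mt) Mt (fun tp => Phit tp.1 tp.2).
Proof.
apply: (smooth_map_pair (M := @Hstar R) (N := P)).
  exact: (smooth_map_comp (@smooth_pr1 R (@Hstar R) P) (@smooth_pr2 R line Mt)).
have s1 : smooth_map (fun tp : prod_manifold line Mt =>
    ((tp.1, tp.2.2) : prod_manifold line P)).
  apply: (smooth_map_pair (M := line)); first exact: smooth_pr1.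
  exact: (smooth_map_comp (@smooth_pr2 R (@Hstar R) P) (@smooth_pr2 R line Mt)).
exact: (smooth_map_comp (smooth_scaled_act hP xi) s1).
Qed.

Lemma Phit0 u : Phit 0 u = u.
Proof. by rewrite /Phit (scaled_act0 hP); case: u. Qed.

Lemma PhitD s t u : Phit (s + t) u = Phit s (Phit t u).
Proof. by rewrite /Phit (scaled_actD hP). Qed.

Let sPhit t : smooth_map (Phit t) := @smooth_flow R Mt Phit smooth_Phit t.

Lemma generator_Phit : generator Phit = lift_P XP.
Proof.
have fX : is_field (lift_P XP : field Mt) := is_product_field (@field0 R (@Hstar R)) fXP.
apply: field_ext fX _ => [|u g sg]; first exact: field_generator smooth_Phit Phit0.
rewrite (generatorE smooth_Phit) // /lift_P pair_vec_smooth // add0r.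
by rewrite /fundamental asboolT //; exact: (@smooth_slice2 R (@Hstar R) P u.1 _ sg).
Qed.

Lemma push_Phit t u (v : tvec (@Hstar R)) (w : tvec P) : push (Phit t) (pair_vec u v w) =
  pair_vec (Phit t u) v (push (act (t * xi)) w).
Proof.
apply/funext => g; have [sg|nsg] := pselect (smooth g); last by rewrite /push /pair_vec !asboolF.
rewrite pushE // !pair_vec_smooth //; last exact: sPhit.
by congr (_ + _); rewrite pushE //; exact: (@smooth_slice2 R (@Hstar R) P u.1 _ sg).
Qed.

Lemma push_act_Z1 t p : push (act t) (Z1 p) = Z1 (act t p).
Proof.
rewrite /Z1_of pushD pushZ (push_act_fundamental xi hP) (prj_act hP); congr (_ + _).
have h := eta_lift_act hP heta t (ZhE p); apply: (eta_lift_unique hP heta h).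
by have := ZhE (act t p); rewrite (prj_act hP).
Qed.

Lemma push_Phit_V1 t u : push (Phit t) (V1 u) = V1 (Phit t u).
Proof. by rewrite !V1_pair push_Phit pushN push_act_Z1. Qed.

Lemma push_Phit_eR t u a : push (Phit t) (lift_H (eR a) u) = lift_H (eR a) (Phit t u).
Proof. by rewrite push_Phit push0. Qed.

(** The flow fixes [V1] and the right-invariant frame, and it maps horizontal lifts to horizontal
    lifts. The rotated structure depends only on [u.1] and [prj u.2], which are constant along flow
    lines. *)
Lemma It_invariant al t u v : tangent u v ->
  It al (Phit t u) (push (Phit t) v) = push (Phit t) (It al u v).
Proof.
move: v; apply: Mtilde_linear_ext.
- move=> k v v' tv tv'; rewrite push_linear endo_linear //; first exact: (It_endo hIt).
    exact: push_tangent.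
  exact: push_tangent.
- by move=> k v v' tv tv'; rewrite endo_linear ?push_linear //; exact: (It_endo hIt).
- by rewrite push_Phit_V1 !(It_V1 hIt) push0.
- move=> a; have [s [b Eab]] := It_eR al a.
  by rewrite push_Phit_eR !Eab pushZ push_Phit_eR.
- move=> y w ty hw; have [w1 hw1 E1] := It_horizontal_lift al ty hw.
  have hw' := eta_lift_act hP heta (t * xi) hw.
  have ty' : tangent (prj (Phit t u).2) y by rewrite /= (prj_act hP).
  have [w2 hw2 E2] := It_horizontal_lift al ty' hw'.
  rewrite E1 !push_Phit E2; congr pair_vec.
  apply: (eta_lift_unique hP heta hw2).
  have := eta_lift_act hP heta (t * xi) hw1.
  by rewrite /rotated /= (prj_act hP).
Qed.

(** Lifts through [prt] differ by multiples of [V1]. Since [eta] is [- f1] on [V1], hence nonzero,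
    exactly one of them is annihilated by the pullback of [eta], and [lift_field] makes it
    smooth. *)
Lemma prt_lift Y : is_field Y -> exists2 Yt, is_field Yt & related prt Yt Y.
Proof.
move=> fY; pose th (_ : 'I_1) : form1 Mt := fun u v => eta (pr2 u) (push (@pr2 R (@Hstar R) P) v).
have fth a : is_form1 (th a).
  exact: form1_pullback (@smooth_pr2 R (@Hstar R) P) (cform_form1 heta).
have thV u a : th a u (V1 u) = - f1 (prj u.2).
  rewrite /th V1_pair push_pr2_pair; [|exact: eL_tangent|by apply: tangent_opp; exact: Z1_tangent].
  rewrite -scaleN1r; have := eta_linear heta (- 1) (Z1_tangent u.2) (tangent0 _).
  by rewrite !addr0 eta_Z1 (eta0 heta) addr0 mulN1r.
have thZ u a k v : tangent u v -> th a u (k *: V1 u + v) = - (k * f1 (prj u.2)) + th a u v.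
  by move=> tv; rewrite (form1_linear (fth a) _ (V1_tangent u) tv) thV mulrN.
have [||Yt [fYt rY _]] := @lift_field R Mt Mhat prt sprt 1 th Y fth _ _ fY; last by exists Yt.
- move=> u v tv /(quot_kernel hprt tv)[a ->] /(_ 0).
  have := thZ u 0 a 0 (tangent0 u); rewrite addr0 => ->.
  rewrite /th push0 (eta0 heta) addr0 => /eqP.
  by rewrite oppr_eq0 mulf_eq0 (negbTE (f1_neq0 _)) orbF => /eqP ->; rewrite scale0r.
- move=> u w /(quot_submersion hprt)[v tv <-].
  exists ((th 0 u v / f1 (prj u.2)) *: V1 u + v); first exact: tangentP_linear (V1_tangent u) tv.
  split; first by rewrite push_linear push_V1 scaler0 add0r.
  by move=> a; rewrite thZ // divfK ?addNr.
Qed.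

(** * Lie derivatives along Xhat and the values of theta0 on D *)

Section LieDerivatives.
Variables (V : field Mhat) (theta0 : form1 Mhat) (Xhat : field Mhat).
Hypotheses (hV : is_field V) (VE : related prt (lift_H (eR 0)) V)
  (htheta0 : is_form1 theta0)
  (theta0E : forall u v, tangent u v ->
     theta0 (prt u) (push prt v) = phi0 u.1 (push (fun u' : Mt => u'.1) v))
  (hXhat : is_field Xhat) (XhatE : related prt (lift_P XP) Xhat).

Let rX : related prt (generator Phit) Xhat.
Proof. by rewrite generator_Phit. Qed.

Let fG : is_field (generator Phit) := field_generator smooth_Phit Phit0.

Lemma related_appl_It al Y Yt : is_field Yt -> related prt Yt Y ->
  related prt (appl (It al) Yt) (appl (Ih al) Y).
Proof. by move=> fYt rY u; rewrite /appl IhE ?rY //; exact: field_tangent. Qed.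

(** For a lift of [Y] the identity holds upstairs by invariance of [It]; brackets and endomorphisms
    are compatible with [prt], which is onto. *)
Lemma bracket_Xhat_Ih al Y : is_field Y ->
  bracket Xhat (appl (Ih al) Y) = appl (Ih al) (bracket Xhat Y).
Proof.
move=> fY; have [Yt fYt rY] := prt_lift fY.
have fIY : is_field (appl (Ih al) Y) by exact: endo_smooth.
have fItY : is_field (appl (It al) Yt) by apply: endo_smooth => //; exact: (It_endo hIt).
have r1 := related_bracket sprt fG fItY hXhat fIY rX (related_appl_It al fYt rY).
have r2 := related_appl_It al (field_bracket fG fYt)
  (related_bracket sprt fG fYt hXhat fY rX rY).
apply/funext => x; have [u <-] := quot_surj hprt x.
rewrite -r1 -r2 (invariant_endo_bracket smooth_Phit Phit0 PhitD (It_endo hIt al)) //.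
by move=> t u' v tv; exact: It_invariant.
Qed.

(** The pullback of [theta0] to [Mtilde] is [phi0] on the group factor, and the flow does not move
    that factor. *)
Lemma Xhat_theta0 Y x : is_field Y ->
  Xhat x (fun y => theta0 y (Y y)) = theta0 x (bracket Xhat Y x).
Proof.
move=> fY; have [Yt fYt rY] := prt_lift fY; have [u <-] := quot_surj hprt x.
have fa := form1_pullback sprt htheta0.
have := @invariant_form_derivative R Mt Phit smooth_Phit Phit0 PhitD _ Yt fa _ fYt u.
rewrite (related_bracket sprt fG fYt hXhat fY rX rY) => <-.
  rewrite -rX pushE; last exact: form1_smooth.
  by congr (generator Phit u _); apply/funext => u' /=; rewrite rY.
move=> t u' v tv; rewrite !theta0E //; last exact: push_tangent.
by rewrite push_comp //; exact: smooth_pr1.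
Qed.

Lemma V_eR u : V (prt u) = push prt (lift_H (eR 0) u).
Proof. by rewrite VE. Qed.

Lemma Ih_V_eR al u : Ih al (prt u) (V (prt u)) = push prt (lift_H (eR (im al)) u).
Proof. rewrite V_eR -(IhE al (lift_H_tangent 0 u)) (It_e0 hIt al u); reflexivity. Qed.

Lemma theta0_eR a u : theta0 (prt u) (push prt (lift_H (eR a) u)) = (a == 0)%:R.
Proof.
rewrite theta0E; last exact: lift_H_tangent.
by rewrite /lift_H push_pr1_pair ?phi0_eR //; [exact: eR_tangent|exact: tangent0].
Qed.

Lemma theta0_V x : theta0 x (V x) = 1.
Proof. by have [u <-] := quot_surj hprt x; rewrite V_eR theta0_eR eqxx. Qed.

Lemma theta0_Ih_V al x : theta0 x (Ih al x (V x)) = 0.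
Proof. by have [u <-] := quot_surj hprt x; rewrite Ih_V_eR theta0_eR. Qed.

(** Only the coefficient of [V] needs to be explicit: it yields the values of [theta0], while the
    remaining terms merely have to stay in the distribution. *)
Lemma Ih_Ih_V al be x : exists c : 'I_3 -> R,
  Ih al x (Ih be x (V x)) = - (al == be)%:R *: V x + \sum_ga c ga *: Ih ga x (V x).
Proof.
have [u <-] := quot_surj hprt x.
have one ga (s : R) : s *: Ih ga (prt u) (V (prt u)) =
    \sum_de (s * (de == ga)%:R) *: Ih de (prt u) (V (prt u)).
  rewrite (bigD1 ga) //= eqxx mulr1 big1 ?addr0 // => de /negbTE ->.
  by rewrite mulr0 scale0r.
have nS (a : 'I_3) : (a == ordS a) = false by move: a; apply: I3_case.
have nSS (a : 'I_3) : (a == ordS (ordS a)) = false by move: a; apply: I3_case.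
rewrite (Ih_V_eR be u) -(IhE al (lift_H_tangent (im be) u)).
have [->|->|->] := I3_cyclic al be.
- exists (fun=> 0); rewrite (It_eal hIt) pushN -V_eR eqxx scaleN1r.
  by rewrite big1 ?addr0 // => ga _; rewrite scale0r.
- exists (fun de => 1 * (de == ordS (ordS al))%:R).
  rewrite (It_ebe hIt al u) -(one _ 1) scale1r (Ih_V_eR _ u) nS oppr0 scale0r add0r.
  reflexivity.
- exists (fun de => - 1 * (de == ordS al)%:R).
  by rewrite (It_ega hIt al u) -(one _ (- 1)) scaleN1r (Ih_V_eR _ u) nSS oppr0 scale0r add0r pushN.
Qed.

End LieDerivatives.

End Mtilde.

(** * Invariance of the Obata connection *)

Section LieAlgebra.
Context {R : realType} (M : manifold R).
Implicit Types (X Y W : field M) (A : endo M).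

Lemma bracketDr X Y W : is_field X -> is_field Y -> is_field W ->
  bracket X (Y + W) = bracket X Y + bracket X W.
Proof.
move=> fX fY fW; apply: field_ext => [||x f sf].
- by apply: field_bracket => //; exact: fieldD.
- by apply: fieldD; exact: field_bracket.
rewrite -[RHS]/(bracket X Y x f + bracket X W x f) /bracket.
rewrite (tangentD (field_tangent x fX)); [|exact: field_smooth..].
rewrite -[(Y + W) x _]/(Y x _ + W x _); ring.
Qed.

Lemma bracketNr X Y : is_field X -> is_field Y -> bracket X (- Y) = - bracket X Y.
Proof.
move=> fX fY; apply: field_ext => [||x f sf].
- by apply: field_bracket => //; exact: fieldN.
- by apply: fieldN; exact: field_bracket.
rewrite -[RHS]/(- bracket X Y x f) /bracket -[(- Y) x _]/(- Y x _).
have -> : (fun y => (- Y) y f) = fun y => - 1 * Y y f by apply/funext => y; rewrite mulN1r.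
rewrite (tangentZ _ (field_tangent x fX)); [ring|exact: field_smooth].
Qed.

Lemma bracketBr X Y W : is_field X -> is_field Y -> is_field W ->
  bracket X (Y - W) = bracket X Y - bracket X W.
Proof. by move=> fX fY fW; rewrite bracketDr ?bracketNr //; exact: fieldN. Qed.

Lemma bracketZr X Y (a : M -> R) : is_field X -> is_field Y -> smooth a ->
  bracket X (fun x => a x *: Y x) = fun x => X x a *: Y x + a x *: bracket X Y x.
Proof.
move=> fX fY sa; have fB := field_bracket fX fY; apply: field_ext => [||x f sf].
- by apply: field_bracket => //; exact: fieldZ.
- have sXa : smooth (fun x => X x a) by exact: field_smooth.
  exact: (fieldD (fieldZ sXa fY) (fieldZ sa fB)).
rewrite -[RHS]/(X x a * Y x f + a x * bracket X Y x f) /bracket.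
rewrite -[(a x *: Y x) _]/(a x * Y x _).
rewrite (tangent_leibniz (field_tangent x fX) sa (field_smooth fY sf)); ring.
Qed.

Lemma bracket0r X : is_field X -> bracket X 0 = 0.
Proof.
move=> fX; apply: field_ext => [||x f sf]; [|exact: field0|].
  by apply: field_bracket => //; exact: field0.
by rewrite /bracket (tangent_cst 0 (field_tangent x fX)) subr0.
Qed.

Lemma bracket_sumr (J : finType) X (Y : J -> field M) : is_field X ->
  (forall j, is_field (Y j)) ->
  bracket X (fun x => \sum_j Y j x) = fun x => \sum_j bracket X (Y j) x.
Proof.
move=> fX fY; have H (s : seq J) : is_field (fun x => \sum_(j <- s) Y j x) /\
    bracket X (fun x => \sum_(j <- s) Y j x) = fun x => \sum_(j <- s) bracket X (Y j) x.
  elim: s => [|j s [IHf IH]].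
    under eq_fun do rewrite big_nil; under [in RHS]eq_fun do rewrite big_nil.
    by split; [exact: field0|exact: bracket0r].
  under eq_fun do rewrite big_cons; under [in RHS]eq_fun do rewrite big_cons.
  split; first exact: (fieldD (fY j) IHf).
  by rewrite (bracketDr fX (fY j) IHf) IH.
by have [] := H (index_enum J).
Qed.

Lemma jacobi X Y W : is_field X -> is_field Y -> is_field W ->
  bracket X (bracket Y W) = bracket (bracket X Y) W + bracket Y (bracket X W).
Proof.
move=> fX fY fW; apply: field_ext => [||x f sf].
- by apply: field_bracket => //; exact: field_bracket.
- by apply: fieldD; apply: field_bracket => //; exact: field_bracket.
rewrite -[RHS]/(bracket (bracket X Y) W x f + bracket Y (bracket X W) x f) /bracket.
have s V g : is_field V -> smooth g -> smooth (fun y => V y g) by exact: field_smooth.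
rewrite (tangentB (field_tangent x fX)) ?(tangentB (field_tangent x fY))
  ?(tangentB (field_tangent x fW)); auto; ring.
Qed.

Lemma bracket_local X Y W x : is_field X -> is_field Y -> is_field W ->
  (\forall y \near x, Y y = W y) -> bracket X Y x = bracket X W x.
Proof.
move=> fX fY fW YW; apply: (@tangent_ext _ _ x) => [||f sf].
- exact: field_tangent (field_bracket fX fY).
- exact: field_tangent (field_bracket fX fW).
rewrite /bracket (nbhs_singleton YW); congr (_ - _).
apply: (tangent_local (field_tangent x fX)); [exact: field_smooth..|].
by apply: filterS YW => y ->.
Qed.

Lemma endo_fieldD A Y W : is_endo A -> is_field Y -> is_field W ->
  appl A (Y + W) = appl A Y + appl A W.
Proof.
move=> eA fY fW; apply/funext => x; rewrite /appl.
exact: (tlinearD (endo_tlinear eA) (field_tangent x fY) (field_tangent x fW)).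
Qed.

Lemma endo_fieldN A Y : is_endo A -> is_field Y -> appl A (- Y) = - appl A Y.
Proof.
move=> eA fY; apply/funext => x; rewrite /appl.
exact: (tlinearN (endo_tlinear eA) (field_tangent x fY)).
Qed.

Lemma endo_fieldB A Y W : is_endo A -> is_field Y -> is_field W ->
  appl A (Y - W) = appl A Y - appl A W.
Proof. by move=> eA fY fW; rewrite endo_fieldD ?endo_fieldN //; exact: fieldN. Qed.

Lemma field_lie_endo X A Y : is_field X -> is_endo A -> is_field Y -> is_field (lie_endo X A Y).
Proof.
move=> fX eA fY; apply: fieldB.
  by apply: field_bracket => //; exact: endo_smooth.
by apply: endo_smooth => //; exact: field_bracket.
Qed.

(** The two terms containing the derivative of [a] cancel: this is the tensoriality of the Lie
    derivative of [A]. *)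
Lemma lie_endoZ X A Y (a : M -> R) : is_field X -> is_endo A -> is_field Y -> smooth a ->
  lie_endo X A (fun x => a x *: Y x) = fun x => a x *: lie_endo X A Y x.
Proof.
move=> fX eA fY sa; have fB := field_bracket fX fY; have fAY := endo_smooth eA fY.
have E : appl A (fun x => a x *: Y x) = fun x => a x *: appl A Y x.
  apply/funext => x; exact: (tlinearZ _ (endo_tlinear eA) (field_tangent x fY)).
rewrite /lie_endo E !bracketZr //; apply/funext => x.
rewrite -[LHS]/((X x a *: appl A Y x + a x *: bracket X (appl A Y) x) -
  A x (X x a *: Y x + a x *: bracket X Y x)).
have tY := field_tangent x fY; have tB := field_tangent x fB.
rewrite (endo_linear eA) //; last exact: tangent_scale.
rewrite (tlinearZ _ (endo_tlinear eA)) // opprD addrACA subrr add0r.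
by rewrite -scalerBr.
Qed.

Lemma lie_endo_sum (J : finType) X A (Y : J -> field M) : is_field X -> is_endo A ->
  (forall j, is_field (Y j)) ->
  lie_endo X A (fun x => \sum_j Y j x) = fun x => \sum_j lie_endo X A (Y j) x.
Proof.
move=> fX eA fY; rewrite /lie_endo.
have E (V : J -> field M) : (forall j, is_field (V j)) ->
    appl A (fun x => \sum_j V j x) = fun x => \sum_j appl A (V j) x.
  move=> fV; apply/funext => x; have := tlinear_sum (fun=> 1) (endo_tlinear eA)
    (fun j => field_tangent x (fV j)).
  by under eq_bigr do rewrite scale1r; under [in RHS]eq_bigr do rewrite scale1r.
rewrite E // !bracket_sumr // ?E; last 2 first.
- by move=> j; exact: field_bracket.
- by move=> j; exact: endo_smooth.
by apply/funext => x; rewrite sumrB.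
Qed.

Lemma lie_endo_local X A Y W x : is_field X -> is_endo A -> is_field Y -> is_field W ->
  (\forall y \near x, Y y = W y) -> lie_endo X A Y x = lie_endo X A W x.
Proof.
move=> fX eA fY fW YW; rewrite -[LHS]/(bracket X (appl A Y) x - A x (bracket X Y x)).
rewrite -[RHS]/(bracket X (appl A W) x - A x (bracket X W x)).
rewrite (bracket_local fX fY fW YW); congr (_ - _).
apply: bracket_local => //; [exact: endo_smooth..|].
by apply: filterS YW => y; rewrite /appl => ->.
Qed.

(* The Lie derivative of an endomorphism field is again an endomorphism field,
   defined pointwise through a choice of local frames. *)
Lemma lie_endo_appl X A : is_field X -> is_endo A ->
  exists2 B, is_endo B & forall Y, is_field Y -> lie_endo X A Y = appl B Y.
Proof.
move=> fX eA.
have HF0 (x : M) : exists F : ('I_(mdim M) -> M -> R) * ('I_(mdim M) -> field M),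
    [/\ forall i, smooth (F.1 i), forall i, is_field (F.2 i) &
     \forall y \near x, forall v, tangent y v -> v = \sum_i v (F.1 i) *: F.2 i y].
  have [C [E [sC fE H]]] := local_frame_at x.
  by exists (C, E); split => //; apply: filterS H => y [].
have [F HF] := choice HF0.
pose B : endo M := fun x v => \sum_i v ((F x).1 i) *: lie_endo X A ((F x).2 i) x.
have BE Y : is_field Y -> lie_endo X A Y = appl B Y.
  move=> fY; apply/funext => x; have [sC fE H] := HF x.
  have sYC i : smooth (fun y => Y y ((F x).1 i)) by exact: field_smooth.
  have fYE i : is_field (fun y => Y y ((F x).1 i) *: (F x).2 i y) by exact: fieldZ.
  (* The frame expansion of [Y] holds only near [x], hence locality first, then tensoriality to
     extract the coefficients. *)
  rewrite (@lie_endo_local X A Y (fun y => \sum_i Y y ((F x).1 i) *: (F x).2 i y)) //.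
  - by rewrite lie_endo_sum //; apply: eq_bigr => i _; rewrite lie_endoZ.
  - exact: field_sum.
  - by apply: filterS H => y Hy; apply: Hy; exact: field_tangent.
exists B => //; split=> [x v tv|x k v w tv tw|Y fY].
- apply: tangent_sumv => i; apply: tangent_scale.
  by have [sC fE H] := HF x; apply: field_tangent; exact: field_lie_endo.
- rewrite /B scaler_sumr -big_split; apply: eq_bigr => i _ /=.
  by rewrite -[(k *: v + w) _]/(k * v _ + w _) scalerDl scalerA.
- by rewrite -BE //; exact: field_lie_endo.
Qed.

End LieAlgebra.

(** * Vanishing of the Lie derivative of the Obata connection *)

Section ObataInvariance.
Context {R : realType} (M : manifold R) (I : 'I_3 -> endo M) (nabla : conn M) (X : field M).
Hypotheses (eI : forall al, is_endo (I al))
  (anti : forall al be x (w : tvec M), tangent x w ->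
     I al x (I be x w) + I be x (I al x w) = (- 2 * (al == be)%:R) *: w)
  (hnabla : obata I nabla) (fX : is_field X)
  (lieI : forall al Y, is_field Y -> bracket X (appl (I al) Y) = appl (I al) (bracket X Y)).

Let hconn : is_connection nabla. Proof. by case: hnabla. Qed.
Let fN Y W : is_field Y -> is_field W -> is_field (nabla Y W).
Proof. exact: (conn_field hconn). Qed.

Lemma field_lie_conn Y W : is_field Y -> is_field W -> is_field (lie_conn X nabla Y W).
Proof.
move=> fY fW; have fXY := field_bracket fX fY; have fXW := field_bracket fX fW.
by apply: fieldB; [apply: fieldB; [apply: field_bracket|]|]; auto.
Qed.

(** The antisymmetric part is the Lie derivative of the torsion; with brackets in place of
    differences of covariant derivatives it vanishes by the Jacobi identity. *)
Lemma lie_conn_sym Y W : is_field Y -> is_field W ->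
  lie_conn X nabla Y W = lie_conn X nabla W Y.
Proof.
move=> fY fW; have [_ tf _] := hnabla.
have fXY := field_bracket fX fY; have fXW := field_bracket fX fW.
have e1 := tf _ _ fY fW; have e2 := tf _ _ fXY fW; have e3 := tf _ _ fY fXW.
have J := jacobi fX fY fW.
have e4 : bracket X (nabla Y W) - bracket X (nabla W Y) = bracket X (bracket Y W).
  by rewrite -bracketBr ?e1; auto.
apply/eqP; rewrite -subr_eq0 /lie_conn; apply/eqP.
transitivity ((bracket X (nabla Y W) - bracket X (nabla W Y))
  - (nabla (bracket X Y) W - nabla W (bracket X Y))
  - (nabla Y (bracket X W) - nabla (bracket X W) Y)).
  by rewrite !opprD !opprK [LHS](AC (3*3) ((1*4)*(2*6)*(3*5))).
by rewrite e4 e2 e3 J addrAC addrK subrr.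
Qed.

Lemma lie_conn_linear al Y W : is_field Y -> is_field W ->
  lie_conn X nabla Y (appl (I al) W) = appl (I al) (lie_conn X nabla Y W).
Proof.
move=> fY fW; have [_ _ par] := hnabla.
have fXY := field_bracket fX fY; have fXW := field_bracket fX fW.
have fNN := fN fY fW.
rewrite /lie_conn (par al) // (par al) // lieI // lieI // (par al) //.
have f1 := field_bracket fX fNN; have f2 := fN fXY fW; have f3 := fN fY fXW.
by rewrite (endo_fieldB (eI al) (fieldB f1 f2) f3) (endo_fieldB (eI al) f1 f2).
Qed.

(* A symmetric [S] with [S (Y, I W) = I S (Y, W)] for two anticommuting
   complex structures vanishes, since [I1 I2 S = S (I1, I2) = I2 I1 S]. *)
Lemma lie_obata_eq0 Y W : is_field Y -> is_field W -> lie_conn X nabla Y W = 0.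
Proof.
move=> fY fW; set S := lie_conn X nabla.
have fI al V : is_field V -> is_field (appl (I al) V) by exact: endo_smooth.
have SI al V V' : is_field V -> is_field V' -> S V (appl (I al) V') = appl (I al) (S V V').
  exact: lie_conn_linear.
have SIl al V V' : is_field V -> is_field V' -> S (appl (I al) V) V' = appl (I al) (S V V').
  by move=> fV fV'; rewrite /S lie_conn_sym ?lie_conn_linear ?(lie_conn_sym fV'); auto.
have fS := field_lie_conn fY fW.
have E : appl (I idx1) (appl (I idx2) (S Y W)) = appl (I idx2) (appl (I idx1) (S Y W)).
  transitivity (S (appl (I idx1) Y) (appl (I idx2) W)).
    by rewrite (SIl idx1) ?(SI idx2) //; exact: fI.
  by rewrite (SI idx2) ?(SIl idx1) //; exact: fI.
apply/funext => x; have tS := field_tangent x fS.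
have t1 : tangent x (I idx1 x (S Y W x)) by exact: endo_tangent.
have t2 : tangent x (I idx2 x (S Y W x)) by exact: endo_tangent.
have sq al w : tangent x w -> I al x (I al x w) = - w.
  move=> tw; have := anti al al tw; rewrite eqxx mulr1 -mulr2n -scaler_nat scaleNr => /eqP.
  by rewrite -scalerN => /eqP/(scalerI _) ->.
(* The two structures anticommute, and by [E] they commute on S, so I1 I2 S = 0. As both square to
   minus the identity, first I2 S and then S vanish. *)
have := anti idx1 idx2 tS; rewrite /= mulr0 scale0r.
have -> : I idx2 x (I idx1 x (S Y W x)) = I idx1 x (I idx2 x (S Y W x)).
  by have := congr1 (fun V : field M => V x) E.
rewrite -mulr2n -scaler_nat => /eqP; rewrite scaler_eq0 pnatr_eq0 /= => /eqP e0.
have lI al : tangent_linear_map x (I al x) by exact: endo_tlinear.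
have := sq idx1 _ t2; rewrite e0 (tlinear0 (lI idx1)) => /esym/eqP; rewrite oppr_eq0 => /eqP e2.
by have := sq idx2 _ tS; rewrite e2 (tlinear0 (lI idx2)) => /esym/eqP; rewrite oppr_eq0 => /eqP.
Qed.

End ObataInvariance.

(** * Descent to Mbar *)

Lemma form1_comp_endo {R : realType} (M : manifold R) (a : form1 M) (A : endo M) :
  is_form1 a -> is_endo A -> is_form1 (comp_form1 a A).
Proof.
move=> fa eA; split=> [x k v w tv tw|X fX].
  by rewrite /comp_form1 (endo_linear eA) // (form1_linear fa) //; exact: endo_tangent.
exact: (form1_smooth fa (endo_smooth eA fX)).
Qed.

Section Descent.
Context {R : realType} (Mhat Mbar : manifold R) (Ih : 'I_3 -> endo Mhat) (V : field Mhat)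
  (theta0 : form1 Mhat) (prh : Mhat -> Mbar) (nabla0 : conn Mhat) (nablabar : conn Mbar)
  (Xhat : field Mhat) (X : field Mbar).
Hypotheses (eI : forall al, is_endo (Ih al)) (fV : is_field V) (ftheta0 : is_form1 theta0)
  (anti : forall al be x (w : tvec Mhat), tangent x w ->
     Ih al x (Ih be x w) + Ih be x (Ih al x w) = (- 2 * (al == be)%:R) *: w)
  (theta0_V1 : forall x, theta0 x (V x) = 1)
  (theta0_IV : forall al x, theta0 x (Ih al x (V x)) = 0)
  (I_I_V : forall al be x, exists c : 'I_3 -> R,
     Ih al x (Ih be x (V x)) = - (al == be)%:R *: V x + \sum_ga c ga *: Ih ga x (V x))
  (hprh : quotient_submersion (same_leaf (Dhat Ih V)) (Dhat Ih V) prh)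
  (hnabla0 : obata Ih nabla0)
  (hnablabar : is_nablabar Ih theta0 prh nabla0 nablabar)
  (fXhat : is_field Xhat) (fX : is_field X) (rX : related prh Xhat X)
  (lieI : forall al Y, is_field Y -> bracket Xhat (appl (Ih al) Y) = appl (Ih al) (bracket Xhat Y))
  (lie_theta0 : forall Y x, is_field Y ->
     Xhat x (fun y => theta0 y (Y y)) = theta0 x (bracket Xhat Y x)).
Implicit Types (u : Mhat) (v w : tvec Mhat).
Notation D := (Dhat Ih V).
Notation theta := (theta' Ih theta0).

Let sprh : smooth_map prh := quot_smooth hprh.

Let lI al u : tangent_linear_map u (Ih al u) := endo_tlinear (eI al).

Lemma theta'E0 u v : theta u v 0 0 = theta0 u v.
Proof.
rewrite /theta' !mxE /= mulr1 summxE big1 ?addr0 // => al _.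
by rewrite !mxE /= mulr0.
Qed.

Lemma theta'E u v al : theta u v 0 (im al) = theta0 u (Ih al u v).
Proof.
have imE (be ga : 'I_3) : (im be == im ga) = (be == ga) by exact: (inj_eq (@lift_inj _ ord0)).
rewrite /theta' mxE summxE [X in X + _]mxE qeE mulr0 add0r.
rewrite (bigD1 al) //= big1 => [|be /negbTE ba]; rewrite mxE qeE imE.
  by rewrite eqxx mulr1 addr0.
by rewrite eq_sym ba mulr0.
Qed.

Lemma theta'_eq0P u v : theta u v = 0 <->
  theta0 u v = 0 /\ forall al, theta0 u (Ih al u v) = 0.
Proof.
split=> [t0|[t0 tI]].
  by split=> [|al]; [rewrite -theta'E0 t0 mxE|rewrite -theta'E t0 mxE].
apply/rowP => a; rewrite [RHS]mxE.
by case: (unliftP ord0 a) => [al ->|->]; [rewrite theta'E|rewrite theta'E0].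
Qed.

Lemma form1_theta' a : is_form1 (fun u v => theta u v 0 a).
Proof.
case: (unliftP ord0 a) => [al ->|->].
  rewrite (_ : (fun u v => _) = comp_form1 theta0 (Ih al)); first exact: form1_comp_endo.
  by apply/funext => u; apply/funext => v; exact: theta'E.
rewrite (_ : (fun u v => _) = theta0) //.
by apply/funext => u; apply/funext => v; exact: theta'E0.
Qed.

Lemma theta0_linear u (k : R) v w : tangent u v -> tangent u w ->
  theta0 u (k *: v + w) = k * theta0 u v + theta0 u w.
Proof. by move=> tv tw; exact: (form1_linear ftheta0). Qed.

Let tV u : tangent u (V u) := field_tangent u fV.
Let tI al u v : tangent u v -> tangent u (Ih al u v).
Proof. exact: (endo_tangent (eI al)). Qed.

Lemma theta0_lin_sum u (c : 'I_3 -> R) (v : 'I_3 -> tvec Mhat) :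
  (forall al, tangent u (v al)) ->
  theta0 u (\sum_al c al *: v al) = \sum_al c al * theta0 u (v al).
Proof. by move=> tv; apply: (@linear_on_tangent_sum R Mhat u) => //; exact: theta0_linear. Qed.

Lemma theta0_IIV al be u : theta0 u (Ih al u (Ih be u (V u))) = - (al == be)%:R.
Proof.
have [c ->] := I_I_V al be u.
have t1 ga : tangent u (Ih ga u (V u)) by exact: tI.
rewrite theta0_linear //; last by apply: tangent_sumv => ga; exact: tangent_scale.
rewrite theta0_V1 mulr1 theta0_lin_sum // big1 ?addr0 // => ga _.
by rewrite theta0_IV mulr0.
Qed.

Lemma Dhat_linear u (k : R) v w : D u v -> D u w -> D u (k *: v + w).
Proof.
move=> [a [b ->]] [a' [b' ->]]; exists (k * a + a'), (fun al => k * b al + b' al).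
rewrite scalerDr addrACA scalerA -scalerDl scaler_sumr -big_split; congr (_ + _).
by apply: eq_bigr => al _ /=; rewrite scalerA -scalerDl.
Qed.

Lemma Dhat0 u : D u 0.
Proof.
exists 0, (fun=> 0); rewrite scale0r add0r big1 // => al _; exact: scale0r.
Qed.

Lemma Dhat_scale u (k : R) v : D u v -> D u (k *: v).
Proof. by move=> Dv; have := Dhat_linear k Dv (Dhat0 u); rewrite addr0. Qed.

Lemma Dhat_add u v w : D u v -> D u w -> D u (v + w).
Proof. by move=> Dv /(Dhat_linear 1 Dv); rewrite scale1r. Qed.

Lemma Dhat_sum (J : finType) u (v : J -> tvec Mhat) : (forall j, D u (v j)) -> D u (\sum_j v j).
Proof. by move=> Dv; elim/big_ind: _ => //; [exact: Dhat0|exact: Dhat_add]. Qed.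

Lemma Dhat_V u : D u (V u).
Proof.
exists 1, (fun=> 0); rewrite scale1r big1 ?addr0 // => al _; exact: scale0r.
Qed.

Lemma Dhat_IV al u : D u (Ih al u (V u)).
Proof.
exists 0, (fun be => (be == al)%:R); rewrite scale0r add0r (bigD1 al) //= eqxx scale1r.
by rewrite big1 ?addr0 // => be /negbTE ->; rewrite scale0r.
Qed.

Lemma Dhat_Ih al u v : D u v -> D u (Ih al u v).
Proof.
move=> [a [b ->]].
have t1 be : tangent u (Ih be u (V u)) by exact: tI.
rewrite (lI al) //; last by apply: tangent_sumv => be; exact: tangent_scale.
apply: Dhat_linear; first exact: Dhat_IV.
rewrite (tlinear_sum b (lI al (u := u))) //; apply: Dhat_sum => be; apply: Dhat_scale.
have [c ->] := I_I_V al be u; apply: Dhat_linear; first exact: Dhat_V.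
by apply: Dhat_sum => ga; apply: Dhat_scale; exact: Dhat_IV.
Qed.

(** On the distribution the components of [theta'] are the coefficients up to sign: [theta0] reads
    off that of [V], and [theta0] after [Ih al] gives minus that of [Ih al V]. *)
Lemma Dhat_horizontal_eq0 u v : D u v -> theta u v = 0 -> v = 0.
Proof.
move=> [a [b ->]] /theta'_eq0P[].
have t1 be : tangent u (Ih be u (V u)) by exact: tI.
have tS : tangent u (\sum_be b be *: Ih be u (V u)).
  by apply: tangent_sumv => be; exact: tangent_scale.
rewrite theta0_linear // theta0_V1 mulr1 theta0_lin_sum // big1 ?addr0; last first.
  by move=> be _; rewrite theta0_IV mulr0.
move=> -> tI0; rewrite scale0r add0r big1 // => al _.
have := tI0 al; rewrite scale0r add0r (tlinear_sum b (lI al (u := u))) //.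
rewrite theta0_lin_sum => [|be]; last exact: tI.
rewrite (bigD1 al) //= theta0_IIV eqxx mulrN1 big1 ?addr0 => [|be /negbTE ba].
  by move/eqP; rewrite oppr_eq0 => /eqP ->; rewrite scale0r.
by rewrite theta0_IIV eq_sym ba oppr0 mulr0.
Qed.

Lemma hat_lift_exists (Y : field Mbar) : is_field Y -> exists Yh, hat_lift Ih theta0 prh Y Yh.
Proof.
move=> fY.
have [||Yh [fYh rY tY]] :=
  @lift_field R Mhat Mbar prh sprh 4 (fun a u v => theta u v 0 a) Y form1_theta' _ _ fY.
- move=> u v tv /(quot_kernel hprh tv) Dv t0; apply: Dhat_horizontal_eq0 Dv _.
  by apply/rowP => a; rewrite t0 mxE.
- move=> u w /(quot_submersion hprh)[v tv <-].
  have t1 be : tangent u (Ih be u (V u)) by exact: tI.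
  (* Vertical correction cancelling [theta'] of [v]. The signs differ because [theta0] is 1 on [V]
     but -1 on [Ih al (Ih al V)]. *)
  pose d := - theta0 u v *: V u + \sum_be theta0 u (Ih be u v) *: Ih be u (V u).
  have tS : tangent u (\sum_be theta0 u (Ih be u v) *: Ih be u (V u)).
    by apply: tangent_sumv => be; exact: tangent_scale.
  have td : tangent u d by exact: tangentP_linear.
  have Dd : D u d by exists (- theta0 u v), (fun be => theta0 u (Ih be u v)).
  exists (1 *: d + v); first exact: tangentP_linear.
  split.
    by rewrite push_linear (_ : push prh d = 0) ?scaler0 ?add0r //; exact/(quot_kernel hprh td).
  suff t0 : theta u (1 *: d + v) = 0 by move=> a; rewrite t0 mxE.
  apply/theta'_eq0P; split=> [|al].
    rewrite theta0_linear // mul1r /d theta0_linear // theta0_V1 mulr1 theta0_lin_sum //.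
    rewrite big1 ?addr0 ?addNr // => be _; by rewrite theta0_IV mulr0.
  rewrite (lI al) // theta0_linear ?mul1r; [|exact: tI..].
  rewrite /d (lI al) // theta0_linear; [|exact: tI..].
  rewrite theta0_IV mulr0 add0r (tlinear_sum _ (lI al (u := u))) //.
  rewrite theta0_lin_sum => [|be]; last exact: tI.
  rewrite (bigD1 al) //= theta0_IIV eqxx mulrN1 big1 ?addr0 ?addNr // => be /negbTE ba.
  by rewrite theta0_IIV eq_sym ba oppr0 mulr0.
exists Yh; split => // u; split; first exact: field_tangent.
by apply/rowP => a; rewrite tY mxE.
Qed.

(** Each component of [theta'] on the bracket is the Xhat-derivative of that component on [Yh],
    because both [theta0] and the [Ih] are invariant; the latter is identically zero. *)
Lemma hat_lift_bracket Y Yh : is_field Y -> hat_lift Ih theta0 prh Y Yh ->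
  hat_lift Ih theta0 prh (bracket X Y) (bracket Xhat Yh).
Proof.
move=> fY [fYh hY rY]; have fB := field_bracket fXhat fYh; split => // [u|].
  split; first exact: field_tangent.
  apply/theta'_eq0P; split=> [|al].
    rewrite -lie_theta0 // (_ : (fun y => _) = fun=> 0) ?(tangent_cst 0 (field_tangent u fXhat)) //.
    by apply/funext => y; have [_ /theta'_eq0P[]] := hY y.
  have fIY := endo_smooth (eI al) fYh.
  have := lie_theta0 u fIY; rewrite lieI // /appl => <-.
  rewrite (_ : (fun y => _) = fun=> 0) ?(tangent_cst 0 (field_tangent u fXhat)) //.
  by apply/funext => y; have [_ /theta'_eq0P[]] := hY y.
exact: (related_bracket sprh fXhat fYh fX fY rX rY).
Qed.

(** As brackets of Xhat with lifts are again lifts, each of the three terms is the image of its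
    Obata counterpart, and the sum of those vanishes. *)
Lemma lie_nablabar_eq0 Y W : is_field Y -> is_field W -> lie_conn X nablabar Y W = 0.
Proof.
move=> fY fW; have [hc hn] := hnablabar; have [hc0 _ _] := hnabla0.
have [Yh hY] := hat_lift_exists fY; have [Wh hW] := hat_lift_exists fW.
have hXY := hat_lift_bracket fY hY; have hXW := hat_lift_bracket fW hW.
have fXY := field_bracket fX fY; have fXW := field_bracket fX fW.
have [fYh _ _] := hY; have [fWh _ _] := hW.
have fN := conn_field hc0 fYh fWh; have fNb := conn_field hc fY fW.
have r1 := related_bracket sprh fXhat fN fX fNb rX (hn _ _ _ _ fY fW hY hW).
have r2 := hn _ _ _ _ fXY fW hXY hW; have r3 := hn _ _ _ _ fY fXW hY hXW.
have r := relatedB (relatedB r1 r2) r3.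
apply/funext => y; have [u <-] := quot_surj hprh y.
rewrite -[LHS]r -[X in push prh X]/(lie_conn Xhat nabla0 Yh Wh u).
by rewrite (lie_obata_eq0 eI anti hnabla0 fXhat lieI fYh fWh) push0.
Qed.

(* T = sum c_al Ih_al satisfies T^2 = - (sum c_al^2) and preserves D, so that
   T w in D yields w in D unless c = 0. *)
Lemma Ih_independent u w (c : 'I_3 -> R) : horizontal Ih theta0 u w -> w <> 0 ->
  D u (\sum_al c al *: Ih al u w) -> forall al, c al = 0.
Proof.
move=> [tw hw] w0 DT.
have tIw al : tangent u (Ih al u w) by exact: tI.
have DTT : D u (\sum_be c be *: Ih be u (\sum_al c al *: Ih al u w)).
  by apply: Dhat_sum => be; apply: Dhat_scale; exact: Dhat_Ih.
have E : (\sum_be c be *: Ih be u (\sum_al c al *: Ih al u w)) =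
    \sum_be \sum_al (c be * c al) *: Ih be u (Ih al u w).
  apply: eq_bigr => be _; rewrite (tlinear_sum c (lI be (u := u))) // scaler_sumr.
  by apply: eq_bigr => al _; rewrite scalerA.
pose n := \sum_al c al * c al.
have D2 : D u ((- 2 * n) *: w).
  (* The square of T is doubled and symmetrised so that only anticommutators appear. *)
  have -> : (- 2 * n) *: w = \sum_be \sum_al (c be * c al) *: Ih be u (Ih al u w) +
      \sum_be \sum_al (c be * c al) *: Ih be u (Ih al u w).
    rewrite [X in _ = _ + X]exchange_big -big_split /= /n mulr_sumr scaler_suml.
    apply: eq_bigr => be _; rewrite -big_split (bigD1 be) //= big1 ?addr0 => [|al ab].
      by rewrite -scalerDr anti // eqxx scalerA mulr1 mulrC.
    by rewrite [c al * _]mulrC -scalerDr anti // eq_sym (negbTE ab) mulr0 scale0r scaler0.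
  by rewrite -E; exact: Dhat_add.
have n0 : n = 0.
  apply/eqP; apply/negPn/negP => n0; apply: w0.
  have k0 : - 2 * n != 0 by rewrite mulf_neq0 // oppr_eq0 pnatr_eq0.
  apply: (@Dhat_horizontal_eq0 u) => //.
  by have := Dhat_scale (- 2 * n)^-1 D2; rewrite scalerA mulVf // scale1r.
have c2 al : 0 <= c al * c al by rewrite -expr2 sqr_ge0.
move=> al; have := psumr_eq0P (P := xpredT) (fun i _ => c2 i) n0 (i := al) isT.
by move/eqP; rewrite mulf_eq0 orbb => /eqP.
Qed.

Lemma hat_lift_at u w Y Yh : horizontal Ih theta0 u w -> hat_lift Ih theta0 prh Y Yh ->
  Y (prh u) = push prh w -> Yh u = w.
Proof.
move=> [tw hw] [fYh hY rY] Yw; have [tY hYu] := hY u.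
apply/eqP; rewrite -subr_eq0 -scaleN1r addrC; apply/eqP.
have tS : tangent u (- 1 *: w + Yh u) by exact: tangentP_linear.
apply: (@Dhat_horizontal_eq0 u).
  by apply/(quot_kernel hprh tS); rewrite push_linear rY Yw scaleN1r addNr.
by apply/rowP => a; rewrite (form1_linear (form1_theta' a)) // hw hYu !mxE mulr0 addr0.
Qed.

(** * Lie derivatives of sections of Qbar *)

Section Sections.
Variable A : endo Mbar.
Hypothesis eA : is_endo A.
Variable a : Mhat -> 'I_3 -> R.
Hypothesis aE : forall u w, horizontal Ih theta0 u w ->
  A (prh u) (push prh w) = \sum_(al < 3) a u al *: push prh (Ih al u w).

(* The functions a_al solve a smooth linear system, of full rank at a point where
   the vector field that is lifted does not vanish. *)
Lemma smooth_coefficients al : (0 < mdim Mbar)%N -> smooth (fun u => a u al).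
Proof.
move=> d0; apply/smoothP => u.
have [C [E [sC fE /nbhs_singleton[CE ED]]]] := local_frame_at (prh u).
have fY := fE (Ordinal d0); have [Yh hY] := hat_lift_exists fY.
have [fYh hYh rY] := hY; set Y := E (Ordinal d0) in fY hY rY *.
have fIY be := endo_smooth (eI be) fYh.
have sCp j : smooth (C j \o prh) by exact: sprh.
(* The field [Y] belongs to a frame and takes the value 1 on its own coordinate, so its lift cannot
   vanish at [u]; [Ih_independent] requires this. *)
have w0 : Yh u <> 0.
  move=> e0; have := ED (Ordinal d0) (Ordinal d0); rewrite eqxx -/Y -rY e0 push0.
  by move/esym/eqP; rewrite oner_eq0.
have := @smooth_solve R Mhat 3 (mdim Mbar) (fun y => \row_be a y be)
  (fun y => \matrix_(be, j) Ih be y (Yh y) (C j \o prh))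
  (fun y => \row_j A (prh y) (Y (prh y)) (C j)) u.
move=> H; suff: smooth_at (fun y => (\row_be a y be) 0 al) u.
  by under eq_fun do rewrite mxE.
apply: H => [be j|j||].
- under eq_fun do rewrite mxE; apply: smooth_at_smooth.
  exact: (field_smooth (fIY be)).
- under eq_fun do rewrite mxE; apply: smooth_at_smooth.
  exact: (sprh (field_smooth (endo_smooth eA fY) (sC j))).
(* A left kernel vector gives a combination of the [Ih ga (Yh u)] killed by [push prh], that is,
   lying in D; independence makes it zero. *)
- rewrite -kermx_eq0; apply/eqP/row_matrixP => i0; rewrite row0.
  set K := kermx _; have : row i0 K *m (\matrix_(be, j) Ih be u (Yh u) (C j \o prh)) = 0.
    by rewrite -row_mul mulmx_ker row0.
  move: (row i0 K) => z zC; apply/rowP => be; rewrite mxE.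
  have tIY ga : tangent u (Ih ga u (Yh u)) by apply: tI; exact: field_tangent.
  have tS : tangent u (\sum_ga z 0 ga *: Ih ga u (Yh u)).
    by apply: tangent_sumv => ga; exact: tangent_scale.
  apply: (Ih_independent (c := fun ga => z 0 ga) (hYh u) w0).
  apply/(quot_kernel hprh tS); rewrite (CE _ (push_tangent sprh tS)) big1 // => j _.
  rewrite pushE // sum_tvecE.
  have := congr1 (fun B : 'rV[R]_(mdim Mbar) => B 0 j) zC; rewrite !mxE => zj.
  rewrite (_ : \sum_ga _ = 0) ?scale0r // -[RHS]zj.
  by apply: eq_bigr => ga _; rewrite mxE.
- apply: nearW => y; apply/rowP => j; rewrite !mxE -rY aE // sum_tvecE.
  by apply: eq_bigr => be _; rewrite !mxE -pushE.
Qed.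

(** The field [appl A Y] is the image of the sum of the a_al Ih_al Yh. By the Leibniz rule its
    bracket with Xhat has terms differentiating a_al, which remain, and terms a_al Ih_al [Xhat, Yh],
    which project to [A] applied to [X, Y] and cancel. *)
Lemma lie_section u w Y : (0 < mdim Mbar)%N -> horizontal Ih theta0 u w -> is_field Y ->
  Y (prh u) = push prh w ->
  lie_endo X A Y (prh u) = \sum_(al < 3) Xhat u (a^~ al) *: push prh (Ih al u w).
Proof.
move=> d0 hw fY Yw; have sa al := smooth_coefficients al d0.
have [Yh hY] := hat_lift_exists fY; have Yhw := hat_lift_at hw hY Yw.
have [fYh hYh rY] := hY; have [_ hB rB] := hat_lift_bracket fY hY.
have fIY al := endo_smooth (eI al) fYh.
have fA := endo_smooth eA fY.
have faI al := fieldZ (sa al) (fIY al).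
pose W : field Mhat := fun u => \sum_al a u al *: appl (Ih al) Yh u.
have fW : is_field W by apply: field_sum => al; exact: faI.
have rW : related prh W (appl A Y).
  move=> y; rewrite /appl -rY aE // /W push_sum; apply: eq_bigr => al _.
  by rewrite pushZ.
rewrite -[LHS]/(bracket X (appl A Y) (prh u) - A (prh u) (bracket X Y (prh u))).
rewrite -(related_bracket sprh fXhat fW fX fA rX rW) -rB aE //.
rewrite (bracket_sumr fXhat faI) push_sum -sumrB; apply: eq_bigr => al _.
rewrite (bracketZr fXhat (fIY al) (sa al)) lieI // pushD !pushZ addrK.
by rewrite /appl Yhw.
Qed.

End Sections.

Lemma descent_affine_quaternionic :
  affine_quaternionic (section_Qbar Ih theta0 prh) nablabar X.
Proof.
split=> [A [eA HA]|]; last exact: lie_nablabar_eq0.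
have [B eB HB] := lie_endo_appl fX eA.
have [a aE] := choice HA.
exists B => //; split => // u.
(* In dimension zero the coefficients of [A] are undetermined and need not be smooth, but all
   tangent vectors vanish and zero coefficients serve. *)
have [d0|d0] := posnP (mdim Mbar).
  exists (fun=> 0) => w [tw _].
  have [C [E [_ _ /nbhs_singleton[CE _]]]] := local_frame_at (prh u).
  have tB := endo_tangent eB (push_tangent sprh tw).
  rewrite (CE _ tB) !big1 // => i _; first by rewrite scale0r.
  by suff : (i < 0)%N by []; rewrite -[X in (_ < X)%N]d0.
exists (fun al => Xhat u (a^~ al)) => w hw; have [tw _] := hw.
have [Y fY Yw] := tangent_field (push_tangent sprh tw).
rewrite -(lie_section eA aE d0 hw fY Yw) HB // /appl Yw //.
Qed.

End Descent.

(** The descent along [prh] uses six facts about [Mhat]: anticommutation of the [Ih], the values of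
    [theta0] on V and on the Ih V, the products Ih Ih V, and the invariance of the [Ih] and of
    [theta0] under Xhat. All are obtained through [prt]. *)
Theorem proposition4p7 (R : realType) (M P Mhat Mbar : manifold R)
  (I : 'I_3 -> endo M) (Theta : form2 M) (Z : field M) (f : M -> R)
  (hI : hypercomplex I)
  (hTheta : is_form2 Theta) (dTheta : closed2 Theta)
  (hZ : rotating I Z)
  (LZTheta : forall Y W, is_field Y -> is_field W ->
     forall x, lie_form2 Z Theta Y W x = 0)
  (hf : smooth f)
  (df : forall x v, tangent x v -> v f = - iota2 Z Theta x v)
  (f1_neq0 : forall x, f1_of Theta Z (I idx1) f x != 0)
  (act : R -> P -> P) (prj : P -> M) (hP : principal_U1 act prj)
  (eta : form1 P) (xi : R) (heta : connection_form act eta xi)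
  (deta : has_curvature prj eta Theta Z (I idx1))
  (Zh : field P) (hZh : is_field Zh)
  (ZhE : forall p, eta_lift prj eta p (Z (prj p)) (Zh p))
  (V1 : field (Mtilde P))
  (V1E : V1 = V1_of (Z1_of prj (f1_of Theta Z (I idx1) f) Zh (fundamental act xi)))
  (prt : Mtilde P -> Mhat)
  (hprt : quotient_submersion (same_integral_curve V1)
     (fun u => [set v | exists a : R, v = a *: V1 u]) prt)
  (It : 'I_3 -> endo (Mtilde P)) (hIt : is_Itilde prj eta I V1 It)
  (Ih : 'I_3 -> endo Mhat) (hIh : forall al, is_endo (Ih al))
  (IhE : forall al u v, tangent u v ->
     push prt (It al u v) = Ih al (prt u) (push prt v))
  (V : field Mhat) (hV : is_field V)
  (VE : related prt (lift_H (eR 0)) V)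
  (nabla0 : conn Mhat) (hnabla0 : obata Ih nabla0)
  (prh : Mhat -> Mbar)
  (hprh : quotient_submersion (same_leaf (Dhat Ih V)) (Dhat Ih V) prh)
  (theta0 : form1 Mhat) (htheta0 : is_form1 theta0)
  (theta0E : forall (u : Mtilde P) v, tangent u v ->
     theta0 (prt u) (push prt v) = phi0 u.1 (push (fun u' : Mtilde P => u'.1) v))
  (nablabar : conn Mbar)
  (hnablabar : is_nablabar Ih theta0 prh nabla0 nablabar)
  (Xhat : field Mhat) (hXhat : is_field Xhat)
  (XhatE : related prt (lift_P (fundamental act xi)) Xhat)
  (X : field Mbar) (hX : is_field X)
  (XE : related prh Xhat X) :
  affine_quaternionic (section_Qbar Ih theta0 prh) nablabar X.
Proof.
apply: (@descent_affine_quaternionic R Mhat Mbar Ih V theta0 prh nabla0 nablabar Xhat X) => //.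
- by move=> al be x w; apply: (Ih_anticommute hI f1_neq0 hP heta ZhE V1E hprt hIt IhE).
- by move=> x; apply: (theta0_V hprt VE theta0E).
- by move=> al x; apply: (theta0_Ih_V hprt hIt IhE VE theta0E).
- by move=> al be x; apply: (Ih_Ih_V hprt hIt IhE VE).
- by move=> al Y; apply: (bracket_Xhat_Ih hI f1_neq0 hP heta ZhE V1E hprt hIt hIh IhE hXhat XhatE).
- move=> Y x fY; exact: (Xhat_theta0 f1_neq0 hP heta ZhE V1E hprt htheta0 theta0E hXhat XhatE x fY).
Qed.
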